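(* Let $(\mathcal Z,d)$ be a Polish metric space, let $\mathcal X\subset\mathcal Z$ be a Polish space contained in it, let $\mathbf x_1,\dots,\mathbf x_m\in\mathcal X$ be pairwise distinct, and let $P=\sum_{k=1}^m p_k\delta_{\mathbf x_k}$ with $p_k>0$ for all $k$ and $\sum_{k=1}^m p_k=1$. Let $Q$ be a Borel probability measure on $\mathcal Z$ such that $$\int d(\mathbf y,\mathbf x_0)\,dQ(\mathbf y)<\infty\quad\text{for some }\mathbf x_0\in\mathcal X.$$ Let $P_n$ be the empirical measure of an i.i.d. sample of size $n$ with law $P$. Then, for any $p\ge1$, as $n\to\infty$, $$\sqrt n\,\bigl(\mathcal W_p(P_n,Q)-\mathcal W_p(P,Q)\bigr)\ \overset{w}{\longrightarrow}\ \frac{1}{p\,(\mathcal W_p(P,Q))^{p-1}}\ \sup_{\mathbf z\in\operatorname{Opt}_{d^p}(P,Q)}\ \sum_{i=1}^m z_iX_i,$$ where $(X_1,\dots,X_m)\sim\mathcal N(\mathbf 0,\Sigma(\mathbf p))$.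
   Context: $\overset{w}{\longrightarrow}$ denotes convergence in distribution. For a cost $c:\mathcal Z\times\mathcal Z\to[0,\infty)$, $\mathcal T_c(P,Q)=\inf_{\pi\in\Pi(P,Q)}\int c(\mathbf x,\mathbf y)\,d\pi(\mathbf x,\mathbf y)$, where $\Pi(P,Q)$ is the set of Borel probability measures on $\mathcal Z\times\mathcal Z$ with marginals $P$ and $Q$; $\mathcal W_p(P,Q)=(\mathcal T_{d^p}(P,Q))^{1/p}$ is the $p$-Wasserstein distance. If $X^{(1)},\dots,X^{(n)}$ are i.i.d. with law $P$, then $P_n=\frac1n\sum_{k=1}^n\delta_{X^{(k)}}$. Write $\mathbf p=(p_1,\dots,p_m)$ for the vector of weights of $P$ (not to be confused with the exponent $p$). For the cost $d^p$ and $\mathbf z\in\mathbb R^m$, $$\mathcal M(\mathbf z,\mathbf p)=\frac{1}{\|\mathbf p\|_1}\sum_{k=1}^m |p_k|z_k+\int\min_{i=1,\dots,m}\{d(\mathbf y,\mathbf x_i)^p-z_i\}\,dQ(\mathbf y),\qquad \|\mathbf p\|_1=\sum_{k=1}^m|p_k|$$ (so $\|\mathbf p\|_1=1$ here), and $\operatorname{Opt}_{d^p}(P,Q)=\{\mathbf z\in\mathbb R^m:\ \mathcal T_{d^p}(P,Q)=\mathcal M(\mathbf z,\mathbf p)\}$. $\Sigma(\mathbf p)$ is the $m\times m$ matrix with entries $\Sigma(\mathbf p)_{ii}=p_i(1-p_i)$ and $\Sigma(\mathbf p)_{ij}=-p_ip_j$ for $i\ne j$. *)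

(* Defs.v *)
From HB Require Import structures.
From mathcomp Require Import all_boot all_order all_algebra.
From mathcomp Require Import all_classical all_reals all_analysis.
From mathcomp Require Import measurable_realfun.

Set Implicit Arguments.
Unset Strict Implicit.
Unset Printing Implicit Defensive.

Import Order.TTheory GRing.Theory Num.Theory.
Import numFieldNormedType.Exports.

Local Open Scope classical_set_scope.
Local Open Scope ring_scope.
Local Open Scope ereal_scope.

HB.mixin Record isBorel (d : measure_display) T
    & Measurable d T & Topological T := {
  measurable_borel : @measurable d T = <<s @open T >> }.

#[short(type="borelMetricType")]
HB.structure Definition BorelMetric (d : measure_display) (R : realType) :=
  {T of Measurable d T & Metric R T & isBorel d T}.

Definition separable (T : topologicalType) : Prop :=
  exists2 D : set T, countable D & dense D.

Definition completely_metrizable (R : realType) (T : topologicalType) : Prop :=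
  exists rho : T -> T -> R,
    [/\ [/\ forall x y, (rho x y = 0 <-> x = y)%R,
            forall x y, rho x y = rho y x &
            forall x y z, (rho x z <= rho x y + rho y z)%R],
        forall (x : T) (A : set T), nbhs x A <->
          exists2 e : R, (0 < e)%R & [set y | (rho x y < e)%R] `<=` A
      & forall u : nat -> T,
          (forall e : R, (0 < e)%R -> exists N : nat,
             forall i j, (N <= i)%N -> (N <= j)%N -> (rho (u i) (u j) < e)%R) ->
          exists l : T, u @ \oo --> l].

Definition polish (R : realType) (T : topologicalType) : Prop :=
  separable T /\ completely_metrizable R T.

Section transport.
Context {R : realType} {d : measure_display} {Z : borelMetricType d R}.
Implicit Types (P Q : {measure set Z -> \bar R}) (p : R).

(* The product sigma-algebra carried by Z * Z is the Borel one as soon as Z is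
   separable. *)
Definition couplings P Q : set (probability (Z * Z)%type R) :=
  [set pi | forall A : set Z, measurable A ->
     pi (A `*` setT) = P A /\ pi (setT `*` A) = Q A].

Definition transport_cost (c : Z -> Z -> R) P Q : \bar R :=
  ereal_inf [set \int[pi]_u (c u.1 u.2)%:E | pi in couplings P Q].

Definition dist_pow p (x y : Z) : R := mdist x y `^ p.

Definition wasserstein p P Q : \bar R :=
  (transport_cost (dist_pow p) P Q) `^ p^-1.

Definition l1norm (m : nat) (v : 'rV[R]_m) : R := (\sum_k `|v 0 k|)%R.

Definition dual_objective (m : nat) (x : 'I_m -> Z) Q p (z v : 'rV[R]_m) :
    \bar R :=
  ((l1norm v)^-1 * \sum_k `|v 0 k| * z 0 k)%:E +
  \int[Q]_y \big[mine/+oo]_(i < m) (dist_pow p y (x i) - z 0 i)%:E.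

Definition Opt (m : nat) (x : 'I_m -> Z) (v : 'rV[R]_m) P Q p :
    set 'rV[R]_m :=
  [set z | transport_cost (dist_pow p) P Q = dual_objective x Q p z v].

Definition empirical_measure (n : nat) (X : nat -> Z) :
    {measure set Z -> \bar R} :=
  mscale ((n%:R^-1)%:nng)%R (msum (fun k => \d_(X k)) n).

End transport.

Definition iid_sample {R : realType} {d d' : measure_display}
    {Omega : measurableType d} {T : measurableType d'}
    (Pr : probability Omega R) (P : probability T R)
    (X : nat -> {RV Pr >-> T}) : Prop :=
  (forall (k : nat) (A : set T), measurable A ->
     distribution Pr (X k) A = P A) /\
  (forall (J : seq nat) (A : nat -> set T), uniq J ->
     (forall k, measurable (A k)) ->
     Pr (\bigcap_(k in [set` J]) (X k @^-1` A k)) =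
     \prod_(k <- J) Pr (X k @^-1` A k)).

Definition multinomial_cov {R : realType} (m : nat) (v : 'rV[R]_m) : 'M[R]_m :=
  (\matrix_(i, j) if i == j then v 0 i * (1 - v 0 i) else - (v 0 i * v 0 j))%R.

(* [normal_prob 0 0] is the uniform law on [0, 1], not the Dirac mass at 0. *)
Definition centered_normal {R : realType} (v : R) : set R -> \bar R :=
  if v == 0%R then \d_(0%R : R) else normal_prob 0 (Num.sqrt v).

(* S may be singular, so there is no density: Y ~ N(0, S) means that every
   linear combination t.Y has the centered normal law of variance t S t^T. *)
Definition centered_gaussian_vector {R : realType} {d : measure_display}
    {Omega : measurableType d} (Pr : probability Omega R) (m : nat)
    (S : 'M[R]_m) (Y : 'I_m -> {RV Pr >-> R}) : Prop :=
  forall (t : 'rV[R]_m) (A : set R), measurable A ->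
    Pr [set w | A (\sum_i t 0 i * Y i w)%R] =
    centered_normal ((t *m S *m t^T) 0 0)%R A.

(* For real-valued U and V this is the usual convergence in distribution;
   extended values are allowed so that the limit may be infinite. *)
Definition cvg_in_distribution {R : realType} {d d' : measure_display}
    {Omega : measurableType d} {Omega' : measurableType d'}
    (Pr : probability Omega R) (Pr' : probability Omega' R)
    (U : nat -> Omega -> \bar R) (V : Omega' -> \bar R) : Prop :=
  [/\ forall n, measurable_fun setT (U n),
      measurable_fun setT V
    & forall f : \bar R -> R, continuous f ->
        (exists M : R, forall y, (`|f y| <= M)%R) ->
        'E_Pr[f \o U n] @[n --> \oo] --> 'E_Pr'[f \o V]].

(* Main.v *)
(** By Kantorovich duality, the cost of transporting [sum_k v_k delta_(x_k)] to
    [Q] is the maximum over [z] of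
    [sum_k v_k z_k + int min_k (d(x_k, y)^p - z_k) dQ(y)], a function of [z] that
    is Lipschitz, invariant under adding constants, and coercive modulo
    constants. Absence of a duality gap comes from entropic regularisation: at a
    maximiser of the soft-min dual, the Gibbs weights form a transport plan.

    As a function of [v] the maximum has, in every direction [h] with
    [sum_k h_k = 0], a derivative equal to the support function of [Opt] at [h],
    uniformly for bounded [h]. The normalised empirical weights are a random walk
    with multinomial steps, so the central limit theorem for this walk and the
    derivative of [t |-> t^(1/p)] give the limit. The central limit theorem is
    proved for cosines by a Taylor expansion, and then for Lipschitz functions,
    which are limits of trigonometric polynomials.

    Two degenerate cases rest on conventions. If the cost vanishes and [p > 1],
    every small [z] is optimal, the fluctuations escape to [+oo], and so does the
    limit because [0^-1 = +oo] (for [m = 1] both sides are [0]). If [Q] has no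
    [p]-th moment, then [fine +oo = 0] and [(+oo)^-1 = 0] make both sides [0]. *)

Require Import Defs.
From HB Require Import structures.
From mathcomp Require Import all_boot all_order all_algebra.
From mathcomp Require Import all_classical all_reals all_analysis.
From mathcomp Require Import measurable_realfun.
From mathcomp Require Import ring lra.

Set Implicit Arguments.
Unset Strict Implicit.
Unset Printing Implicit Defensive.

Import Order.TTheory GRing.Theory Num.Theory.
Import numFieldNormedType.Exports.

Local Open Scope classical_set_scope.
Local Open Scope ring_scope.

(** * Random walks *)

(** The sample enters through one device: for [n] independent draws from finitely many atoms, an
    expectation is the [n]-th iterate of a finite averaging operator on functions. The central limit
    theorem becomes an estimate on these iterates, and the same operator, with weights depending on
    a parameter, produces the trigonometric approximations. The obstacle is that the limit
    functional is a supremum over a set unbounded along constants. The walk keeps sum_i h_i = 0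
    exactly, and in such directions a compact box of optimal potentials gives the same supremum,
    hence a Lipschitz functional. The Gaussian vector has sum zero only almost surely; off that
    event the supremum is [+oo]. The rescaled functionals depend on [n] and are controlled uniformly
    only on bounded sets of [h]; the rest is paid for by second moments. When the cost vanishes,
    uniformity is also restricted to [h_0] away from 0, and the excluded region is small because the
    first Gaussian coordinate has no atom at 0. The sample lies on the atoms only almost surely, so
    measurability of the fluctuation is proved for arbitrary sample points, through duality with
    equal weights. *)

Section walk.
Context {R : realType} {V : zmodType} {J : finType}.
Variables (pr : J -> R) (a : J -> V).

(** The transition operator of the walk with step [a j] taken with probability [pr j]:
    [iter n walk g s] is the mean of [g] after [n] independent steps from [s]. *)
Definition walk (g : V -> R) : V -> R := fun s => \sum_j pr j * g (s + a j).

Lemma walkZ_iter n c g s :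
  iter n walk (fun s => c * g s) s = c * iter n walk g s.
Proof.
elim: n s => [|n IH] s //=; rewrite /walk mulr_sumr; apply: eq_bigr => j _.
by rewrite [X in _ * X]IH mulrCA.
Qed.

Lemma walkD_iter n f g s :
  iter n walk (fun s => f s + g s) s = iter n walk f s + iter n walk g s.
Proof.
elim: n s => [|n IH] s //=; rewrite /walk -big_split; apply: eq_bigr => j _.
by rewrite [X in _ * X]IH mulrDr.
Qed.

Lemma walk_sum_iter n (I : Type) (r : seq I) (f : I -> V -> R) s :
  iter n walk (fun s => \sum_(i <- r) f i s) s =
  \sum_(i <- r) iter n walk (f i) s.
Proof.
elim: n s => [|n IH] s //=; rewrite /walk exchange_big; apply: eq_bigr => j _.
by rewrite [X in _ * X]IH mulr_sumr.
Qed.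

Hypothesis pr_ge0 : forall j, 0 <= pr j.
Hypothesis pr_sum1 : \sum_j pr j = 1.

Lemma iter_walk_cst n c s : iter n walk (fun=> c) s = c.
Proof.
elim: n s => [|n IH] s //=; rewrite /walk.
under eq_bigr do rewrite IH.
by rewrite -mulr_suml pr_sum1 mul1r.
Qed.

(** Averaging preserves pointwise bounds. The set [D], stable under the steps, restricts the
    comparison to reachable states; for the multinomial walk it is the hyperplane of sum zero. *)
Lemma iter_walk_dist (D : V -> Prop) n g h b s :
    (forall s j, D s -> D (s + a j)) ->
    (forall s, D s -> `|g s - h s| <= b s) ->
  D s -> `|iter n walk g s - iter n walk h s| <= iter n walk b s.
Proof.
move=> Da ghb; elim: n s => [|n IH] s Ds /=; first exact: ghb.
rewrite /walk -sumrB (le_trans (ler_norm_sum _ _ _))//.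
apply: ler_sum => j _; rewrite -mulrBr normrM ger0_norm// ler_wpM2l//.
exact/IH/Da.
Qed.

(** Squared bias plus variance: the mean of [l] moves by [mean] at each step, and the variances of
    independent steps add up. *)
Lemma iter_walk_sqr (l : V -> R) (b : R) n s :
    (forall s t, l (s + t) = l s + l t) ->
    let mean := \sum_j pr j * l (a j) in
  iter n walk (fun s => (l s - b) ^+ 2) s =
  (l s + n%:R * mean - b) ^+ 2 +
    n%:R * (\sum_j pr j * l (a j) ^+ 2 - mean ^+ 2).
Proof.
move=> lD mean; elim: n s => [|n IH] s; first by rewrite /= !mul0r !addr0.
transitivity (\sum_j pr j *
  iter n walk (fun s => (l s - b) ^+ 2) (s + a j)) => //.
under eq_bigr do rewrite IH lD.
set q := \sum_j pr j * l (a j) ^+ 2; set K := n%:R * (q - _).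
pose u := l s + n%:R * mean - b.
rewrite (eq_bigr (fun j => pr j * (u ^+ 2 + K) + (pr j * l (a j)) * (2 * u) +
   pr j * l (a j) ^+ 2)); last by move=> j _; rewrite /u; ring.
rewrite !big_split /= -!mulr_suml pr_sum1 -/q -/mean.
by rewrite /u /K -natr1; ring.
Qed.

End walk.

(** * Taylor bounds for sine and cosine *)

Section taylor_bounds.
Context {R : realType}.
Implicit Types (f df : R -> R) (u : R).

(** The mean value theorem gains one power of [|u|]. The factor 1/(k + 1) of an integration is given
    up, so every bound below has constant 1. *)
Lemma norm_le_pow_of_derive f df (K : R) k u :
    (forall x, is_derive x (1 : R) f (df x)) -> f 0 = 0 ->
    (forall x, `|df x| <= K * `|x| ^+ k) ->
  `|f u| <= K * `|u| ^+ k.+1.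
Proof.
move=> fdf f0 dfK.
have cf (a b : R) : {within `[a, b], continuous f}.
  by apply: derivable_within_continuous => x _; have [] := fdf x.
suff [c cu ->] : exists2 c, `|c| <= `|u| & f u = df c * u.
  rewrite normrM exprSr mulrA ler_wpM2r// (le_trans (dfK c))//.
  have K0 : 0 <= K by have := dfK 1; rewrite normr1 expr1n mulr1; exact: le_trans.
  by rewrite ler_wpM2l// lerXn2r// nnegrE.
have [u0|u0] := leP 0 u.
  have [c] := MVT_segment u0 (fun x _ => fdf x) (cf _ _).
  rewrite in_itv/= f0 !subr0 => /andP[c0 cu] ->; exists c => //.
  by rewrite !ger0_norm.
have [c] := MVT_segment (ltW u0) (fun x _ => fdf x) (cf _ _).
rewrite in_itv/= f0 !sub0r => /andP[uc c0] E; exists c.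
  by rewrite !ler0_norm ?lerN2// ltW.
by rewrite -[f u]opprK E mulrN opprK.
Qed.

Lemma norm_sin_le u : `|sin u| <= `|u|.
Proof.
have := @norm_le_pow_of_derive sin cos 1 0 u _ (sin0 R).
by rewrite expr1 mul1r; apply=> x; rewrite expr0 mulr1 cos_max.
Qed.

Let is_derive_cosB1 x : is_derive x (1 : R) (fun x => cos x - 1) (- sin x).
Proof.
by have := is_deriveB (is_derive_cos x) (is_derive_cst (1 : R) x 1); rewrite subr0.
Qed.

Let is_derive_sinB x : is_derive x (1 : R) (fun x => sin x - x) (cos x - 1).
Proof. exact: is_deriveB (is_derive_sin x) (is_derive_id x 1). Qed.

Let is_derive_cos_taylor2 x :
  is_derive x (1 : R) (fun x => cos x - (1 - x ^+ 2 / 2)) (x - sin x).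
Proof.
have dx2 : is_derive x (1 : R) (fun x => x ^+ 2 / 2) x.
  have := is_deriveM (is_deriveM (is_derive_id x (1:R)) (is_derive_id x 1))
    (is_derive_cst (2^-1 : R) x 1).
  by rewrite /GRing.scale /= => /is_derive_eq; apply; field.
have := is_deriveB (is_derive_cos x) (is_deriveB (is_derive_cst (1 : R) x 1) dx2).
have -> // : x - sin x = - sin x - (0 - x) by ring.
Qed.

Lemma norm_cosB1_le1 u : `|cos u - 1| <= `|u|.
Proof.
have := @norm_le_pow_of_derive (fun x => cos x - 1) (fun x => - sin x) 1 0 u.
rewrite expr1 mul1r; apply => [||x]; [exact: is_derive_cosB1|by rewrite cos0 subrr|].
by rewrite expr0 mulr1 normrN sin_max.
Qed.

Lemma norm_cosB1_le u : `|cos u - 1| <= `|u| ^+ 2.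
Proof.
have := @norm_le_pow_of_derive (fun x => cos x - 1) (fun x => - sin x) 1 1 u.
rewrite mul1r; apply => [||x]; [exact: is_derive_cosB1|by rewrite cos0 subrr|].
by rewrite mul1r normrN norm_sin_le.
Qed.

Lemma norm_sinB_le2 u : `|sin u - u| <= `|u| ^+ 2.
Proof.
have := @norm_le_pow_of_derive _ _ 1 1 u is_derive_sinB.
rewrite mul1r; apply => [|x]; first by rewrite sin0 subrr.
by rewrite mul1r norm_cosB1_le1.
Qed.

Lemma norm_sinB_le3 u : `|sin u - u| <= `|u| ^+ 3.
Proof.
have := @norm_le_pow_of_derive _ _ 1 2 u is_derive_sinB.
rewrite mul1r; apply => [|x]; first by rewrite sin0 subrr.
by rewrite mul1r norm_cosB1_le.
Qed.

Lemma norm_cos_taylor2_le u : `|cos u - (1 - u ^+ 2 / 2)| <= `|u| ^+ 4.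
Proof.
have := @norm_le_pow_of_derive (fun x => cos x - (1 - x ^+ 2 / 2))
  (fun x => x - sin x) 1 3 u.
rewrite mul1r; apply => [||x]; [exact: is_derive_cos_taylor2| |].
  by rewrite cos0 expr0n mul0r subr0 subrr.
by rewrite mul1r distrC norm_sinB_le3.
Qed.

End taylor_bounds.

(** * Trigonometric polynomials in several variables *)

Section trig_polynomials.
Context {R : realType} {m : nat}.
Implicit Types (f g : 'rV[R]_m -> R) (t y : 'rV[R]_m).

Definition dotr t y : R := \sum_i t 0 i * y 0 i.

(** An entry of [l] holds amplitude, frequency and phase. The phase brings sines into the class and
    lets products be expanded with cosines alone. *)
Definition trig f := exists l : seq (R * 'rV[R]_m * R),
  forall y, f y = \sum_(u <- l) u.1.1 * cos (dotr u.1.2 y + u.2).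

Lemma dotrD t t' y : dotr (t + t') y = dotr t y + dotr t' y.
Proof. by rewrite -big_split; apply: eq_bigr => i _; rewrite mxE mulrDl. Qed.

Lemma dotrB t t' y : dotr (t - t') y = dotr t y - dotr t' y.
Proof. by rewrite -sumrB; apply: eq_bigr => i _; rewrite !mxE mulrBl. Qed.

Lemma dotrDr t y y' : dotr t (y + y') = dotr t y + dotr t y'.
Proof. by rewrite -big_split; apply: eq_bigr => i _; rewrite mxE mulrDr. Qed.

Lemma dotr_delta c i y : dotr (c *: delta_mx 0 i) y = c * y 0 i.
Proof.
rewrite /dotr (bigD1 i)//= !mxE !eqxx mulr1 big1 ?addr0// => j ji.
by rewrite !mxE eqxx (negbTE ji) mulr0 mul0r.
Qed.

Lemma trig_ext f g : f =1 g -> trig f -> trig g.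
Proof. by move=> fg [l fl]; exists l => y; rewrite -fg. Qed.

Lemma trig_cos (c : R) t (th : R) : trig (fun y => c * cos (dotr t y + th)).
Proof. by exists [:: (c, t, th)] => y; rewrite big_seq1. Qed.

Lemma trig_cst (c : R) : trig (fun=> c).
Proof.
apply: trig_ext (trig_cos c 0 0) => y.
rewrite /dotr big1 ?addr0 ?cos0 ?mulr1// => i _.
by rewrite mxE mul0r.
Qed.

Lemma trigD f g : trig f -> trig g -> trig (fun y => f y + g y).
Proof. by move=> [l fl] [k gk]; exists (l ++ k) => y; rewrite big_cat fl gk. Qed.

Lemma trig_sum (I : Type) (r : seq I) (F : I -> 'rV[R]_m -> R) :
  (forall i, trig (F i)) -> trig (fun y => \sum_(i <- r) F i y).
Proof.
move=> tF; elim: r => [|i r IH].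
  by apply: trig_ext (trig_cst 0) => y; rewrite big_nil.
by apply: trig_ext (trigD (tF i) IH) => y; rewrite big_cons.
Qed.

Lemma trigM f g : trig f -> trig g -> trig (fun y => f y * g y).
Proof.
move=> [l fl] [k gk].
apply: (@trig_ext (fun y => \sum_(u <- l) \sum_(v <- k)
   (u.1.1 * v.1.1 / 2 * cos (dotr (u.1.2 + v.1.2) y + (u.2 + v.2)) +
    u.1.1 * v.1.1 / 2 * cos (dotr (u.1.2 - v.1.2) y + (u.2 - v.2))))).
  move=> y; rewrite fl gk mulr_suml; apply: eq_bigr => u _.
  rewrite mulr_sumr; apply: eq_bigr => v _.
  rewrite dotrD dotrB; set A := dotr u.1.2 y; set B := dotr v.1.2 y.
  have -> : A + B + (u.2 + v.2) = (A + u.2) + (B + v.2) by ring.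
  have -> : A - B + (u.2 - v.2) = (A + u.2) - (B + v.2) by ring.
  by rewrite (cosD (A + _)) (cosB (A + _)); field.
apply: trig_sum => u; apply: trig_sum => v.
by apply: trigD; exact: trig_cos.
Qed.

Lemma trig_sin (c : R) i : trig (fun y => sin (c * y 0 i)).
Proof.
apply: trig_ext (trig_cos 1 (c *: delta_mx 0 i) (- (pi / 2))) => y.
by rewrite dotr_delta mul1r cosBpihalf.
Qed.

(** The parameter [y] enters only through the probabilities, in which the mean after [n] steps is a
    polynomial: the mechanism of Bernstein polynomials. *)
Lemma trig_walk (V : zmodType) (J : finType) (pr : 'rV[R]_m -> J -> R)
    (a : J -> V) (g : V -> R) n s :
  (forall j, trig (pr ^~ j)) -> trig (fun y => iter n (walk (pr y) a) g s).
Proof.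
move=> tpr; elim: n s => [|n IH] s /=; first exact: trig_cst.
by apply: trig_sum => j; apply: trigM.
Qed.

Definition lipschitz1 (C : R) g :=
  forall s t, `|g s - g t| <= C * \sum_i `|s 0 i - t 0 i|.

Lemma lipschitz1_onesided (C : R) g :
  (forall s t, g s - g t <= C * \sum_i `|s 0 i - t 0 i|) -> lipschitz1 C g.
Proof.
move=> H s t; rewrite ler_norml H andbT lerNl opprB.
by under eq_bigr do rewrite distrC; exact: H.
Qed.

End trig_polynomials.

(** * Approximation of Lipschitz functions by trigonometric polynomials *)

Section trig_approximation.
Context {R : realType} {m' : nat}.
Local Notation m := m'.+1.
Implicit Types (g : 'rV[R]_m -> R) (y : 'rV[R]_m).

(* In state [s], a coordinate is drawn uniformly and moved up or down, with
   the bias making the mean position after [N] steps equal to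
   [L sin (y_i / L)]. *)
Definition trig_weight (L : R) y (j : 'I_m * bool) : R :=
  m%:R^-1 * ((1 + (-1) ^+ j.2 * sin (L^-1 * y 0 j.1)) / 2).

Definition trig_step (L : R) (N : nat) (j : 'I_m * bool) : 'rV[R]_m :=
  ((-1) ^+ j.2 * (m%:R * L / N%:R)) *: delta_mx 0 j.1.

(** A trigonometric Bernstein operator: the final position has mean close to [y] for large [L] and
    variance at most [m L^2 / N] in each coordinate, so [g] is averaged near [y]. *)
Definition trig_approx L N g y : R :=
  iter N (walk (trig_weight L y) (trig_step L N)) g 0.

Lemma trig_trig_approx L N g : trig (trig_approx L N g).
Proof.
apply: trig_walk => -[i b] /=; rewrite /trig_weight /=.
apply: trigM; first exact: trig_cst.
apply: trigM; last exact: trig_cst.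
apply: trigD; first exact: trig_cst.
by apply: trigM; [exact: trig_cst|exact: trig_sin].
Qed.

Lemma trig_weight_ge0 L y j : 0 <= trig_weight L y j.
Proof.
rewrite /trig_weight mulr_ge0// divr_ge0//.
have := sin_max (L^-1 * y 0 j.1); rewrite ler_norml => /andP[s1 s2].
by case: j.2; rewrite ?expr1 ?expr0; lra.
Qed.

Lemma trig_weight_sum1 L y : \sum_j trig_weight L y j = 1.
Proof.
rewrite -(pair_bigA _ (fun i b => trig_weight L y (i, b)))/=.
rewrite (eq_bigr (fun=> m%:R^-1)); last first.
  move=> i _; rewrite big_bool /trig_weight /= expr1 expr0.
  by move: (m%:R^-1 : R) => u; field.
by rewrite sumr_const card_ord -[LHS]mulr_natr mulVf// pnatr_eq0.
Qed.

Lemma trig_step_mean L N y i :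
  \sum_j trig_weight L y j * trig_step L N j 0 i = L * sin (L^-1 * y 0 i) / N%:R.
Proof.
rewrite -(pair_bigA _ (fun k b => trig_weight L y (k, b) * trig_step L N (k, b) 0 i))/=.
rewrite (bigD1 i)//= [X in _ + X]big1 ?addr0; last first.
  move=> k ki; rewrite big1// => b _.
  by rewrite !mxE eqxx eq_sym (negbTE ki) !mulr0.
rewrite big_bool /trig_weight /trig_step /= !mxE !eqxx expr1 expr0 /= !mulr1.
have : (m%:R : R) != 0 by rewrite pnatr_eq0.
move: (m%:R : R) (N%:R^-1 : R) => M N' M0; field; exact: M0.
Qed.

Lemma trig_step_sqr L N y i :
  \sum_j trig_weight L y j * trig_step L N j 0 i ^+ 2 =
  m%:R * L ^+ 2 / N%:R ^+ 2.
Proof.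
rewrite -(pair_bigA _ (fun k b => trig_weight L y (k, b) * trig_step L N (k, b) 0 i ^+ 2))/=.
rewrite (bigD1 i)//= [X in _ + X]big1 ?addr0; last first.
  move=> k ki; rewrite big1// => b _.
  by rewrite !mxE eqxx eq_sym (negbTE ki) !mulr0 expr0n mulr0.
rewrite big_bool /trig_weight /trig_step /= !mxE !eqxx expr1 expr0.
rewrite /= !mulr1 -exprVn.
have : (m%:R : R) != 0 by rewrite pnatr_eq0.
move: (m%:R : R) (N%:R^-1 : R) => M N' M0; field; exact: M0.
Qed.

(** Two sources of error: the spread of the walk around its mean, split by the free parameter [k]
    into [k] and variance over [k], and the distance from [L sin(y_i / L)] to [y_i], at most
    [y_i^2 / L]. *)
Lemma trig_approx_dist C g L N y (k : R) : 0 <= C -> lipschitz1 C g ->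
    0 < L -> (0 < N)%N -> 0 < k ->
  `|trig_approx L N g y - g y| <=
    C * \sum_(i < m) (k + k^-1 * (m%:R * L ^+ 2 / N%:R) + L^-1 * y 0 i ^+ 2).
Proof.
move=> C0 gC L0 N0 k0; rewrite -[g y](@iter_walk_cst _ _ _ _ (trig_step L N)
  (trig_weight_sum1 L y) N _ 0).
pose b (s : 'rV[R]_m) := C * \sum_(i < m) (k + k^-1 * (s 0 i - L * sin (L^-1 * y 0 i)) ^+ 2 +
   L^-1 * y 0 i ^+ 2) : R.
apply: le_trans (_ : _ <= iter N (walk (trig_weight L y) (trig_step L N)) b 0) _.
  apply: (@iter_walk_dist _ _ _ _ _ (trig_weight_ge0 L y) (fun=> True)) => // s _.
  rewrite (le_trans (gC _ _))// ler_wpM2l// ler_sum// => i _.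
  set u := L * sin _.
  rewrite (le_trans (_ : _ <= `|s 0 i - u| + `|u - y 0 i|))//.
    by rewrite (le_trans _ (ler_normD _ _))// addrA subrK.
  apply: lerD.
    (* From [(|v| - k)^2 >= 0] comes [|v| <= k + v^2 / k], which trades a first absolute moment for
       a variance. *)
    set v := s 0 i - u; have := sqr_ge0 (`|v| - k); rewrite sqrrB real_normK ?num_real//.
    rewrite -(ler_pM2l k0) mulrDr mulrA divff ?gt_eqF// mul1r => h.
    have kv : 0 <= k * `|v| by rewrite mulr_ge0// ltW.
    by rewrite mulrC -subr_ge0; move: h kv; rewrite -!expr2; set w := v ^+ 2; lra.
  rewrite /u -{2}[y 0 i](mulVKf (lt0r_neq0 L0)) -mulrBr normrM gtr0_norm//.
  rewrite (le_trans (ler_wpM2l (ltW L0) (norm_sinB_le2 _)))//.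
  rewrite normrM gtr0_norm ?invr_gt0// exprMn real_normK ?num_real//.
  by rewrite expr2 !mulrA divff ?gt_eqF// mul1r.
rewrite /b walkZ_iter ler_wpM2l// walk_sum_iter ler_sum// => i _.
rewrite walkD_iter (iter_walk_cst _ (trig_weight_sum1 L y)) lerD2r.
rewrite walkD_iter (iter_walk_cst _ (trig_weight_sum1 L y)) lerD2l.
rewrite walkZ_iter ler_wpM2l ?invr_ge0 ?(ltW k0)//.
have /= -> := @iter_walk_sqr _ _ _ _ (trig_step L N) (trig_weight_sum1 L y)
  (fun s : 'rV[R]_m => s 0 i) (L * sin (L^-1 * y 0 i)) N 0; last first.
  by move=> s t; rewrite mxE.
rewrite trig_step_mean trig_step_sqr mxE add0r.
have N0' : (N%:R : R) != 0 by rewrite pnatr_eq0 -lt0n.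
rewrite mulrC divfK// subrr expr0n add0r mulrBr.
rewrite lerBlDr; set e := m%:R * L ^+ 2.
rewrite expr2 invfM mulrCA [X in _ * X]mulrA divff// mul1r lerDl.
by rewrite mulr_ge0// sqr_ge0.
Qed.

End trig_approximation.

(** * Cosine moments of a scaled walk *)

Section walk_characteristic.
Context {R : realType} {m : nat} {J : finType}.
Variables (pr : J -> R) (a : J -> 'rV[R]_m) (t : 'rV[R]_m).
Hypothesis pr_ge0 : forall j, 0 <= pr j.
Hypothesis pr_sum1 : \sum_j pr j = 1.
Hypothesis mean0 : \sum_j pr j * dotr t (a j) = 0.

Let v := \sum_j pr j * dotr t (a j) ^+ 2.

Let v_ge0 : 0 <= v.
Proof. by apply: sumr_ge0 => j _; rewrite mulr_ge0// sqr_ge0. Qed.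

(** Squeezed by [expR (- u) <= 1 / (1 + u) <= 1 - u + u^2]; the last step is (1 - u + u^2)(1 + u) =
    1 + u^3. *)
Lemma expRN_taylor1 (u : R) : 0 <= u -> `|expR (- u) - (1 - u)| <= u ^+ 2.
Proof.
move=> u0; rewrite ger0_norm ?subr_ge0 ?expR_ge1Dx// lerBlDr.
rewrite expRN (le_trans (_ : _ <= (1 + u)^-1))//.
  by rewrite lef_pV2 ?posrE ?expR_gt0// ?expR_ge1Dx//; lra.
rewrite -div1r ler_pdivrMr; last lra.
rewrite -subr_ge0 (_ : _ - _ = u ^+ 3); last by ring.
by rewrite exprn_ge0.
Qed.

Let dotrZr (r : R) y : dotr t (r *: y) = r * dotr t y.
Proof. by rewrite mulr_sumr; apply: eq_bigr => i _; rewrite mxE mulrCA. Qed.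

(** One step of size [r] multiplies the cosine by the Gaussian factor up to order [r^3], uniformly
    in the phase [x]. The sine of the increment has a mean of third order since the increment is
    centred, and the fourth-order error of the cosine is absorbed because [r <= 1]. *)
Lemma walk_cos_step : exists2 C : R, 0 <= C & forall (r x : R), 0 <= r <= 1 ->
  `|\sum_j pr j * cos (x + r * dotr t (a j)) -
    expR (- (r ^+ 2 * v / 2)) * cos x| <= C * r ^+ 3.
Proof.
pose B3 := \sum_j pr j * `|dotr t (a j)| ^+ 3.
pose B4 := \sum_j pr j * `|dotr t (a j)| ^+ 4.
have B30 : 0 <= B3 by apply: sumr_ge0 => j _; rewrite mulr_ge0// exprn_ge0.
have B40 : 0 <= B4 by apply: sumr_ge0 => j _; rewrite mulr_ge0// exprn_ge0.
exists (B4 + B3 + v ^+ 2); first by rewrite !addr_ge0// sqr_ge0.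
move=> r x /andP[r0 r1].
have r43 : r ^+ 4 <= r ^+ 3 by rewrite (exprS _ 3) ler_piMl// exprn_ge0.
pose c := \sum_j pr j * cos (r * dotr t (a j)).
pose s := \sum_j pr j * sin (r * dotr t (a j)).
have -> : \sum_j pr j * cos (x + r * dotr t (a j)) = cos x * c - sin x * s.
  rewrite /c /s !mulr_sumr -sumrB; apply: eq_bigr => j _.
  by rewrite cosD; ring.
set u := r ^+ 2 * v / 2.
have u0 : 0 <= u by rewrite /u divr_ge0// mulr_ge0// sqr_ge0.
have cB : `|c - (1 - u)| <= B4 * r ^+ 3.
  have -> : c - (1 - u) = \sum_j pr j *
      (cos (r * dotr t (a j)) - (1 - (r * dotr t (a j)) ^+ 2 / 2)).
    rewrite (eq_bigr (fun j => pr j * cos (r * dotr t (a j)) - pr j +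
       (pr j * dotr t (a j) ^+ 2) * (r ^+ 2 / 2))); last by move=> j _; ring.
    by rewrite big_split/= sumrB pr_sum1 -mulr_suml -/v /c /u; ring.
  apply: le_trans (ler_norm_sum _ _ _) _; rewrite mulr_suml; apply: ler_sum => j _.
  rewrite normrM ger0_norm// -mulrA ler_wpM2l//.
  apply: le_trans (norm_cos_taylor2_le _) _.
  by rewrite normrM ger0_norm// exprMn mulrC ler_wpM2l// exprn_ge0.
have sB : `|s| <= B3 * r ^+ 3.
  have -> : s = \sum_j pr j * (sin (r * dotr t (a j)) - r * dotr t (a j)).
    rewrite (eq_bigr (fun j => pr j * sin (r * dotr t (a j)) -
       r * (pr j * dotr t (a j)))); last by move=> j _; ring.
    by rewrite sumrB -mulr_sumr mean0 mulr0 subr0.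
  apply: le_trans (ler_norm_sum _ _ _) _; rewrite mulr_suml; apply: ler_sum => j _.
  rewrite normrM ger0_norm// -mulrA ler_wpM2l//.
  apply: le_trans (norm_sinB_le3 _) _.
  by rewrite normrM ger0_norm// exprMn mulrC.
have eB : `|(1 - u) - expR (- u)| <= v ^+ 2 * r ^+ 3.
  rewrite distrC (le_trans (expRN_taylor1 u0))// /u.
  rewrite (_ : _ ^+ 2 = v ^+ 2 / 4 * r ^+ 4); last by field.
  rewrite ler_pM ?divr_ge0 ?exprn_ge0//.
  by rewrite ler_pdivrMr//; have := sqr_ge0 v; set q := v ^+ 2; lra.
have -> : cos x * c - sin x * s - expR (- u) * cos x =
    cos x * ((c - (1 - u)) + ((1 - u) - expR (- u))) - sin x * s by ring.
apply: le_trans (ler_normB _ _) _.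
rewrite !normrM !mulrDl.
have H1 : `|cos x| * `|c - (1 - u) + (1 - u - expR (- u))| <=
    B4 * r ^+ 3 + v ^+ 2 * r ^+ 3.
  apply: le_trans (ler_piMl (normr_ge0 _) (cos_max x)) _.
  exact: le_trans (ler_normD _ _) (lerD cB eB).
have H2 : `|sin x| * `|s| <= B3 * r ^+ 3.
  exact: le_trans (ler_piMl (normr_ge0 _) (sin_max x)) sB.
by apply: le_trans (lerD H1 H2) _; rewrite addrAC.
Qed.

(** The errors [C r^3] of [n] steps with [r = 1 / sqrt n] add up to [C r], and the [n]-th power of
    the one-step factor is the Gaussian value. *)
Lemma walk_cos_cvg_rate : exists2 C : R, 0 <= C & forall (n : nat) (th : R),
    (0 < n)%N ->
  `|iter n (walk pr (fun j => (Num.sqrt n%:R)^-1 *: a j))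
      (fun s => cos (dotr t s + th)) 0 - expR (- (v / 2)) * cos th| <=
  C * (Num.sqrt n%:R)^-1.
Proof.
have [C C0 hC] := walk_cos_step; exists C => // n th n0.
set r := (Num.sqrt n%:R)^-1.
have sn1 : 1 <= Num.sqrt n%:R :> R by rewrite -[leLHS]sqrtr1 ler_wsqrtr// ler1n.
have r0 : 0 < r by rewrite invr_gt0 (lt_le_trans _ sn1).
have r01 : 0 <= r <= 1 by rewrite ltW//= invf_le1// (lt_le_trans _ sn1).
have r2 : n%:R * r ^+ 2 = 1.
  by rewrite exprVn sqr_sqrtr// divff// pnatr_eq0 -lt0n.
set rho := expR (- (r ^+ 2 * v / 2)).
have rho01 : 0 <= rho <= 1.
  by rewrite expR_ge0/= -expR0 ler_expR oppr_le0 divr_ge0// mulr_ge0// sqr_ge0.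
have H k s : `|iter k (walk pr (fun j => r *: a j))
      (fun s => cos (dotr t s + th)) s - rho ^+ k * cos (dotr t s + th)| <=
    k%:R * (C * r ^+ 3).
  elim: k s => [|k IH] s; first by rewrite /= expr0 mul1r subrr normr0 mul0r.
  set x := dotr t s + th.
  have xE j : dotr t (s + r *: a j) + th = x + r * dotr t (a j).
    by rewrite dotrDr dotrZr /x addrAC.
  (* Split into the error of the last [k] steps, averaged over the first one, and the error of that
     first step, damped by [rho ^ k <= 1]. *)
  apply: (@le_trans _ _ (`|\sum_j pr j * (iter k (walk pr (fun j => r *: a j))
      (fun s => cos (dotr t s + th)) (s + r *: a j) -
      rho ^+ k * cos (dotr t (s + r *: a j) + th))| +
     `|rho ^+ k * (\sum_j pr j * cos (x + r * dotr t (a j)) - rho * cos x)|)).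
    apply: le_trans (ler_normD _ _); rewrite le_eqVlt; apply/orP; left; apply/eqP.
    congr `| _ |; rewrite mulrBr mulrA -exprSr addrA; congr (_ - _).
    rewrite mulr_sumr -big_split; apply: eq_bigr => j _.
    by rewrite xE mulrBr [rho ^+ k * (pr j * _)]mulrCA; exact: esym (subrK _ _).
  rewrite -natr1 mulrDl mul1r lerD//.
    apply: le_trans (ler_norm_sum _ _ _) _.
    have -> : k%:R * (C * r ^+ 3) = \sum_j pr j * (k%:R * (C * r ^+ 3)).
      by rewrite -mulr_suml pr_sum1 mul1r.
    apply: ler_sum => j _; by rewrite normrM ger0_norm// ler_wpM2l.
  case/andP: rho01 => rho0 rho1.
  rewrite normrM (le_trans _ (hC r x r01))//.
  by rewrite ler_piMl// normrX ger0_norm// exprn_ile1.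
have := H n 0.
have -> : rho ^+ n = expR (- (v / 2)).
  rewrite -expRM_natl; congr expR; rewrite mulrN; congr (- _).
  by rewrite [LHS]mulrA [n%:R * _]mulrA r2 mul1r.
have -> : dotr t 0 + th = th.
  by rewrite /dotr big1 ?add0r// => i _; rewrite mxE mulr0.
move=> /le_trans; apply.
rewrite mulrCA; apply: ler_wpM2l => //.
by rewrite exprS mulrCA r2 mulr1.
Qed.

End walk_characteristic.

(** * Centered Gaussian laws *)

Section normal_characteristic.
Context {R : realType}.
Variable (sg : R).
Hypothesis sg_gt0 : 0 < sg.
Local Notation mu := (@lebesgue_measure R).
Local Notation phi := (normal_pdf 0 sg).

Let sg0 : sg != 0. Proof. by rewrite gt_eqF. Qed.

Let phiE x : phi x = normal_peak sg * expR (- (x ^+ 2 / (sg ^+ 2 *+ 2))).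
Proof. by rewrite normal_pdfE// /normal_fun subr0 mulNr. Qed.

Let mphi : measurable_fun setT phi. Proof. exact: measurable_normal_pdf. Qed.

(** Comparison with the normal density of variance [2 sg^2]: half of the exponent is kept as that
    density, the other half absorbs [|x|]. *)
Lemma integrable_norm_normal_pdf :
  mu.-integrable setT (fun x => (`|x| * phi x)%:E).
Proof.
pose s' := Num.sqrt 2 * sg.
have s'2 : s' ^+ 2 = 2 * sg ^+ 2 by rewrite exprMn sqr_sqrtr.
have s'0 : s' != 0 by rewrite mulf_neq0// gt_eqF// sqrtr_gt0.
have pk : 0 < normal_peak s' by rewrite normal_peak_gt0.
pose K := sg * normal_peak sg / normal_peak s'.
apply: (@le_integrable _ _ _ mu setT _ _ (fun x => (K * normal_pdf 0 s' x)%:E)) => //.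
- apply/measurable_EFinP; apply: measurable_funM => //.
- move=> x _; rewrite !abse_EFin lee_fin normrM normr_id (ger0_norm (normal_pdf_ge0 _ _ _)).
  have K0 : 0 <= K by rewrite /K !mulr_ge0 ?invr_ge0 ?normal_peak_ge0// ltW.
  rewrite (ger0_norm (mulr_ge0 K0 (normal_pdf_ge0 _ _ _))) phiE.
  rewrite (normal_pdfE _ s'0) /normal_fun subr0 mulNr s'2.
  have KE : K * normal_peak s' = sg * normal_peak sg by rewrite /K divfK ?gt_eqF.
  rewrite [K * (_ * _)]mulrA KE mulrCA -(mulrA sg) (mulrCA sg).
  rewrite ler_wpM2l ?normal_peak_ge0//.
  set u := x ^+ 2 / ((2 * sg ^+ 2) *+ 2).
  have -> : x ^+ 2 / (sg ^+ 2 *+ 2) = u + u by rewrite /u; field.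
  rewrite opprD expRD mulrA ler_pM2r ?expR_gt0//.
  have u0 : 0 <= u by rewrite /u divr_ge0 ?sqr_ge0// mulrn_wge0// mulr_ge0// sqr_ge0.
  have uE : x ^+ 2 = 4 * sg ^+ 2 * u by rewrite /u; field.
  (* This is [(2 sg - |x|)^2 >= 0] written with [x^2 = 4 sg^2 u]; afterwards [1 + u <= expR u]. *)
  have h1 : `|x| <= sg * (1 + u).
    have := sqr_ge0 (2 * sg - `|x|).
    rewrite sqrrB real_normK ?num_real// uE => h2.
    have h3 : 0 <= 4 * sg * (sg * (1 + u) - `|x|) by nra.
    by rewrite -subr_ge0 -(pmulr_rge0 _ (_ : 0 < 4 * sg))// mulr_gt0.
  rewrite -(@ler_pM2r _ (expR u)) ?expR_gt0// -!mulrA -expRD addNr expR0 mulr1.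
  by rewrite (le_trans h1)// ler_wpM2l ?(ltW sg_gt0)// expR_ge1Dx.
- have := integrableZl measurableT K (integrable_normal_pdf 0 s').
  by apply: eq_integrable.
Qed.

Lemma integrable_cos_normal_pdf s :
  mu.-integrable setT (fun x => (cos (s * x) * phi x)%:E).
Proof.
apply: (@le_integrable _ _ _ mu setT _ _ (fun x => (phi x)%:E)) => //.
- apply/measurable_EFinP; apply: measurable_funM => //.
  apply: (measurableT_comp (f := cos)).
    by apply: continuous_measurable_fun; exact: continuous_cos.
  exact: measurable_funM.
- move=> x _; rewrite !abse_EFin lee_fin normrM ler_piMl// cos_max//.
- exact: integrable_normal_pdf.
Qed.

Lemma integrable_sin_normal_pdf s :
  mu.-integrable setT (fun x => (x * sin (s * x) * phi x)%:E).
Proof.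
apply: (@le_integrable _ _ _ mu setT _ _ (fun x => (`|x| * phi x)%:E)) => //.
- apply/measurable_EFinP; apply: measurable_funM => //; apply: measurable_funM => //.
  apply: (measurableT_comp (f := sin)).
    by apply: continuous_measurable_fun; exact: continuous_sin.
  exact: measurable_funM.
- move=> x _; rewrite !abse_EFin lee_fin !normrM normr_id ler_wpM2r//.
  by rewrite ler_piMr// sin_max.
- exact: integrable_norm_normal_pdf.
Qed.

Let is_derive_phi x : is_derive x (1 : R) phi (- (x / sg ^+ 2) * phi x).
Proof.
have -> : phi = (fun x => normal_peak sg * expR (- (x ^+ 2 / (sg ^+ 2 *+ 2)))).
  by apply/funext => y; rewrite phiE.
have d1 : is_derive x (1 : R) (fun x => - (x ^+ 2 / (sg ^+ 2 *+ 2))) (- (x / sg ^+ 2)).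
  have := is_deriveN (is_deriveM (is_deriveM (is_derive_id x (1:R)) (is_derive_id x 1))
    (is_derive_cst ((sg ^+ 2 *+ 2)^-1 : R) x 1)).
  by rewrite /GRing.scale /= => /is_derive_eq; apply; field.
have := is_deriveM (is_derive_cst (normal_peak sg) x 1) (is_derive1_comp (is_derive_expR _) d1).
by rewrite /GRing.scale /= => /is_derive_eq; apply; ring.
Qed.

Let is_derive_lin (c x : R) : is_derive x (1 : R) (fun x => c * x) c.
Proof.
have := is_deriveM (is_derive_cst c x (1:R)) (is_derive_id x (1 : R)).
by rewrite /GRing.scale /= => /is_derive_eq; apply; ring.
Qed.

Let is_derive_h s x : is_derive x (1 : R) (fun x => sin (s * x) * phi x)
  (s * (cos (s * x) * phi x) - (sg ^+ 2)^-1 * (x * sin (s * x) * phi x)).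
Proof.
have := is_deriveM (is_derive1_comp (is_derive_sin _) (is_derive_lin s x)) (is_derive_phi x).
by rewrite /GRing.scale /= => /is_derive_eq; apply; ring.
Qed.

Definition normal_char (s : R) : R := \int[mu]_x (cos (s * x) * phi x).

(** Stein's identity E[X f(X)] = sg^2 E[f'(X)] for f(x) = sin(s x): the derivative of
    [sin (s x) phi x] integrates to zero because the boundary terms on [-n, n] vanish in the
    limit. *)
Lemma normal_stein s :
  \int[mu]_x (x * sin (s * x) * phi x) = sg ^+ 2 * s * normal_char s.
Proof.
pose h x := sin (s * x) * phi x.
pose dh x := s * (cos (s * x) * phi x) - (sg ^+ 2)^-1 * (x * sin (s * x) * phi x).
pose Ic := integrable_cos_normal_pdf s; pose Is := integrable_sin_normal_pdf s.
have Idh : mu.-integrable setT (EFin \o dh).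
  have := integrableB measurableT (integrableZl measurableT s Ic)
    (integrableZl measurableT (sg ^+ 2)^-1 Is).
  by apply: eq_integrable.
have cdh : continuous dh.
  have cphi : continuous phi by exact: continuous_normal_pdf.
  have cl : continuous (fun x : R => s * x).
    by move=> x; apply: cvgM; [exact: cvg_cst|exact: cvg_id].
  move=> x; apply: cvgB.
    apply: cvgM; first exact: cvg_cst.
    apply: cvgM; last exact: cphi.
    by apply: (cvg_comp _ cos); [exact: cl|exact: continuous_cos].
  apply: cvgM; first exact: cvg_cst.
  apply: cvgM; last exact: cphi.
  apply: cvgM; first exact: cvg_id.
  by apply: (cvg_comp _ sin); [exact: cl|exact: continuous_sin].
have FTC (n : nat) : (\int[mu]_(x in `[(- n.+1%:R)%R, n.+1%:R%R]) (dh x)%:E =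
    (h n.+1%:R%R)%:E - (h (- n.+1%:R)%R)%:E)%E.
  apply: continuous_FTC2.
  - by have : 0 < n.+1%:R :> R by []; lra.
  - exact: continuous_subspaceT.
  - have ch x : {for x, continuous h}.
      by apply: differentiable_continuous; apply/derivable1_diffP; have [] := is_derive_h s x.
    split.
    + by move=> x _; have [] := is_derive_h s x.
    + by apply: cvg_at_right_filter; exact: ch.
    + by apply: cvg_at_left_filter; exact: ch.
  - by move=> x _; rewrite derive1E; have [] := is_derive_h s x.
have h0 : (fun n : nat => h n.+1%:R - h (- n.+1%:R)) @ \oo --> (0 : R).
  pose K := 2 * (normal_peak sg * (sg ^+ 2 *+ 2)).
  have hK : (fun n : nat => K * harmonic n) @ \oo --> (0 : R).
    rewrite -[X in _ --> X](mulr0 K); apply: cvgM; first exact: cvg_cst.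
    exact: cvg_harmonic.
  have hub (x : R) : 1 <= x -> phi x <= normal_peak sg * (sg ^+ 2 *+ 2) * x^-1.
    move=> x1; rewrite phiE -mulrA ler_wpM2l ?normal_peak_ge0// expRN.
    have s20 : 0 < sg ^+ 2 *+ 2 by rewrite pmulrn_rgt0// exprn_gt0.
    have x0 : 0 < x by exact: lt_le_trans x1.
    rewrite -[sg ^+ 2 *+ 2]invrK -invfM lef_pV2 ?posrE ?expR_gt0 ?mulr_gt0 ?invr_gt0//.
    apply: le_trans (expR_ge1Dx _); rewrite mulrC -[leLHS]add0r lerD//.
    by rewrite invrK ler_wpM2r ?invr_ge0 ?(ltW s20)// expr2 ler_peMl// ltW.
  have phiN x : phi (- x) = phi x by rewrite !phiE sqrrN.
  apply: norm_cvg0; apply: (squeeze_cvgr _ (@cvg_cst _ _ _ _ _) hK).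
  apply: nearW => n; rewrite normr_ge0/= /h phiN mulrN sinN mulNr opprK.
  rewrite -mulr2n -[_ *+ 2]mulr_natl normrM (@ger0_norm _ 2)// /K -mulrA ler_pM2l//.
  rewrite normrM (ger0_norm (normal_pdf_ge0 _ _ _)).
  apply: le_trans (_ : phi n.+1%:R <= _).
    by rewrite ler_piMl ?normal_pdf_ge0// sin_max.
  by apply: hub; rewrite ler1n.
have dcv : (fun n : nat => \int[mu]_(x in `[(- n.+1%:R)%R, n.+1%:R%R]) (dh x)%:E)%E @ \oo -->
    (\int[mu]_x (dh x)%:E)%E.
  under eq_fun do rewrite integral_mkcond.
  apply: (@dominated_cvg _ _ _ mu _ measurableT
     (fun n => (EFin \o dh) \_ `[(- n.+1%:R : R), n.+1%:R]%classic) _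
     (fun x => (`|dh x|)%:E)) => //.
  - move=> n; apply/measurable_restrict => //; apply: measurable_funTS.
    by apply/measurable_EFinP; exact: continuous_measurable_fun.
  - move=> x _; apply: cvg_near_cst.
    exists (Num.truncn `|x|) => // n /= xn.
    rewrite patchE mem_set//= in_itv/= -ler_norml.
    apply: ltW (lt_le_trans (truncnS_gt _) _).
    by rewrite ler_nat.
  - exact: (integrable_norm Idh).
  - move=> n x _; rewrite patchE; case: ifP => _ //=.
    by rewrite normr0 lee_fin.
have E0 : (\int[mu]_x (dh x)%:E = 0)%E.
  move: dcv; under eq_fun do rewrite FTC.
  move=> dcv; apply: cvg_unique dcv _ => //.
  by apply: cvg_EFin => //; exact: nearW.
have : \int[mu]_x dh x = 0 by rewrite /Rintegral E0.
rewrite /dh RintegralB//; last 2 first.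
- exact: integrableZl Ic.
- exact: integrableZl Is.
rewrite !RintegralZl// -/(normal_char s) => /eqP; rewrite subr_eq0 => /eqP E.
by rewrite -mulrA E mulVKf// expf_neq0.
Qed.

(** Differentiation under the integral, dominated by [|x| phi x], followed by Stein's identity,
    turns the characteristic function into the solution of a linear differential equation. *)
Lemma is_derive_normal_char s :
  is_derive s (1 : R) normal_char (- (sg ^+ 2 * s * normal_char s)).
Proof.
pose f s x := cos (s * x) * phi x.
have df s' x : is_derive s' (1 : R) (f ^~ x) (- (x * sin (s' * x) * phi x)).
  have dl : is_derive s' (1 : R) (fun s => s * x) x.
    by have := is_derive_lin x s'; under eq_fun do rewrite mulrC.
  have := is_deriveM (is_derive1_comp (is_derive_cos _) dl) (is_derive_cst (phi x) s' (1:R)).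
  by rewrite /GRing.scale /= => /is_derive_eq; apply; ring.
have d1f s' x : partial1of2 f s' x = - (x * sin (s' * x) * phi x).
  by rewrite partial1of2E; have [_] := df s' x.
have Is : `](s - 1), (s + 1)[%classic s by rewrite /= in_itv/=; apply/andP; split; lra.
have intf x : `](s - 1), (s + 1)[%classic x -> mu.-integrable setT (EFin \o f x).
  by move=> _; exact: integrable_cos_normal_pdf.
have derf x y : `](s - 1), (s + 1)[%classic x -> [set: R] y -> derivable (f ^~ y) x 1.
  by move=> _ _; have [] := df x y.
have G0 y : 0 <= `|y| * phi y by rewrite mulr_ge0// normal_pdf_ge0.
have Gub x y : `](s - 1), (s + 1)[%classic x -> [set: R] y ->
    `|partial1of2 f x y| <= `|y| * phi y.
  move=> _ _; rewrite d1f normrN !normrM (ger0_norm (normal_pdf_ge0 _ _ _)).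
  by rewrite ler_wpM2r ?normal_pdf_ge0// ler_piMr// sin_max.
have := derivable_under_integral measurableT Is intf derf G0 integrable_norm_normal_pdf Gub.
have := differentiation_under_integral measurableT Is intf derf G0 integrable_norm_normal_pdf Gub.
move=> E D; apply: DeriveDef => //.
rewrite -derive1E E -normal_stein -[RHS]mulN1r -RintegralZl//; last first.
  exact: integrable_sin_normal_pdf.
by apply: eq_Rintegral => x _; rewrite d1f mulN1r.
Qed.

Lemma normal_charE s : normal_char s = expR (- (sg ^+ 2 * s ^+ 2 / 2)).
Proof.
pose H s := normal_char s * expR (sg ^+ 2 * s ^+ 2 / 2).
have dH x : is_derive x (1 : R) H 0.
  have d1 : is_derive x (1 : R) (fun x => sg ^+ 2 * x ^+ 2 / 2) (sg ^+ 2 * x).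
    have := is_deriveM (is_deriveM (is_derive_cst (sg ^+ 2) x (1:R)) (is_deriveM (is_derive_id x (1:R)) (is_derive_id x 1)))
      (is_derive_cst (2^-1 : R) x 1).
    by rewrite /GRing.scale /= => /is_derive_eq; apply; field.
  have := is_deriveM (is_derive_normal_char x) (is_derive1_comp (is_derive_expR _) d1).
  by rewrite /GRing.scale /= => /is_derive_eq; apply; ring.
have := is_derive_0_is_cst s 0 dH.
rewrite /H [in RHS]expr0n mulr0 mul0r expR0 mulr1.
have -> : normal_char 0 = 1.
  rewrite /normal_char /Rintegral.
  under eq_integral do rewrite mul0r cos0 mul1r.
  by rewrite integral_normal_pdf.
move=> H1; apply: (mulIf (lt0r_neq0 (expR_gt0 (sg ^+ 2 * s ^+ 2 / 2)))).
by rewrite H1 -expRD addNr expR0.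
Qed.

End normal_characteristic.

(** * Measures given by a density *)

Section density.
Local Open Scope ereal_scope.
Context {R : realType} {d : measure_display} {T : measurableType d}.
Variables (mu : {measure set T -> \bar R}) (rho : T -> R).
Hypothesis mrho : measurable_fun setT rho.
Hypothesis rho0 : forall x, (0 <= rho x)%R.

Import HBNNSimple.

(** Stated for any [nu] whose values are integrals of the density, so that it covers both
    [normal_prob] and [density_measure]; proved on simple functions and passed to [f] by monotone
    convergence. *)
Lemma ge0_integral_density (nu : {measure set T -> \bar R}) (f : T -> \bar R) :
    (forall A, measurable A -> nu A = \int[mu]_(x in A) (rho x)%:E) ->
    measurable_fun setT f -> (forall x, 0 <= f x) ->
  \int[nu]_x f x = \int[mu]_x (f x * (rho x)%:E).
Proof.
move=> nuE mf f0.
have merho : measurable_fun setT (EFin \o rho) by exact/measurable_EFinP.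
pose f_ := nnsfun_approx measurableT mf.
transitivity (limn (fun n => \int[nu]_x (f_ n x)%:E)).
  rewrite -monotone_convergence//.
  - apply: eq_integral => y _; apply/esym/cvg_lim => //.
    by apply: cvg_nnsfun_approx => // *; exact: f0.
  - by move=> n; exact/measurable_EFinP/measurable_funP.
  - by move=> n y _; rewrite lee_fin.
  - by move=> y _ m n mn; rewrite lee_fin; exact/lefP/nd_nnsfun_approx.
rewrite [X in limn X](_ : _ = (fun n => \int[mu]_x ((f_ n x)%:E * (rho x)%:E))).
  rewrite -monotone_convergence//; last 3 first.
    - move=> n /=; apply: emeasurable_funM => //.
      exact/measurable_EFinP/measurable_funP.
    - by move=> n x _ /=; rewrite mule_ge0// lee_fin.
    - move=> x _ m n mn; apply: lee_wpmul2r; rewrite lee_fin//.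
      exact/lefP/nd_nnsfun_approx.
  apply: eq_integral => x _ /=; apply/cvg_lim => //.
  apply: cvgeZr => //.
  by apply: cvg_nnsfun_approx => // y _; exact: f0.
apply/funext => n.
transitivity (\sum_(k \in range (f_ n))
    \int[mu]_x ((k * \1_(f_ n @^-1` [set k]) x)%:E * (rho x)%:E)); last first.
  rewrite -ge0_integral_fsum//.
  - apply: eq_integral => x _; rewrite [in RHS]fimfunE -fsumEFin//.
    by rewrite ge0_mule_fsuml// => r; rewrite nnfun_muleindic_ge0.
  - by move=> r; apply: emeasurable_funM => //; exact/measurable_EFinP/measurable_funM.
  - move=> r x _; apply: mule_ge0; last by rewrite lee_fin.
    by rewrite EFinM nnfun_muleindic_ge0.
under eq_integral do rewrite fimfunE -fsumEFin//.
rewrite ge0_integral_fsum//; last 2 first.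
- by move=> y; exact/measurable_EFinP/measurable_funM.
- by move=> y x _; rewrite nnfun_muleindic_ge0.
apply: eq_fsbigr => r rfn.
have r0 : (0 <= r)%R by move: rfn; rewrite inE => -[x _ <-].
rewrite integralZl_indic_nnsfun// integral_indic//= setIT nuE//.
rewrite integral_mkcond -ge0_integralZl//; last 2 first.
- exact/(measurable_restrict _ _ _).1/measurable_funTS.
- by move=> x _; rewrite patchE; case: ifP => //; rewrite lee_fin.
apply: eq_integral => x _; rewrite patchE EFinM -muleA indicE.
by case: ifPn => _; rewrite ?mul1e ?mul0e ?mule0.
Qed.

Definition mdensity (A : set T) : \bar R := \int[mu]_(x in A) (rho x)%:E.

Let mdensity0 : mdensity set0 = 0. Proof. exact: integral_set0. Qed.

Let mdensity_ge0 A : 0 <= mdensity A.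
Proof. by apply: integral_ge0 => x _; rewrite lee_fin. Qed.

Let mdensity_sigma_additive : semi_sigma_additive mdensity.
Proof.
move=> F mF tF mUF; rewrite /mdensity ge0_integral_bigcup//.
- apply: is_cvg_ereal_nneg_natsum_cond => n _ _.
  by apply: integral_ge0 => x _; rewrite lee_fin.
- by apply: measurable_funTS; exact/measurable_EFinP.
- by move=> x _; rewrite lee_fin.
Qed.

Definition density_measure : {measure set T -> \bar R} :=
  HB.pack mdensity (isMeasure.Build _ _ _ mdensity mdensity0 mdensity_ge0
    mdensity_sigma_additive).

Lemma ge0_integral_density_measure (f : T -> \bar R) :
    measurable_fun setT f -> (forall x, 0 <= f x) ->
  \int[density_measure]_x f x = \int[mu]_x (f x * (rho x)%:E).
Proof. exact: ge0_integral_density. Qed.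

End density.

(** * Integrals of bounded functions *)

Section bounded_integrals.
Context {R : realType} {d : measure_display} {T : measurableType d}.

Lemma bounded_integrable (mu : {finite_measure set T -> \bar R}) (f : T -> R) (M : R) :
    measurable_fun setT f -> (forall x, `|f x| <= M) ->
  mu.-integrable setT (EFin \o f).
Proof.
move=> mf fM; apply: (@le_integrable _ _ _ _ setT _ _ (cst M%:E)) => //.
- exact/measurable_EFinP.
- move=> x _; rewrite lee_fin (le_trans (fM x))//.
  exact: ler_norm.
- exact: finite_measure_integrable_cst.
Qed.

End bounded_integrals.

Section bounded_cvg.
Context {R : realType} {d : measure_display} {Omega : measurableType d}.
Variable (Pr : probability Omega R).

Lemma bounded_cvg_Rintegral (f_ : nat -> Omega -> R) (f : Omega -> R) (M : R) :
    (forall n, measurable_fun setT (f_ n)) -> (forall n o, `|f_ n o| <= M) ->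
    (forall o, f_ n o @[n --> \oo] --> f o) ->
  \int[Pr]_o f_ n o @[n --> \oo] --> \int[Pr]_o f o.
Proof.
move=> mf fM ff.
have mf' : measurable_fun setT f.
  by apply: (@measurable_fun_cvg _ _ _ _ f_) => // o _; exact: ff.
have fM' o : `|f o| <= M.
  apply/ler_addgt0Pr => e e0.
  have /cvgrPdist_le /(_ e e0)[n _ /(_ n (leqnn n))] := ff o.
  have := fM n o; rewrite !ler_norml => /andP[? ?] /andP[? ?].
  by apply/andP; split; lra.
have H := @dominated_cvg _ _ _ Pr _ measurableT (fun n o => (f_ n o)%:E)
  (fun o => (f o)%:E) (cst M%:E).
apply: fine_cvg; rewrite fineK.
  apply: H => //.
  - by move=> n; exact/measurable_EFinP.
  - by move=> o _; apply: cvg_EFin => //; [exact: nearW|exact: ff].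
  - exact: finite_measure_integrable_cst.
  - by move=> n o _; rewrite lee_fin.
apply: integrable_fin_num => //.
exact: (@bounded_integrable _ _ _ Pr f M).
Qed.

Lemma le_bounded_Rintegral (f g : Omega -> R) (M : R) :
    measurable_fun setT f -> measurable_fun setT g ->
    (forall o, `|f o| <= M) -> (forall o, `|g o| <= M) ->
    (forall o, f o <= g o) -> \int[Pr]_o f o <= \int[Pr]_o g o.
Proof.
move=> mf mg fM gM fg; apply: le_Rintegral => //.
- exact: (@bounded_integrable _ _ _ Pr f M).
- exact: (@bounded_integrable _ _ _ Pr g M).
Qed.

End bounded_cvg.

Section centered_normal_moments.
Context {R : realType} {d : measure_display} {Omega : measurableType d}.
Variables (Pr : probability Omega R) (Y : Omega -> R) (v : R).
Hypothesis mY : measurable_fun setT Y.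
Hypothesis v_ge0 : 0 <= v.
Hypothesis lawY : forall A, measurable A -> Pr (Y @^-1` A) = centered_normal v A.

Let mcos : measurable_fun [set: R] (@cos R).
Proof. by apply: continuous_measurable_fun; exact: continuous_cos. Qed.

Lemma centered_normal_integral (f : R -> R) (M : R) :
    measurable_fun setT f -> (forall x, `|f x| <= M) ->
  (\int[Pr]_w (f (Y w))%:E)%E =
  if v == 0 then (f 0)%:E
  else (\int[@lebesgue_measure R]_x (f x * normal_pdf 0 (Num.sqrt v) x)%:E)%E.
Proof.
move=> mf fM.
have mYR : measurable_fun setT (Y : Omega -> measurableTypeR R) by exact: mY.
pose mY' := isMeasurableFun.Build _ _ _ _ _ mYR.
pose Y' : {mfun Omega >-> measurableTypeR R} := HB.pack (Y : Omega -> measurableTypeR R) mY'.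
have fY : Pr.-integrable setT (fun w => (f (Y w))%:E).
  by apply: (@bounded_integrable _ _ _ Pr _ M) => //; exact: measurableT_comp.
have mfE : measurable_fun (setT : set (measurableTypeR R)) (fun x => (f x)%:E) by exact/measurable_EFinP.
have -> : (\int[Pr]_w (f (Y w))%:E = \int[distribution Pr Y']_x (f x)%:E)%E.
  by rewrite (@integral_distribution _ _ _ _ _ Pr Y' (EFin \o f)).
have [v0|vn0] := eqVneq v 0.
  rewrite (eq_measure_integral (\d_((0 : R) : measurableTypeR R))); last first.
    by move=> A mA _; rewrite [LHS]lawY// /centered_normal v0 eqxx.
  by rewrite integral_dirac// diracT mul1e.
set sg := Num.sqrt v.
have -> : (\int[distribution Pr Y']_x (f x)%:E = \int[normal_prob 0 sg]_x (f x)%:E)%E.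
  have lawE : forall A : set (measurableTypeR R), measurable A -> A `<=` setT ->
      distribution Pr Y' A = normal_prob 0 sg A.
    by move=> A mA _; rewrite [LHS]lawY// /centered_normal (negbTE vn0).
  exact: (@eq_measure_integral _ (measurableTypeR R) R setT (normal_prob 0 sg)
    (distribution Pr Y') (EFin \o f) lawE).
pose nu := normal_prob (R := R) 0 sg.
pose mu := @lebesgue_measure R.
have phi0 x : 0 <= normal_pdf 0 sg x by exact: normal_pdf_ge0.
have If : nu.-integrable setT (EFin \o f).
  exact: (@bounded_integrable _ _ _ nu _ M).
have Iphi : mu.-integrable setT (fun x => (normal_pdf 0 sg x)%:E).
  exact: integrable_normal_pdf.
have Ifphi : mu.-integrable setT (fun x => (f x * normal_pdf 0 sg x)%:E).
  apply: (@le_integrable _ _ _ mu setT _ _ (fun x => (M * normal_pdf 0 sg x)%:E)) => //.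
  - by apply/measurable_EFinP; apply: measurable_funM => //; exact: measurable_normal_pdf.
  - move=> x _; rewrite lee_fin !normrM ler_wpM2r//.
    by rewrite (le_trans (fM x))// ler_norm.
  - by have := integrableZl measurableT M Iphi; apply: eq_integrable.
(* Adding [M] makes the integrand nonnegative, as the density formula requires; the constant is
   removed at the end. *)
have M0 x : 0 <= f x + M by have := fM x; rewrite ler_norml; lra.
have : (\int[nu]_x (f x + M)%:E = \int[mu]_x ((f x + M) * normal_pdf 0 sg x)%:E)%E.
  rewrite (@ge0_integral_density _ _ _ mu (normal_pdf 0 sg)) //.
  - exact: measurable_normal_pdf.
  - by apply/measurable_EFinP; exact: measurable_funD.
under eq_integral do rewrite EFinD.
rewrite integralD//=; last exact: finite_measure_integrable_cst.
have -> : (\int[normal_prob 0 sg]_x M%:E = M%:E)%E.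
  rewrite integral_cst// -[RHS]mule1; congr (_ * _)%E.
  exact: integral_normal_pdf.
under [X in _ = X -> _]eq_integral do rewrite mulrDl EFinD.
rewrite integralD//=; last first.
  by have := integrableZl measurableT M Iphi; apply: eq_integrable.
under [X in _ = (_ + X)%E -> _]eq_integral do rewrite EFinM.
rewrite integralZl// [in X in _ = (_ + M%:E * X)%E -> _]integral_normal_pdf mule1.
by move/(congr1 (fun z => (z - M%:E)%E)); rewrite !addeK.
Qed.

Lemma centered_normal_cos : (\int[Pr]_w (cos (Y w))%:E)%E = (expR (- (v / 2)))%:E.
Proof.
rewrite (centered_normal_integral mcos (@cos_max R)).
case: eqP => [->|/eqP vn0]; first by rewrite mul0r oppr0 cos0 expR0.
have sg0 : 0 < Num.sqrt v by rewrite sqrtr_gt0 lt_neqAle eq_sym vn0.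
have := normal_charE sg0 1; rewrite sqr_sqrtr// expr1n mulr1 => <-.
rewrite /normal_char /Rintegral; under [in RHS]eq_integral do rewrite mul1r.
rewrite fineK//; have := integrable_cos_normal_pdf (Num.sqrt v) 1.
by move=> /(integrable_fin_num measurableT); under eq_integral do rewrite mul1r.
Qed.

End centered_normal_moments.

Section gaussian_vector.
Context {R : realType} {d : measure_display} {Omega : measurableType d}.
Variables (Pr : probability Omega R) (m : nat) (S : 'M[R]_m).
Variable (Y : 'I_m -> {RV Pr >-> R}).
Hypothesis gY : centered_gaussian_vector S Y.

Definition rvec w : 'rV[R]_m := \row_i Y i w.

Lemma measurable_dotr_rvec t : measurable_fun setT (fun w => dotr t (rvec w)).
Proof.
apply: measurable_sum => i; apply: measurable_funM => //.
rewrite (_ : (fun w => _) = Y i)//.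
by apply/funext => w; rewrite mxE.
Qed.

Lemma measurable_cos_dotr t (th : R) :
  measurable_fun setT (fun w => cos (dotr t (rvec w) + th)).
Proof.
apply: (measurableT_comp (f := cos)).
  by apply: continuous_measurable_fun; exact: continuous_cos.
by apply: measurable_funD => //; exact: measurable_dotr_rvec.
Qed.

Lemma integrable_cos_dotr t (th : R) :
  Pr.-integrable setT (fun w => (cos (dotr t (rvec w) + th))%:E).
Proof.
apply: (@bounded_integrable _ _ _ Pr _ 1) => [|w]; last exact: cos_max.
exact: measurable_cos_dotr.
Qed.

Let integrable_cos0 t : Pr.-integrable setT (fun w => (cos (dotr t (rvec w)))%:E).
Proof. by have := integrable_cos_dotr t 0; under eq_fun do rewrite addr0. Qed.

Lemma law_dotr_rvec t A : measurable A ->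
  Pr ((fun w => dotr t (rvec w)) @^-1` A) = centered_normal ((t *m S *m t^T) 0 0) A.
Proof.
move=> mA; rewrite -gY//.
rewrite (_ : (fun w => dotr t (rvec w)) = (fun w => \sum_i t 0 i * Y i w))//.
by apply/funext => w; apply: eq_bigr => i _; rewrite mxE.
Qed.

(** Addition formula for the cosine: the sine part has mean zero, because [t.Y] and [-t.Y] have the
    same variance, hence the same law. *)
Lemma gaussian_cos t th : 0 <= (t *m S *m t^T) 0 0 ->
  (\int[Pr]_w (cos (dotr t (rvec w) + th))%:E)%E =
  (expR (- ((t *m S *m t^T) 0 0 / 2)) * cos th)%:E.
Proof.
set v := (t *m S *m t^T) 0 0 => v0.
have ms : measurable_fun setT (fun w => sin (dotr t (rvec w))).
  apply: (measurableT_comp (f := sin)); last exact: measurable_dotr_rvec.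
  by apply: continuous_measurable_fun; exact: continuous_sin.
have Ic := integrable_cos0 t.
have Is : Pr.-integrable setT (fun w => (sin (dotr t (rvec w)))%:E).
  by apply: (@bounded_integrable _ _ _ Pr _ 1) => // w; exact: sin_max.
have s0 : (\int[Pr]_w (sin (dotr t (rvec w)))%:E = 0)%E.
  have msin : measurable_fun [set: R] (@sin R).
    by apply: continuous_measurable_fun; exact: continuous_sin.
  have E1 := centered_normal_integral (measurable_dotr_rvec t) (@law_dotr_rvec t)
    msin (@sin_max R).
  have vN : ((- t) *m S *m (- t)^T) 0 0 = v.
    by rewrite linearN/= mulmxN !mulNmx opprK.
  have lawN A : measurable A ->
      Pr ((fun w => dotr (- t) (rvec w)) @^-1` A) = centered_normal v A.
    move=> mA; have := @law_dotr_rvec (- t) A mA.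
    by move=> ->; congr (centered_normal _ A).
  have E2 := centered_normal_integral (measurable_dotr_rvec (- t)) lawN
    msin (@sin_max R).
  have dN w : dotr (- t) (rvec w) = - dotr t (rvec w).
    by rewrite /dotr -sumrN; apply: eq_bigr => i _; rewrite !mxE mulNr.
  move: E2; rewrite -E1.
  under eq_integral do rewrite dN sinN EFinN.
  rewrite integralN/=; last exact: integrable_add_def.
  have := integrable_fin_num measurableT Is.
  case: (\int[Pr]_w _)%E => // r _ [] /eqP.
  by rewrite eq_sym -subr_eq0 opprK -mulr2n mulrn_eq0 /= => /eqP ->.
under eq_integral do rewrite cosD EFinB EFinM (EFinM (sin _)).
rewrite integralB//; last 2 first.
- by have := integrableZr measurableT (cos th) Ic; apply: eq_integrable.
- by have := integrableZr measurableT (sin th) Is; apply: eq_integrable.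
rewrite !integralZr// s0 mul0e sube0 EFinM; congr (_ * _)%E.
exact: centered_normal_cos (measurable_dotr_rvec t) v0 (@law_dotr_rvec t).
Qed.

End gaussian_vector.

(** * Central limit theorem for walks *)

Section walk_clt.
Context {R : realType} {m' : nat}.
Local Notation m := m'.+1.
Context {d : measure_display} {Omega : measurableType d}.
Variables (Pr : probability Omega R) (S : 'M[R]_m) (Y : 'I_m -> {RV Pr >-> R}).
Hypothesis gY : centered_gaussian_vector S Y.
Context {J : finType}.
Variables (pr : J -> R) (a : J -> 'rV[R]_m).
Hypothesis pr_ge0 : forall j, 0 <= pr j.
Hypothesis pr_sum1 : \sum_j pr j = 1.
Hypothesis mean0 : forall t, \sum_j pr j * dotr t (a j) = 0.
Hypothesis covE : forall t,
  \sum_j pr j * dotr t (a j) ^+ 2 = (t *m S *m t^T) 0 0.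

Let S_ge0 (t : 'rV[R]_m) : 0 <= (t *m S *m t^T) 0 0.
Proof. by rewrite -covE sumr_ge0// => j _; rewrite mulr_ge0// sqr_ge0. Qed.

Let delta_cov i :
  ((delta_mx 0 i : 'rV[R]_m) *m S *m (delta_mx 0 i : 'rV[R]_m)^T) 0 0 = S i i.
Proof.
rewrite -rowE !mxE (bigD1 i)//= !mxE !eqxx mulr1 big1 ?addr0// => j ji.
by rewrite !mxE eqxx (negbTE ji) mulr0.
Qed.

Let dotr_delta1 i (y : 'rV[R]_m) : dotr (delta_mx 0 i) y = y 0 i.
Proof. by rewrite -[delta_mx 0 i]scale1r dotr_delta mul1r. Qed.

Let Sii_ge0 i : 0 <= S i i. Proof. by rewrite -delta_cov. Qed.

Definition scaled_walk n (g : 'rV[R]_m -> R) : R :=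
  iter n (walk pr (fun j => (Num.sqrt n%:R)^-1 *: a j)) g 0.

(** An inequality only because of [n = 0], where the left side is 0. *)
Lemma scaled_walk_sqr_le n i :
  scaled_walk n (fun s : 'rV[R]_m => s 0 i ^+ 2) <= S i i.
Proof.
have sD (s t : 'rV[R]_m) : (s + t) 0 i = s 0 i + t 0 i by rewrite mxE.
have := @iter_walk_sqr _ _ _ _ (fun j => (Num.sqrt n%:R)^-1 *: a j) pr_sum1
  (fun s : 'rV[R]_m => s 0 i) 0 n 0 sD.
rewrite /= /scaled_walk.
rewrite (_ : (fun s : 'rV[R]_m => (s 0 i - 0) ^+ 2) = (fun s => s 0 i ^+ 2)); last first.
  by apply/funext => s; rewrite subr0.
move=> ->; rewrite mxE add0r subr0.
set r := (Num.sqrt n%:R)^-1.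
have -> : \sum_j pr j * (r *: a j) 0 i = 0.
  rewrite (eq_bigr (fun j => r * (pr j * dotr (delta_mx 0 i) (a j)))).
    by rewrite -mulr_sumr mean0 mulr0.
  by move=> j _; rewrite mxE dotr_delta1 mulrCA.
have -> : \sum_j pr j * (r *: a j) 0 i ^+ 2 = r ^+ 2 * S i i.
  rewrite (eq_bigr (fun j => r ^+ 2 * (pr j * dotr (delta_mx 0 i) (a j) ^+ 2))).
    by rewrite -mulr_sumr covE delta_cov.
  by move=> j _; rewrite mxE dotr_delta1 exprMn mulrCA.
rewrite mulr0 expr0n add0r subr0 mulrA.
case: n @r => [|n] r; first by rewrite !mul0r.
by rewrite /r exprVn sqr_sqrtr// divff ?mul1r// pnatr_eq0.
Qed.

Lemma cvg_scaled_walk_cos t th :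
  (fun n => scaled_walk n (fun s => cos (dotr t s + th))) @ \oo -->
  expR (- ((t *m S *m t^T) 0 0 / 2)) * cos th.
Proof.
have [C C0 hC] := walk_cos_cvg_rate pr_ge0 pr_sum1 (mean0 t).
rewrite covE in hC.
apply/subr_cvg0; apply: norm_cvg0.
have hs : (fun n : nat => C * (Num.sqrt n%:R)^-1) @ \oo --> (0 : R).
  rewrite -[X in _ --> X](mulr0 C); apply: cvgM; first exact: cvg_cst.
  apply/cvgrPdist_le => e e0; near=> n.
  rewrite sub0r normrN ger0_norm ?invr_ge0 ?sqrtr_ge0//.
  have n1 : e^-1 ^+ 2 <= n%:R.
    by near: n; exact: nbhs_infty_ger.
  have se : e^-1 <= Num.sqrt n%:R.
    by rewrite -[e^-1]gtr0_norm ?invr_gt0// -sqrtr_sqr; exact: ler_wsqrtr.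
  have ei0 : 0 < e^-1 by rewrite invr_gt0.
  by rewrite -[leRHS]invrK lef_pV2 ?posrE// (lt_le_trans ei0 se).
apply: (squeeze_cvgr _ (@cvg_cst _ _ _ _ _) hs); near=> n.
rewrite normr_ge0/=; apply: hC.
by near: n; exact: nbhs_infty_gt.
Unshelve. all: by end_near. Qed.

Lemma trig_measurable f : trig f -> measurable_fun setT (fun w => f (rvec Y w)).
Proof.
move=> [l fl]; rewrite (_ : (fun w => _) = (fun w =>
    \sum_(u <- l) u.1.1 * cos (dotr u.1.2 (rvec Y w) + u.2))); last exact/funext.
by apply: measurable_sum => u; apply: measurable_funM => //; exact: measurable_cos_dotr.
Qed.

Lemma cvg_scaled_walk_trig f : trig f ->
  (fun n => scaled_walk n f) @ \oo --> \int[Pr]_w (f (rvec Y w)).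
Proof.
move=> [l fl].
have -> : f = (fun y => \sum_(u <- l) u.1.1 * cos (dotr u.1.2 y + u.2)) by exact/funext.
rewrite /scaled_walk; under eq_fun do rewrite walk_sum_iter.
have -> : \int[Pr]_w (\sum_(u <- l) u.1.1 * cos (dotr u.1.2 (rvec Y w) + u.2)) =
   \sum_(u <- l) u.1.1 * (expR (- ((u.1.2 *m S *m u.1.2^T) 0 0 / 2)) * cos u.2).
  rewrite /Rintegral; under eq_integral do rewrite -sumEFin.
  rewrite integral_sum//; last first.
    by move=> u; have := integrableZl measurableT u.1.1 (integrable_cos_dotr Y u.1.2 u.2); apply: eq_integrable.
  rewrite (eq_bigr (fun u => (u.1.1 * (expR (- ((u.1.2 *m S *m u.1.2^T) 0 0 / 2)) * cos u.2))%:E)).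
    by rewrite sumEFin.
  move=> u _; under eq_integral do rewrite EFinM.
  by rewrite integralZl ?(gaussian_cos gY)//; exact: integrable_cos_dotr.
apply: cvg_big => [|u _]; first by move=> [x y] /=; exact: add_continuous.
under eq_fun do rewrite walkZ_iter.
by apply: cvgM; [exact: cvg_cst|exact: cvg_scaled_walk_cos].
Qed.

Section lipschitz.
Variables (C : R) (g : 'rV[R]_m -> R).
Hypothesis C0 : 0 <= C.
Hypothesis gC : lipschitz1 C g.

(** With [L = k + 1], [N = (k + 1)^4] and the free parameter of [trig_approx_dist] equal to 1/(k +
    1), all three error terms are of order 1/(k + 1), which gives [b]. *)
Let T k := trig_approx k.+1%:R (k.+1 ^ 4) g.
Let b k (y : 'rV[R]_m) := C * (\sum_(i < m) (1 + m%:R + y 0 i ^+ 2)) * k.+1%:R^-1 : R.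

Let T_dist k y : `|T k y - g y| <= b k y.
Proof.
have k0 : 0 < k.+1%:R :> R by [].
have k40 : (0 < k.+1 ^ 4)%N by rewrite expn_gt0.
have ki0 : 0 < k.+1%:R^-1 :> R by rewrite invr_gt0.
apply: le_trans (trig_approx_dist y C0 gC k0 k40 ki0) _.
rewrite /b -[leRHS]mulrA; apply: ler_wpM2l => //.
rewrite mulr_suml ler_sum// => i _.
rewrite natrX le_eqVlt; apply/orP; left; apply/eqP.
have : (k.+1%:R : R) != 0 by rewrite gt_eqF.
by move: (k.+1%:R : R) (m%:R : R) => x y' x0; field.
Qed.

Let b_cvg y : (fun k => b k y) @ \oo --> (0 : R).
Proof.
rewrite -[X in _ --> X](mulr0 (C * (\sum_(i < m) (1 + m%:R + y 0 i ^+ 2)))).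
by apply: cvgM; [exact: cvg_cst|exact: cvg_harmonic].
Qed.

(** Obtained from the pointwise approximations, each a finite sum of cosines of linear forms in [Y],
    so no sigma-algebra on row vectors is involved. *)
Lemma lipschitz_rvec_measurable : measurable_fun setT (fun w => g (rvec Y w)).
Proof.
apply: (@measurable_fun_cvg _ _ _ _ (fun k w => T k (rvec Y w))).
  by move=> k; apply: trig_measurable; exact: trig_trig_approx.
move=> w _; apply/subr_cvg0; apply: norm_cvg0.
apply: (squeeze_cvgr _ (@cvg_cst _ _ _ _ _) (b_cvg (rvec Y w))).
by apply: nearW => k; rewrite normr_ge0/= T_dist.
Qed.

Let K := C * (\sum_(i < m) (1 + m%:R + S i i)).

(** The approximation error grows quadratically in the state, but its mean under the walk is bounded
    uniformly in [n] by second moments. Under the law of [Y], dominated convergence applies, as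
    [T k] inherits the bound [M]. In between, [k] is fixed and the trigonometric case applies. *)
Theorem cvg_scaled_walk (M : R) : (forall y, `|g y| <= M) ->
  (fun n => scaled_walk n g) @ \oo --> \int[Pr]_w (g (rvec Y w)).
Proof.
move=> gM; apply/cvgrPdist_le => e e0.
have e30 : 0 < e / 3 by rewrite divr_gt0.
have TM k y : `|T k y| <= M.
  have := @iter_walk_dist _ _ _ _ (trig_step k.+1%:R (k.+1 ^ 4)) (trig_weight_ge0 k.+1%:R y)
    (fun=> True) (k.+1 ^ 4)%N g (fun=> 0) (fun=> M) 0 (fun _ _ _ => I) _ I.
  rewrite !(iter_walk_cst _ (trig_weight_sum1 _ _)) subr0; apply => z _.
  by rewrite subr0.
have HY : \int[Pr]_w (T k (rvec Y w)) @[k --> \oo] --> \int[Pr]_w (g (rvec Y w)).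
  apply: (bounded_cvg_Rintegral (M := M)) => // [k|w].
    by apply: trig_measurable; exact: trig_trig_approx.
  apply/subr_cvg0; apply: norm_cvg0.
  apply: (squeeze_cvgr _ (@cvg_cst _ _ _ _ _) (b_cvg (rvec Y w))).
  by apply: nearW => k; rewrite normr_ge0/= T_dist.
have hK : (fun k => K * harmonic k) @ \oo --> (0 : R).
  rewrite -[X in _ --> X](mulr0 K).
  by apply: cvgM; [exact: cvg_cst|exact: cvg_harmonic].
have [k HYk hk] : exists2 k, `|\int[Pr]_w (g (rvec Y w)) - \int[Pr]_w (T k (rvec Y w))| <= e / 3 &
    K * k.+1%:R^-1 <= e / 3.
  move: HY hK => /cvgrPdist_le/(_ _ e30)[k1 _ h1] /cvgrPdist_le/(_ _ e30)[k2 _ h2].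
  exists (maxn k1 k2); first by apply: h1; rewrite /= leq_maxl.
  have := h2 (maxn k1 k2); rewrite /= leq_maxr sub0r normrN => /(_ isT).
  exact: le_trans (ler_norm _).
have tT : trig (T k) by exact: trig_trig_approx.
have HW n : `|scaled_walk n (T k) - scaled_walk n g| <= e / 3.
  have := @iter_walk_dist _ _ _ pr (fun j => (Num.sqrt n%:R)^-1 *: a j) pr_ge0
    (fun=> True) n (T k) g (b k) 0 (fun _ _ _ => I) (fun s _ => T_dist k s) I.
  move=> /le_trans; apply.
  apply: le_trans hk; rewrite /b.
  rewrite (_ : (fun s : 'rV[R]_m => _) = (fun s => (C * k.+1%:R^-1) * (\sum_(i < m) (1 + m%:R + s 0 i ^+ 2)))); last first.
    by apply/funext => s; rewrite mulrAC.
  have -> : K / k.+1%:R = (C * k.+1%:R^-1) * (\sum_(i < m) (1 + m%:R + S i i)).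
    by rewrite /K mulrAC.
  rewrite walkZ_iter; apply: ler_wpM2l; first by rewrite mulr_ge0 ?invr_ge0.
  rewrite walk_sum_iter ler_sum// => i _.
  rewrite walkD_iter (iter_walk_cst _ pr_sum1) lerD2l.
  exact: scaled_walk_sqr_le.
have /cvgrPdist_le /(_ _ e30) HT := cvg_scaled_walk_trig tT.
near=> n.
have HTn : `|\int[Pr]_w (T k (rvec Y w)) - scaled_walk n (T k)| <= e / 3 by near: n.
have := HW n; move: HYk HTn; rewrite !ler_norml => /andP[? ?] /andP[? ?] /andP[? ?].
by apply/andP; split; lra.
Unshelve. all: by end_near. Qed.

End lipschitz.
End walk_clt.

(** * Semidiscrete dual problem *)

Section coercive_max.
Context {R : realType} {N' : nat}.
Local Notation N := N'.+1.
Implicit Types (z : 'rV[R]_N).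

Lemma lipschitz1_continuous (n : nat) (L : R) (f : 'rV[R]_n -> R) :
  lipschitz1 L f -> continuous f.
Proof.
move=> fL z; have FF : Filter (nbhs z) := nbhs_filter z.
apply/(@cvgrPdist_le _ _ _ (nbhs z) FF) => e e0.
have d0 : 0 < e / (`|L| * n%:R + 1).
  by rewrite divr_gt0// ltr_wpDl// mulr_ge0.
near=> y.
have yz : ball z (e / (`|L| * n%:R + 1)) y by near: y; exact: nbhsx_ballx.
apply: le_trans (fL _ _) _.
apply: le_trans (_ : `|L| * (\sum_(i < n) e / (`|L| * n%:R + 1)) <= _).
  apply: le_trans (ler_wpM2r (sumr_ge0 _ _) (ler_norm L)) _ => //.
  apply: ler_wpM2l => //.
  apply: ler_sum => i _.
  have h : `|z 0 i - y 0 i| < e / (`|L| * n%:R + 1) := yz.2 0 i.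
  exact: ltW.
rewrite sumr_const card_ord -[(_ *+ _)]mulr_natr mulrCA -mulrA ler_piMr ?(ltW e0)//.
rewrite mulrC ler_pdivrMr ?mul1r ?lerDl// ltr_wpDl// mulr_ge0//.
Unshelve. all: by end_near. Qed.

(** Coercivity modulo constants: the bound on [F] decreases linearly in the gap between the largest
    coordinate [z 0 j] and any other one. *)
Definition osc_coercive (C del : R) (F : 'rV[R]_N -> R) :=
  forall z i j, (forall k, z 0 k <= z 0 j) -> F z <= C - del * (z 0 j - z 0 i).

Definition shift_invariant (F : 'rV[R]_N -> R) :=
  forall z s, F (z + const_mx s) = F z.

Definition box (K : R) : set 'rV[R]_N := [set z | forall i, - K <= z 0 i <= 0].

Lemma box_compact K : compact (box K).
Proof.
have := @rV_compact R _ (fun=> `[- K, 0]%classic) (fun=> @segment_compact R _ _).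
by move=> /(_ N); congr compact; apply/seteqP; split => z /= zK i; have := zK i;
  rewrite /= in_itv.
Qed.

Lemma ex_argmax z : exists j, forall k, z 0 k <= z 0 j.
Proof.
have [j _ zj] := arg_maxP (fun i => z 0 i) (isT : xpredT (ord0 : 'I_N)).
by exists j => k; exact: zj.
Qed.

(** Subtracting the largest coordinate makes all coordinates nonpositive; coercivity where
    [F z >= - b] bounds them from below. *)
Lemma coercive_shift_box C del b F z : 0 < del ->
    osc_coercive C del F -> shift_invariant F -> - b <= F z ->
  exists2 s, box ((C + b) / del) (z + const_mx s) & F (z + const_mx s) = F z.
Proof.
move=> del0 Fc Fs bF; have [j zj] := ex_argmax z.
exists (- z 0 j); last exact: Fs.
move=> i; rewrite !mxE subr_le0 zj andbT lerNl opprB ler_pdivlMr//.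
by have := Fc z i j zj; rewrite mulrC; lra.
Qed.

(** The box has a maximum by compactness. A point with [F z' >= - b] can be shifted into the box,
    and one below [- b] is beaten by the shifted origin. *)
Lemma coercive_max C del b L F : 0 < del -> osc_coercive C del F ->
    shift_invariant F -> lipschitz1 L F -> - b <= F 0 ->
  exists2 z, box ((C + b) / del) z & forall z', F z' <= F z.
Proof.
move=> del0 Fc Fs FL F0.
have cF : continuous F by exact: lipschitz1_continuous FL.
have [s0 s0b s0F] := coercive_shift_box del0 Fc Fs F0.
have [z zb zmax] := @EVT_max_rV R N F (box ((C + b) / del)) (ex_intro _ _ s0b)
  (@box_compact _) (continuous_subspaceT cF).
rewrite inE in zb; exists z => // z'.
have [bF|Fb] := leP (- b) (F z').
  have [s sb <-] := coercive_shift_box del0 Fc Fs bF.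
  by apply: zmax; rewrite inE.
apply: le_trans (ltW Fb) _; apply: le_trans F0 _; rewrite -s0F.
by apply: zmax; rewrite inE.
Qed.

End coercive_max.

(** * The c-transform of a potential on finitely many points *)

Section min_cost.
Context {R : realType} {N' : nat} {T : Type}.
Local Notation N := N'.+1.
Variable c : 'I_N -> T -> R.
Implicit Types (z : 'rV[R]_N) (y : T).

(** The c-transform of [z]. The term of [ord0], itself one of the minimised terms, is the initial
    value and keeps the minimum real. *)
Definition min_cost z y : R :=
  \big[Num.min/c ord0 y - z 0 ord0]_(i < N) (c i y - z 0 i).

Lemma min_cost_le z y i : min_cost z y <= c i y - z 0 i.
Proof. exact: bigmin_le_cond. Qed.

Lemma min_cost_attained z y : exists i, min_cost z y = c i y - z 0 i.
Proof.
rewrite /min_cost; elim/big_ind : _ => [|x1 x2 [i ->] [j ->]|i _].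
- by exists ord0.
- by case: leP => _; [exists i|exists j].
- by exists i.
Qed.

Lemma min_cost_glb z y (u : R) : (forall i, u <= c i y - z 0 i) -> u <= min_cost z y.
Proof. by move=> uc; have [i ->] := min_cost_attained z y. Qed.

Lemma min_cost_lipschitz y : lipschitz1 1 (min_cost ^~ y).
Proof.
apply: lipschitz1_onesided => z z'; rewrite mul1r.
have [i ->] := min_cost_attained z' y.
have := min_cost_le z y i.
have : z' 0 i - z 0 i <= \sum_i `|z 0 i - z' 0 i|.
  rewrite (bigD1 i)//= distrC.
  apply: le_trans (ler_norm _) _; rewrite lerDl.
  by apply: sumr_ge0.
lra.
Qed.

Lemma min_cost_shift z s y : min_cost (z + const_mx s) y = min_cost z y - s.
Proof.
apply/eqP; rewrite eq_le; apply/andP; split.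
  have [i ->] := min_cost_attained z y.
  by apply: le_trans (min_cost_le _ _ i) _; rewrite !mxE; lra.
apply: min_cost_glb => i; rewrite !mxE.
by have := min_cost_le z y i; lra.
Qed.

Lemma min_cost_dominated z y : (forall i, 0 <= c i y) ->
  `|min_cost z y| <= \sum_i c i y + \sum_i `|z 0 i|.
Proof.
move=> c0; have [i ->] := min_cost_attained z y.
apply: le_trans (ler_normB _ _) _; rewrite ger0_norm//.
apply: lerD; rewrite (bigD1 i)//= lerDl; exact: sumr_ge0.
Qed.

End min_cost.

Section min_cost_integral.
Context {R : realType} {N' : nat} {d : measure_display} {T : measurableType d}.
Local Notation N := N'.+1.
Variables (Q : probability T R) (c : 'I_N -> T -> R).
Implicit Types (z v : 'rV[R]_N) (y : T).
Hypothesis mc : forall i, measurable_fun setT (c i).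
Hypothesis c0 : forall i y, 0 <= c i y.

Lemma measurable_min_cost z : measurable_fun setT (min_cost c z).
Proof.
rewrite /min_cost; elim: (index_enum _) => [|i r IH].
  by under eq_fun do rewrite big_nil; exact: measurable_funB.
under eq_fun do rewrite big_cons.
by apply: measurable_minr => //; exact: measurable_funB.
Qed.

Hypothesis Ic : forall i, Q.-integrable setT (EFin \o c i).

Let Isum K : Q.-integrable setT (fun y => (\sum_i c i y + K)%:E).
Proof.
have h : Q.-integrable setT (fun y => (\sum_i (c i y)%:E)%E).
  exact: (@integrable_sum _ _ _ Q setT measurableT _ (index_enum _) xpredT
    (fun i y => (c i y)%:E) (fun i _ => Ic i)).
have := integrableD measurableT h (finite_measure_integrable_cst Q K measurableT).
by apply: eq_integrable => // y _; rewrite /= EFinD sumEFin.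
Qed.

Lemma dominated_integrable (f : T -> R) K : measurable_fun setT f ->
    (forall y, `|f y| <= \sum_i c i y + K) -> Q.-integrable setT (EFin \o f).
Proof.
move=> mf fK; apply: (@le_integrable _ _ _ _ setT _ _ (fun y => (\sum_i c i y + K)%:E)) => //.
- exact/measurable_EFinP.
- by move=> y _; rewrite lee_fin (le_trans (fK y))// ler_norm.
Qed.

Lemma integrable_min_cost z : Q.-integrable setT (EFin \o min_cost c z).
Proof.
apply: (dominated_integrable (K := \sum_i `|z 0 i|)); first exact: measurable_min_cost.
by move=> y; exact: min_cost_dominated.
Qed.

Lemma Rintegral_dist (f g : T -> R) K : Q.-integrable setT (EFin \o f) ->
    Q.-integrable setT (EFin \o g) -> (forall y, `|f y - g y| <= K) ->
  `|\int[Q]_y f y - \int[Q]_y g y| <= K.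
Proof.
move=> If Ig fg; rewrite -RintegralB//.
have Ifg : Q.-integrable setT (EFin \o (fun y => f y - g y)).
  by have := integrableB measurableT If Ig; apply: eq_integrable.
apply: le_trans (le_normr_Rintegral _ Ifg) _ => //.
have -> : K = \int[Q]_y (cst K y).
  by rewrite Rintegral_cst//= probability_setT mulr1.
apply: le_Rintegral => //.
- by have := integrable_norm Ifg; apply: eq_integrable.
- exact: finite_measure_integrable_cst.
Qed.

Section affine_integral.
Variables (phi : 'rV[R]_N -> T -> R) (v : 'rV[R]_N).
Hypothesis Iphi : forall z, Q.-integrable setT (EFin \o phi z).
Hypothesis v1 : \sum_i v 0 i = 1.

(** An abstract [phi] serves both the minimum and its entropic smoothing. The constant 2 adds the
    linear part, with weights at most 1, to the integral of a 1-Lipschitz function. *)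
Lemma affine_integral_lipschitz : (forall i, 0 <= v 0 i) ->
    (forall y, lipschitz1 1 (phi ^~ y)) ->
  lipschitz1 2 (fun z => \sum_i v 0 i * z 0 i + \int[Q]_y phi z y).
Proof.
move=> v0 Lphi z z'; rewrite opprD addrACA -sumrB.
under eq_bigr do rewrite -mulrBr.
apply: le_trans (ler_normD _ _) _; rewrite mulrDl !mul1r; apply: lerD.
  apply: le_trans (ler_norm_sum _ _ _) _; apply: ler_sum => i _.
  rewrite normrM ger0_norm// ler_piMl//.
  by rewrite -v1 (bigD1 i)//= lerDl sumr_ge0.
by apply: Rintegral_dist => // y; have := Lphi y z z'; rewrite mul1r.
Qed.

Lemma affine_integral_shift : (forall z s y, phi (z + const_mx s) y = phi z y - s) ->
  shift_invariant (fun z => \sum_i v 0 i * z 0 i + \int[Q]_y phi z y).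
Proof.
move=> phiD z s; under eq_Rintegral do rewrite phiD.
rewrite RintegralB//; last exact: (finite_measure_integrable_cst Q s).
rewrite [X in _ - X](_ : _ = s); last by rewrite Rintegral_cst//= probability_setT mulr1.
rewrite (eq_bigr (fun i => v 0 i * z 0 i + v 0 i * s)); last first.
  by move=> i _; rewrite !mxE mulrDr.
by rewrite big_split/= -mulr_suml v1; ring.
Qed.

End affine_integral.

Definition dual v z : R := \sum_i v 0 i * z 0 i + \int[Q]_y min_cost c z y.

Definition cost_bound : R := \sum_i \int[Q]_y c i y.

Lemma dual_lipschitz v : (forall i, 0 <= v 0 i) -> \sum_i v 0 i = 1 ->
  lipschitz1 2 (dual v).
Proof.
move=> v0 v1; apply: affine_integral_lipschitz => // [z|y].
  exact: integrable_min_cost.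
exact: min_cost_lipschitz.
Qed.

Lemma dual_shift v : \sum_i v 0 i = 1 -> shift_invariant (dual v).
Proof.
move=> v1; apply: affine_integral_shift => // [z|z s y].
  exact: integrable_min_cost.
exact: min_cost_shift.
Qed.

(** The minimum is at most the term of the largest coordinate, [c j y - z 0 j], while the weighted
    mean of [z] falls below [z 0 j] by at least [del] times any single gap. *)
Lemma dual_coercive v del : (forall i, del <= v 0 i) -> 0 <= del ->
  \sum_i v 0 i = 1 -> osc_coercive cost_bound del (dual v).
Proof.
move=> vdel del0 v1 z i j zj.
have v0 k : 0 <= v 0 k by exact: le_trans (vdel k).
have h1 : \int[Q]_y min_cost c z y <= cost_bound - z 0 j.
  apply: (@le_trans _ _ (\int[Q]_y (c j y - z 0 j))).
    apply: le_Rintegral => //.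
    - exact: integrable_min_cost.
    - have := integrableB measurableT (Ic j) (finite_measure_integrable_cst Q (z 0 j) measurableT).
      by apply: eq_integrable.
    - by move=> y _; exact: min_cost_le.
  rewrite RintegralB//; last exact: (finite_measure_integrable_cst Q (z 0 j)).
  rewrite [X in _ - X](_ : _ = z 0 j); last first.
    by rewrite Rintegral_cst//= probability_setT mulr1.
  rewrite lerD2r /cost_bound (bigD1 j)//= lerDl sumr_ge0// => k _.
  by apply: Rintegral_ge0.
have h2 : \sum_k v 0 k * z 0 k - z 0 j <= - (del * (z 0 j - z 0 i)).
  have -> : \sum_k v 0 k * z 0 k - z 0 j = \sum_k v 0 k * (z 0 k - z 0 j).
    rewrite [in RHS](eq_bigr (fun k => v 0 k * z 0 k - v 0 k * z 0 j)).
      by rewrite sumrB -mulr_suml v1 mul1r.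
    by move=> k _; rewrite mulrBr.
  rewrite (bigD1 i)//= -[leRHS]addr0; apply: lerD.
    rewrite -mulrN opprB; apply: ler_wnM2r => //; first by rewrite subr_le0.
  by apply: sumr_le0 => k _; rewrite mulr_ge0_le0// subr_le0.
rewrite /dual; lra.
Qed.

Lemma dual0_ge0 v : 0 <= dual v 0.
Proof.
rewrite /dual big1 ?add0r; last by move=> i _; rewrite mxE mulr0.
apply: Rintegral_ge0 => y _; apply: min_cost_glb => i.
by rewrite mxE subr0.
Qed.

End min_cost_integral.

Lemma Rintegral_sum {R : realType} {d : measure_display} {T : measurableType d}
    (mu : {measure set T -> \bar R}) (I : Type) (r : seq I) (F : I -> T -> R) :
    (forall i, mu.-integrable setT (EFin \o F i)) ->
  \int[mu]_y (\sum_(i <- r) F i y) = \sum_(i <- r) \int[mu]_y F i y.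
Proof.
move=> IF; rewrite /Rintegral; under eq_integral do rewrite -sumEFin.
rewrite integral_sum// (eq_bigr (fun i => (fine (\int[mu]_y (F i y)%:E))%:E)).
  by rewrite sumEFin.
by move=> i _; rewrite fineK//; exact: integrable_fin_num (IF i).
Qed.

(** * Entropic regularisation of the dual *)

Section entropic.
Context {R : realType} {N' : nat} {d : measure_display} {T : measurableType d}.
Local Notation N := N'.+1.
Variables (Q : probability T R) (c : 'I_N -> T -> R).
Implicit Types (z v : 'rV[R]_N) (y : T) (k : 'I_N).
Hypothesis mc : forall i, measurable_fun setT (c i).
Hypothesis c0 : forall i y, 0 <= c i y.
Hypothesis Ic : forall i, Q.-integrable setT (EFin \o c i).
Variable e : R.
Hypothesis e0 : 0 < e.

Definition gibbs z y k : R := expR ((z 0 k - c k y) / e).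
Definition gibbs_sum z y : R := \sum_k gibbs z y k.
Definition softmin z y : R := - (e * ln (gibbs_sum z y)).
Definition gibbs_prob z k y : R := gibbs z y k / gibbs_sum z y.

Lemma gibbs_gt0 z y k : 0 < gibbs z y k. Proof. exact: expR_gt0. Qed.

Lemma gibbs_le_sum z y k : gibbs z y k <= gibbs_sum z y.
Proof.
rewrite /gibbs_sum (bigD1 k)//= lerDl sumr_ge0// => j _.
exact: ltW (gibbs_gt0 _ _ _).
Qed.

Lemma gibbs_sum_gt0 z y : 0 < gibbs_sum z y.
Proof. exact: lt_le_trans (gibbs_gt0 z y ord0) (gibbs_le_sum _ _ _). Qed.

Lemma gibbs_prob_gt0 z k y : 0 < gibbs_prob z k y.
Proof. by rewrite divr_gt0 ?gibbs_gt0 ?gibbs_sum_gt0. Qed.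

Lemma gibbs_prob_sum1 z y : \sum_k gibbs_prob z k y = 1.
Proof. by rewrite -mulr_suml divff// gt_eqF// gibbs_sum_gt0. Qed.

Lemma gibbs_prob_le1 z k y : gibbs_prob z k y <= 1.
Proof. by rewrite ler_pdivrMr ?gibbs_sum_gt0// mul1r gibbs_le_sum. Qed.

Lemma softmin_le z y : softmin z y <= min_cost c z y.
Proof.
apply: min_cost_glb => i; rewrite /softmin lerNl opprB.
rewrite mulrC -ler_pdivrMr// -[leLHS]expRK ler_ln ?posrE ?expR_gt0 ?gibbs_sum_gt0//.
exact: gibbs_le_sum.
Qed.

(** A sum of [N] exponentials costs [e ln N], replaced by the cruder [e N] through ln N <= N - 1. *)
Lemma softmin_ge z y : min_cost c z y - e * N%:R <= softmin z y.
Proof.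
rewrite /softmin lerBlDr addrC -lerBlDr opprK addrC mulrC.
set u := min_cost c z y.
have h : gibbs_sum z y <= N%:R * expR (- u / e).
  rewrite /gibbs_sum; apply: (@le_trans _ _ (\sum_(k < N) expR (- u / e))).
    apply: ler_sum => k _; rewrite /gibbs ler_expR ler_pM2r ?invr_gt0//.
    by have := min_cost_le c z y k; rewrite -/u; lra.
  by rewrite sumr_const card_ord -[leLHS]mulr_natr mulrC.
have h2 : ln (gibbs_sum z y) <= N%:R - u / e.
  apply: (@le_trans _ _ (ln (N%:R * expR (- u / e)))).
    by rewrite ler_ln ?posrE ?gibbs_sum_gt0// mulr_gt0 ?expR_gt0.
  rewrite lnM ?posrE ?expR_gt0// expRK mulNr lerD2r.
  have h3 := @le_ln1Dx R (N%:R - 1).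
  have e1 : 1 + (N%:R - 1) = N%:R :> R by ring.
  rewrite e1 in h3.
  have n1 : (1 : R) <= N%:R by rewrite ler1n.
  by apply: le_trans (h3 _) _; lra.
rewrite -lerBrDr -ler_pdivlMr//.
by rewrite (le_trans h2)// mulrBl [e * _]mulrC mulfK ?gt_eqF.
Qed.

Lemma softmin_lipschitz y : lipschitz1 1 (softmin ^~ y).
Proof.
apply: lipschitz1_onesided => z z'; rewrite mul1r.
set M := \sum_i _.
have h : gibbs_sum z' y <= gibbs_sum z y * expR (M / e).
  rewrite /gibbs_sum mulr_suml; apply: ler_sum => k _.
  rewrite /gibbs -expRD ler_expR -mulrDl ler_pM2r ?invr_gt0//.
  have : z' 0 k - z 0 k <= M.
    rewrite /M (bigD1 k)//= distrC; apply: le_trans (ler_norm _) _.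
    by rewrite lerDl sumr_ge0.
  lra.
have h2 : ln (gibbs_sum z' y) <= ln (gibbs_sum z y) + M / e.
  rewrite -[M / e]expRK -lnM ?posrE ?expR_gt0 ?gibbs_sum_gt0//.
  by rewrite ler_ln ?posrE ?mulr_gt0 ?expR_gt0 ?gibbs_sum_gt0.
rewrite /softmin opprK addrC -mulrBr mulrC -ler_pdivlMr//.
by rewrite lerBlDl.
Qed.

Lemma softmin_shift z s y : softmin (z + const_mx s) y = softmin z y - s.
Proof.
rewrite /softmin.
have -> : gibbs_sum (z + const_mx s) y = gibbs_sum z y * expR (s / e).
  rewrite /gibbs_sum mulr_suml; apply: eq_bigr => k _.
  by rewrite /gibbs -expRD -mulrDl !mxE addrAC.
rewrite lnM ?posrE ?expR_gt0 ?gibbs_sum_gt0// expRK mulrDr opprD; congr (_ - _).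
by rewrite mulrC divfK// gt_eqF.
Qed.

(** Moving one coordinate multiplies the Gibbs sum by exactly [1 + x], so the difference is
    [e ln (1 + x) <= e x]. This one-sided bound replaces differentiation under the integral. *)
Lemma softmin_perturb z y k t :
  softmin z y - softmin (z + t *: delta_mx 0 k) y <=
  e * (expR (t / e) - 1) * gibbs_prob z k y.
Proof.
set x := gibbs_prob z k y * (expR (t / e) - 1).
have Zg := gibbs_sum_gt0 z y.
have E : gibbs_sum (z + t *: delta_mx 0 k) y = gibbs_sum z y * (1 + x).
  rewrite mulrDr mulr1 /x mulrA /gibbs_prob mulrCA divff ?gt_eqF// mulr1.
  rewrite /gibbs_sum (bigD1 k)//= [in RHS](bigD1 k)//=.
  rewrite (eq_bigr (fun j => gibbs z y j)); last first.
    by move=> j jk; rewrite /gibbs !mxE eqxx (negbTE jk) mulr0 addr0.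
  have -> : gibbs (z + t *: delta_mx 0 k) y k = gibbs z y k * expR (t / e).
    by rewrite /gibbs -expRD -mulrDl !mxE !eqxx mulr1 addrAC.
  ring.
have x1 : 0 < 1 + x.
  by rewrite -(pmulr_rgt0 _ Zg) -E gibbs_sum_gt0.
rewrite /softmin E lnM ?posrE//.
have xN1 : -1 < x by lra.
have := le_ln1Dx xN1.
move=> h; rewrite -mulrA [_ * gibbs_prob _ _ _]mulrC -/x.
have : e * ln (1 + x) <= e * x by rewrite ler_pM2l.
lra.
Qed.

Lemma measurable_gibbs z k : measurable_fun setT (fun y => gibbs z y k).
Proof.
apply: (measurableT_comp (f := expR)) => //.
by apply: measurable_funM => //; exact: measurable_funB.
Qed.

Lemma measurable_gibbs_sum z : measurable_fun setT (gibbs_sum z).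
Proof. by apply: measurable_sum => k; exact: measurable_gibbs. Qed.

Lemma measurable_softmin z : measurable_fun setT (softmin z).
Proof.
apply: measurableT_comp => //; apply: measurable_funM => //.
by apply: (measurableT_comp (f := @ln R)) => //; exact: measurable_gibbs_sum.
Qed.

Lemma measurable_gibbs_prob z k : measurable_fun setT (gibbs_prob z k).
Proof.
rewrite (_ : gibbs_prob z k = (fun y => expR ((z 0 k - c k y) / e - ln (gibbs_sum z y)))).
  apply: (measurableT_comp (f := expR)) => //; apply: measurable_funB.
    by apply: measurable_funM => //; exact: measurable_funB.
  by apply: (measurableT_comp (f := @ln R)) => //; exact: measurable_gibbs_sum.
apply/funext => y; rewrite expRD expRN lnK//.
by rewrite posrE gibbs_sum_gt0.
Qed.

Lemma integrable_softmin z : Q.-integrable setT (EFin \o softmin z).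
Proof.
apply: (dominated_integrable Ic (K := \sum_i `|z 0 i| + e * N%:R)).
  exact: measurable_softmin.
move=> y; have := softmin_ge z y; have := softmin_le z y.
have := min_cost_dominated z (c0 ^~ y); rewrite !ler_norml.
have : 0 <= e * N%:R by rewrite mulr_ge0// ltW.
by move=> ? /andP[? ?] ? ?; apply/andP; split; lra.
Qed.

Lemma integrable_gibbs_prob z k : Q.-integrable setT (EFin \o gibbs_prob z k).
Proof.
apply: (@bounded_integrable _ _ _ Q _ 1); first exact: measurable_gibbs_prob.
by move=> y; rewrite ger0_norm ?gibbs_prob_le1// ltW// gibbs_prob_gt0.
Qed.

Definition soft_dual v z : R := \sum_i v 0 i * z 0 i + \int[Q]_y softmin z y.

Section first_order.
Variables (v z : 'rV[R]_N).
Hypothesis v1 : \sum_i v 0 i = 1.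
Hypothesis zmax : forall z', soft_dual v z' <= soft_dual v z.

Let mass k : R := \int[Q]_y gibbs_prob z k y.

(** The first-order condition in integrated form: optimality of [z] against a change of coordinate
    [k], combined with [softmin_perturb]. *)
Let mass_ge k t : v 0 k * t <= e * (expR (t / e) - 1) * mass k.
Proof.
have := zmax (z + t *: delta_mx 0 k); rewrite /soft_dual.
have -> : \sum_i v 0 i * (z + t *: delta_mx 0 k) 0 i = \sum_i v 0 i * z 0 i + v 0 k * t.
  rewrite (bigD1 k)//= [in RHS](bigD1 k)//= !mxE !eqxx mulr1 mulrDr.
  rewrite (eq_bigr (fun i => v 0 i * z 0 i)); first by ring.
  by move=> i ik; rewrite !mxE eqxx (negbTE ik) mulr0 addr0.
move=> h.
have : \int[Q]_y softmin z y - \int[Q]_y softmin (z + t *: delta_mx 0 k) y <=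
    e * (expR (t / e) - 1) * mass k.
  rewrite -RintegralB//; try exact: integrable_softmin.
  rewrite /mass -RintegralZl//; last exact: integrable_gibbs_prob.
  apply: le_Rintegral => //.
  - have := integrableB measurableT (integrable_softmin z) (integrable_softmin (z + t *: delta_mx 0 k)).
    by apply: eq_integrable.
  - have := integrableZl measurableT (e * (expR (t / e) - 1)) (integrable_gibbs_prob z k).
    by apply: eq_integrable.
  - by move=> y _; exact: softmin_perturb.
move: h; set A := \int[Q]_y _; set B := \int[Q]_y _; set D := e * _ * _.
set F := \sum_i _; set G := v 0 k * t.
move: A B D F G => A B D F G; lra.
Qed.

Let mass_ge0 k : 0 <= mass k.
Proof. by apply: Rintegral_ge0 => y _; exact: ltW (gibbs_prob_gt0 _ _ _). Qed.

(* Dividing [mass_ge] by [t] and letting [t] tend to [0+] gives one inequality;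
   both sides sum to 1. *)
Let v_le_mass k : v 0 k <= mass k.
Proof.
apply/ler_addgt0Pr => s s0.
set a := mass k.
(* [u <= 1/2] gives [expR u - 1 <= u (1 + 2 u)], from [expR u <= 1 / (1 - u)]; the other bound on
   [u] makes the excess [2 u a] at most [s]. *)
pose u := Num.min (2^-1) (s / (2 * (a + 1))).
have a1 : 0 < a + 1 by rewrite ltr_wpDl// mass_ge0.
have u0 : 0 < u by rewrite lt_min invr_gt0 ltr0n/= divr_gt0// mulr_gt0.
have u1 : u <= 2^-1 by rewrite ge_min lexx.
have us : 2 * u * a <= s.
  apply: (@le_trans _ _ (u * (2 * (a + 1)))).
    have -> : 2 * u * a = u * (2 * a) by ring.
    by rewrite ler_wpM2l ?(ltW u0)//; lra.
  by rewrite -ler_pdivlMr ?mulr_gt0// ge_min lexx orbT.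
have := mass_ge k (e * u); rewrite -/a (_ : e * u / e = u); last by rewrite mulrC mulKf// gt_eqF.
move=> h.
have hexp : expR u - 1 <= u * (1 + 2 * u).
  have h1 : (1 - u) * expR u <= 1.
    rewrite -[leRHS](_ : expR (- u) * expR u = 1); last by rewrite -expRD addNr expR0.
    by rewrite ler_pM2r ?expR_gt0// expR_ge1Dx.
  have h2 : 0 <= (1 - 2 * u) * u * u by rewrite !mulr_ge0// ?(ltW u0)//; lra.
  rewrite -(@ler_pM2l _ (1 - u)); last lra.
  rewrite mulrBr mulr1 lerBlDr (le_trans h1)// -subr_ge0.
  by rewrite (_ : _ - 1 = (1 - 2 * u) * u * u)//; ring.
have h2 : v 0 k * u <= u * (1 + 2 * u) * a.
  rewrite -(ler_pM2l e0) mulrCA (le_trans h)// -mulrA ler_wpM2l ?(ltW e0)//.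
  by apply: ler_wpM2r => //; exact: mass_ge0.
rewrite -(ler_pM2r u0) (le_trans h2)// -mulrA mulrC ler_wpM2r ?(ltW u0)//.
by rewrite mulrDl mul1r lerD2l.
Qed.

Lemma gibbs_prob_integral k : \int[Q]_y gibbs_prob z k y = v 0 k.
Proof.
have sm : \sum_k mass k = 1.
  rewrite /mass -Rintegral_sum//; last by move=> i; exact: integrable_gibbs_prob.
  under eq_Rintegral do rewrite gibbs_prob_sum1.
  by rewrite Rintegral_cst//= probability_setT mulr1.
apply/esym/eqP; rewrite -subr_eq0 -oppr_eq0 opprB.
have : \sum_k (mass k - v 0 k) == 0 by rewrite sumrB sm v1 subrr.
rewrite psumr_eq0; last by move=> i _; rewrite subr_ge0 v_le_mass.
by move=> /allP /(_ k); rewrite mem_index_enum => /(_ isT).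
Qed.

End first_order.

(** With q the Gibbs probabilities, sum q c = sum q z + softmin - e sum q ln q exactly. Each entropy
    term satisfies [- q ln q <= 1], hence [e N] in total. *)
Lemma gibbs_prob_cost z y :
  \sum_k gibbs_prob z k y * c k y <=
  \sum_k z 0 k * gibbs_prob z k y + min_cost c z y + e * N%:R.
Proof.
have Zg := gibbs_sum_gt0 z y.
have H k : gibbs_prob z k y * c k y <=
    z 0 k * gibbs_prob z k y + gibbs_prob z k y * softmin z y + e.
  set q := gibbs_prob z k y; have q0 : 0 < q by exact: gibbs_prob_gt0.
  have lq : ln q = (z 0 k - c k y) / e - ln (gibbs_sum z y).
    by rewrite /q /gibbs_prob ln_div ?posrE ?gibbs_gt0// expRK.
  have cE : c k y = z 0 k + softmin z y - e * ln q.
    by rewrite lq /softmin mulrBr [e * (_ / _)]mulrC divfK ?gt_eqF//; ring.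
  have h : - (q * ln q) <= 1.
    have qi : 0 < q^-1 by rewrite invr_gt0.
    have h1 := @le_ln1Dx R (q^-1 - 1).
    have e1 : 1 + (q^-1 - 1) = q^-1 by ring.
    rewrite e1 lnV ?posrE// in h1.
    have {}h1 : - ln q <= q^-1 by apply: le_trans (h1 _) _; lra.
    by rewrite -mulrN -(mulfV (lt0r_neq0 q0)) ler_pM2l.
  rewrite cE; have : e * (- (q * ln q)) <= e * 1 by rewrite ler_pM2l.
  lra.
apply: le_trans (ler_sum _ (fun k _ => H k)) _.
rewrite !big_split/= -mulr_suml gibbs_prob_sum1 mul1r sumr_const card_ord.
by rewrite mulr_natr lerD2r lerD2l softmin_le.
Qed.

(** Coercivity is inherited from [dual], since the soft minimum lies below the minimum. *)
Lemma soft_dual_max v del : 0 < del -> (forall i, del <= v 0 i) ->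
  \sum_i v 0 i = 1 -> exists z, forall z', soft_dual v z' <= soft_dual v z.
Proof.
move=> del0 vdel v1.
have v0 i : 0 <= v 0 i by exact: le_trans (ltW del0) (vdel i).
have Fc : osc_coercive (cost_bound Q c) del (soft_dual v).
  move=> z i j zj.
  apply: le_trans (dual_coercive mc c0 Ic vdel (ltW del0) v1 i zj).
  rewrite /soft_dual /dual lerD2l; apply: le_Rintegral => //.
  - exact: integrable_softmin.
  - exact: integrable_min_cost.
  - by move=> y _; exact: softmin_le.
have Fs : shift_invariant (soft_dual v).
  by apply: affine_integral_shift => // [z|z s y]; [exact: integrable_softmin|exact: softmin_shift].
have FL : lipschitz1 2 (soft_dual v).
  by apply: affine_integral_lipschitz => // [z|y]; [exact: integrable_softmin|exact: softmin_lipschitz].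
have F0 : - (e * N%:R) <= soft_dual v 0.
  rewrite /soft_dual big1 ?add0r; last by move=> i _; rewrite mxE mulr0.
  have -> : - (e * N%:R) = \int[Q]_y (cst (- (e * N%:R)) y).
    by rewrite Rintegral_cst//= probability_setT mulr1.
  apply: le_Rintegral => //.
  - exact: finite_measure_integrable_cst.
  - exact: integrable_softmin.
  - move=> y _; apply: le_trans (softmin_ge 0 y); rewrite /= lerBrDr addNr.
    by apply: min_cost_glb => i; rewrite mxE subr0.
have [z _ zmax] := coercive_max del0 Fc Fs FL F0.
by exists z.
Qed.

End entropic.

Section semidiscrete.
Context {R : realType} {N' : nat} {d : measure_display} {T : measurableType d}.
Local Notation N := N'.+1.
Variables (Q : probability T R) (c : 'I_N -> T -> R) (v : 'rV[R]_N).
Hypothesis mc : forall i, measurable_fun setT (c i).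
Hypothesis c0 : forall i y, 0 <= c i y.
Hypothesis Ic : forall i, Q.-integrable setT (EFin \o c i).
Hypothesis v0 : forall i, 0 < v 0 i.
Hypothesis v1 : \sum_i v 0 i = 1.

Lemma ex_weight_lb : exists2 del, 0 < del & forall i, del <= v 0 i.
Proof.
exists (\big[Num.min/v 0 ord0]_i v 0 i); last by move=> i; exact: bigmin_le_cond.
by elim/big_ind : _ => // x y x0 y0; rewrite lt_min x0 y0.
Qed.

(* Entropic regularisation: the Gibbs probabilities of a maximiser of the
   regularised dual are an exact transport plan with almost optimal cost. *)
Theorem semidiscrete_plan (eps : R) : 0 < eps ->
  exists (z : 'rV[R]_N) (q : 'I_N -> T -> R),
    [/\ forall k, measurable_fun setT (q k),
        forall k y, 0 <= q k y, forall y, \sum_k q k y = 1,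
        forall k, \int[Q]_y q k y = v 0 k &
        \int[Q]_y (\sum_k q k y * c k y) <= dual Q c v z + eps].
Proof.
move=> eps0.
have [del del0 vdel] := ex_weight_lb.
(* This temperature compensates the loss [e N] of [gibbs_prob_cost]. *)
have e0 : 0 < eps / N%:R by rewrite divr_gt0.
have [z zmax] := soft_dual_max mc c0 Ic e0 del0 vdel v1.
exists z, (gibbs_prob c (eps / N%:R) z); split.
- by move=> k; exact: measurable_gibbs_prob.
- by move=> k y; exact: ltW (gibbs_prob_gt0 _ _ _ _ _).
- exact: gibbs_prob_sum1.
- by move=> k; exact: gibbs_prob_integral.
have Iq k : Q.-integrable setT (EFin \o gibbs_prob c (eps / N%:R) z k).
  exact: integrable_gibbs_prob.
have mq k : measurable_fun setT (gibbs_prob c (eps / N%:R) z k).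
  exact: measurable_gibbs_prob.
have Izq : Q.-integrable setT (EFin \o (fun y => \sum_k z 0 k * gibbs_prob c (eps / N%:R) z k y)).
  have := @integrable_sum _ _ _ Q setT measurableT _ (index_enum _) xpredT
    (fun k y => ((z 0 k)%:E * (gibbs_prob c (eps / N%:R) z k y)%:E)%E)
    (fun k _ => integrableZl measurableT (z 0 k) (Iq k)).
  by apply: eq_integrable => // y _; rewrite /= -sumEFin.
have Im : Q.-integrable setT (EFin \o min_cost c z) by exact: integrable_min_cost.
have Ie : Q.-integrable setT (EFin \o cst eps) by exact: finite_measure_integrable_cst.
have Izm : Q.-integrable setT (EFin \o (fun y =>
    \sum_k z 0 k * gibbs_prob c (eps / N%:R) z k y + min_cost c z y)).
  by have := integrableD measurableT Izq Im; apply: eq_integrable.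
have -> : dual Q c v z + eps = \int[Q]_y (\sum_k z 0 k * gibbs_prob c (eps / N%:R) z k y +
    min_cost c z y + eps).
  rewrite RintegralD// RintegralD//.
  rewrite Rintegral_cst//= probability_setT mulr1; congr (_ + _ + _).
  rewrite Rintegral_sum//; last first.
    by move=> k; have := integrableZl measurableT (z 0 k) (Iq k); apply: eq_integrable.
  apply: eq_bigr => k _; rewrite RintegralZl//.
  by rewrite (gibbs_prob_integral mc c0 Ic e0 v1 zmax) mulrC.
apply: le_Rintegral => //.
- apply: (dominated_integrable Ic (K := 0)).
    by apply: measurable_sum => k; exact: measurable_funM.
  move=> y; rewrite addr0 ger0_norm; last first.
    by apply: sumr_ge0 => k _; rewrite mulr_ge0// ltW// gibbs_prob_gt0.
  by apply: ler_sum => k _; rewrite ler_piMl// gibbs_prob_le1.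
- by have := integrableD measurableT Izm Ie; apply: eq_integrable.
- move=> y _; have := gibbs_prob_cost c e0 z y; rewrite divfK//.
Qed.

End semidiscrete.

(** * Kantorovich duality *)

Lemma measurable_fun_lt {R : realType} {d : measure_display} {T : measurableType d}
  (f : T -> R) : (forall r, measurable [set t | f t < r]) -> measurable_fun setT f.
Proof.
move=> mf mD; apply: (measurability _ (RGenInftyO.measurableE R)) => // _ [_ [r ->] <-].
rewrite setTI (_ : _ @^-1` _ = [set t | f t < r]); first exact: mf.
by apply/seteqP; split => t /=; rewrite in_itv.
Qed.

Section borel_metric.
Context {R : realType} {d : measure_display} {Z : borelMetricType d R}.
Implicit Types (x y : Z).

Lemma open_borel_measurable (A : set Z) : open A -> measurable A.
Proof. by move=> oA; rewrite measurable_borel; exact: sub_sigma_algebra. Qed.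

Lemma measurable_set1_metric x : measurable [set x].
Proof.
rewrite -[X in measurable X]setCK; apply: measurableC.
apply: open_borel_measurable; rewrite openE => y /= yx.
apply/nbhs_ballP; exists (mdist y x); first by rewrite /= mdist_gt0; apply/eqP.
by move=> z; rewrite ballEmdist /= => yz zx; move: yz; rewrite zx ltxx.
Qed.

Lemma measurable_mdistl x : measurable_fun setT (fun y => mdist x y : R).
Proof.
apply: measurable_fun_lt => r; apply: open_borel_measurable.
rewrite openE => y /= xyr; apply/nbhs_ballP; exists (r - mdist x y).
  by rewrite /= subr_gt0.
move=> z; rewrite ballEmdist /= => yz.
by apply: le_lt_trans (metric_triangle x y z) _; rewrite addrC -ltrBrDr.
Qed.

(** d(x, y) < r exactly when d(x, q) + d(q, y) < r for some q in a countable dense set, so the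
    sublevel sets are countable unions of sets measurable for the product sigma-algebra. *)
Lemma measurable_mdist : separable Z ->
  measurable_fun setT (fun u : Z * Z => mdist u.1 u.2 : R).
Proof.
move=> [D cD dD]; apply: measurable_fun_lt => r.
have near_D (x : Z) (e : R) : 0 < e -> exists2 q, D q & mdist x q < e.
  move=> e0; have [q [xq Dq]] : ball x e `&` D !=set0.
    apply: dD; first by exists x; exact: ballxx.
    rewrite openE => y; rewrite ballEmdist /= => xy.
    apply/nbhs_ballP; exists (e - mdist x y); first by rewrite /= subr_gt0.
    move=> z; rewrite !ballEmdist /= => yz.
    by apply: le_lt_trans (metric_triangle x y z) _; rewrite addrC -ltrBrDr.
  by exists q => //; move: xq; rewrite ballEmdist.
have /pfcard_geP[D0|[e]] := cD.
  rewrite (_ : [set _ | _] = set0)//; apply/seteqP; split => // -[x y] _.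
  by have [q] := near_D x 1 ltr01; rewrite D0.
rewrite (_ : [set _ | _] = \bigcup_n [set u : Z * Z | mdist u.1 (e n) + mdist (e n) u.2 < r]).
  apply: bigcup_measurable => n _.
  rewrite -[X in measurable X]setTI.
  have mf : measurable_fun setT (fun u : Z * Z => mdist u.1 (e n) + mdist (e n) u.2 : R).
    apply: measurable_funD.
      rewrite (_ : (fun u => _) = (fun u : Z * Z => mdist (e n) u.1)).
        by apply: (measurableT_comp (f := fun y => mdist (e n) y : R)) => //; exact: measurable_mdistl.
      by apply/funext => u; rewrite metric_sym.
    by apply: (measurableT_comp (f := fun y => mdist (e n) y : R)) => //; exact: measurable_mdistl.
  have := mf measurableT `]-oo, r[%classic (measurable_itv _).
  by rewrite (_ : _ @^-1` _ = [set u | mdist u.1 (e n) + mdist (e n) u.2 < r])//;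
    apply/seteqP; split => t /=; rewrite in_itv.
apply/seteqP; split => -[x y] /=; last first.
  by move=> [n _] /=; apply: le_lt_trans; exact: metric_triangle.
move=> xyr; have e0 : 0 < (r - mdist x y) / 2 by rewrite divr_gt0// subr_gt0.
have [q Dq xq] := near_D x _ e0.
have [n _ nq] := 'surj_e Dq.
exists n => //=; rewrite nq.
have := metric_triangle q x y; rewrite (metric_sym q x); lra.
Qed.

Lemma ge0_integral_discrete (N' : nat) (P : {measure set Z -> \bar R})
    (v : 'I_N'.+1 -> R) (s : 'I_N'.+1 -> Z) (f : Z -> \bar R) :
    (forall k, 0 <= v k) ->
    (forall A, measurable A -> P A = (\sum_k (v k)%:E * \d_(s k) A)%E) ->
    measurable_fun setT f -> (forall x, (0 <= f x)%E) ->
  (\int[P]_x f x = \sum_k (v k)%:E * f (s k))%E.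
Proof.
move=> v0 PE mf f0.
pose m_ (n : nat) : {measure set Z -> \bar R} :=
  mscale (NngNum (v0 (inord n))) (\d_(s (inord n))).
rewrite (eq_measure_integral (msum m_ N'.+1)); last first.
  move=> A mA _; rewrite PE// /msum /m_; apply: eq_bigr => k _.
  by rewrite /mscale/= inord_val.
rewrite ge0_integral_measure_sum//; apply: eq_bigr => k _.
by rewrite ge0_integral_mscale//= integral_dirac//= diracT mul1e inord_val.
Qed.

End borel_metric.

Section transport_duality.
Context {R : realType} {d : measure_display} {Z : borelMetricType d R} {N' : nat}.
Local Notation N := N'.+1.
Variables (c : Z -> Z -> R) (P : {measure set Z -> \bar R}) (Q : probability Z R).
Variables (v : 'rV[R]_N) (s : 'I_N -> Z).
Hypothesis mc : measurable_fun setT (fun u : Z * Z => c u.1 u.2).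
Hypothesis c_ge0 : forall x y, 0 <= c x y.
Hypothesis v0 : forall i, 0 < v 0 i.
Hypothesis v1 : \sum_i v 0 i = 1.
Hypothesis PE : forall A, measurable A -> P A = (\sum_k (v 0 k)%:E * \d_(s k) A)%E.

Let C k y := c (s k) y.

Lemma measurable_cost_section x : measurable_fun setT (c x).
Proof.
apply: (measurableT_comp (f := fun u : Z * Z => c u.1 u.2) (g := fun y => (x, y))) => //.
exact: measurable_fun_pair.
Qed.

Let mC k : measurable_fun setT (C k). Proof. exact: measurable_cost_section. Qed.
Let C0 k y : 0 <= C k y. Proof. exact: c_ge0. Qed.

Lemma coupling_integral_snd (pi : probability (Z * Z)%type R) (f : Z -> \bar R) :
    couplings P Q pi -> measurable_fun setT f -> (forall y, (0 <= f y)%E) ->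
  (\int[pi]_u f u.2 = \int[Q]_y f y)%E.
Proof.
move=> piPQ mf f0.
rewrite -(@eq_measure_integral _ _ _ setT Q (pushforward pi snd)); last first.
  by move=> A mA _; rewrite -(piPQ _ mA).2 /pushforward; congr (pi _);
    apply/seteqP; split => -[x y] //= [].
by rewrite ge0_integral_pushforward.
Qed.

Lemma coupling_integral_fst (pi : probability (Z * Z)%type R) (f : Z -> \bar R) :
    couplings P Q pi -> measurable_fun setT f -> (forall y, (0 <= f y)%E) ->
  (\int[pi]_u f u.1 = \int[P]_x f x)%E.
Proof.
move=> piPQ mf f0.
rewrite -(@eq_measure_integral _ _ _ setT P (pushforward pi fst)); last first.
  by move=> A mA _; rewrite -(piPQ _ mA).1 /pushforward; congr (pi _);
    apply/seteqP; split => -[x y] //= [].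
by rewrite ge0_integral_pushforward.
Qed.

(** With [z <= 0] every integrand is nonnegative, so the cost may be infinite. The potential [- z]
    on the atoms is extended to a measurable [w] on the whole space; [min_cost C z y <= c x y + w x]
    whenever [x] is an atom, that is almost surely under a coupling. *)
Lemma weak_duality (pi : probability (Z * Z)%type R) (z : 'rV[R]_N) :
    couplings P Q pi -> (forall k, z 0 k <= 0) ->
  (\int[Q]_y (min_cost C z y)%:E <=
   \int[pi]_u (c u.1 u.2)%:E + (\sum_k v 0 k * - z 0 k)%:E)%E.
Proof.
move=> piPQ z0.
pose M := \sum_k - z 0 k.
have zM k : - z 0 k <= M.
  by rewrite /M (bigD1 k)//= lerDl sumr_ge0// => j _; rewrite oppr_ge0.
have M0 : 0 <= M by rewrite sumr_ge0// => j _; rewrite oppr_ge0.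
(* The points [s k] may coincide, as sample points do: [w] takes the smallest value among the
   indices of a point, so [w (s k) <= - z 0 k] and some index attains it. Elsewhere [w] is [M]. *)
pose w (x : Z) := \big[Num.min/M]_k (if s k == x then - z 0 k else M).
have w0 x : 0 <= w x.
  rewrite /w; elim/big_ind : _ => // [a b a0 b0|k _]; first by rewrite le_min a0 b0.
  by case: ifP => _ //; rewrite oppr_ge0.
have ws k : w (s k) <= - z 0 k.
  have := bigmin_le M k (fun j => if s j == s k then - z 0 j else M).
  by rewrite eqxx.
have wE k x : x = s k -> exists2 j, s j = x & w x = - z 0 j.
  move=> xk; have : w x = M \/ exists2 j, s j = x & w x = - z 0 j.
    rewrite /w; elim/big_ind : _ => [|a b [->|[i si ->]] [->|[j sj ->]]|j _].
    - by left.
    - by left; rewrite minxx.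
    - by right; exists j => //; apply/min_idPr.
    - by right; exists i => //; apply/min_idPl.
    - by right; case: leP => _; [exists i|exists j].
    - by case: eqP => [sj|_]; [right; exists j|left].
  case=> // wM; exists k => //; apply/eqP; rewrite eq_le.
  by rewrite {1}xk ws wM zM.
have mw : measurable_fun setT w.
  rewrite /w; elim: (index_enum _) => [|i r IH].
    by under eq_fun do rewrite big_nil; exact: measurable_cst.
  under eq_fun do rewrite big_cons.
  apply: measurable_minr => //.
  rewrite (_ : (fun x => _) = (fun x => M + (- z 0 i - M) * \1_[set s i] x)); last first.
    apply/funext => x; rewrite indicE.
    have [->|xi] := eqVneq (s i) x; first by rewrite mem_set// mulr1 addrC subrK.
    rewrite memNset ?mulr0 ?addr0// => /= xi'.
    by rewrite xi' eqxx in xi.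
  apply: measurable_funD => //; apply: measurable_funM => //.
  by apply: measurable_indic; exact: measurable_set1_metric.
have m0 y : 0 <= min_cost C z y.
  apply: min_cost_glb => i; have := z0 i; have := C0 i y; lra.
have mm : measurable_fun setT (fun y => (min_cost C z y)%:E).
  by apply/measurable_EFinP; exact: measurable_min_cost.
have mwE : measurable_fun setT (EFin \o w) by exact/measurable_EFinP.
rewrite -(coupling_integral_snd piPQ mm); last by move=> y; rewrite lee_fin.
apply: (@le_trans _ _ (\int[pi]_u ((c u.1 u.2)%:E + (w u.1)%:E))%E).
  apply: ae_ge0_le_integral => //.
  - by move=> u _; rewrite lee_fin.
  - exact: (measurableT_comp (f := fun y => (min_cost C z y)%:E)).
  - by move=> u _; rewrite -EFinD lee_fin addr_ge0.
  - apply: emeasurable_funD; first exact/measurable_EFinP.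
    exact: (measurableT_comp (f := EFin \o w)).
  - have mS : measurable (~` range s).
      apply: measurableC.
      have -> : range s = \bigcup_(k in [set: 'I_N]) [set s k].
        by apply/seteqP; split => x [k _ kx]; exists k => //=; exact/esym.
      by apply: fin_bigcup_measurable => // k _; exact: measurable_set1_metric.
    exists ((~` range s) `*` setT); split.
    + exact: measurableX.
    + transitivity (P (~` range s)); first exact: (piPQ _ mS).1.
      rewrite PE// big1// => k _.
      by rewrite diracE memNset ?mule0//= => /(_ (ex_intro2 _ _ k I erefl)).
    + move=> [x y] /= H; split => // -[k _ kx]; apply: H => _ /=.
      have [j sj ->] := wE k x (esym kx).
      rewrite lee_fin; have := min_cost_le C z y j; rewrite /C sj; lra.
rewrite ge0_integralD//; last 4 first.
- by move=> u _; rewrite lee_fin.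
- exact/measurable_EFinP.
- by move=> u _; rewrite lee_fin.
- exact: (measurableT_comp (f := EFin \o w)).
apply: leeD2l; rewrite (coupling_integral_fst piPQ mwE); last by move=> y; rewrite lee_fin.
rewrite (ge0_integral_discrete (fun k => ltW (v0 k)) PE mwE); last by move=> y; rewrite lee_fin.
under eq_bigr do rewrite -EFinM.
rewrite sumEFin lee_fin; apply: ler_sum => k _.
by rewrite ler_wpM2l// ltW.
Qed.

Lemma transport_cost_ge_min : (\int[Q]_y (min_cost C 0 y)%:E <= transport_cost c P Q)%E.
Proof.
apply: le_ereal_inf_tmp => _ [pi piPQ <-].
apply: le_trans (weak_duality piPQ (z := 0) _) _; first by move=> k; rewrite mxE.
by rewrite big1 ?adde0// => k _; rewrite mxE oppr0 mulr0.
Qed.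

Section integrable_cost.
Hypothesis IC : forall k, Q.-integrable setT (EFin \o C k).

(** The dual value is unchanged by constants, so [z] may be taken nonpositive, where [weak_duality]
    applies. *)
Lemma dual_le_transport_cost z : ((dual Q C v z)%:E <= transport_cost c P Q)%E.
Proof.
have [j zj] := ex_argmax z.
rewrite -(dual_shift mC C0 IC v1 z (- z 0 j)).
set z' := z + _.
have z'0 k : z' 0 k <= 0 by rewrite !mxE subr_le0.
apply: le_ereal_inf_tmp => _ [pi piPQ <-].
have := weak_duality piPQ z'0.
have Im := integrable_min_cost mC C0 IC z'.
rewrite -[X in (X <= _)%E -> _](fineK (integrable_fin_num measurableT Im)).
rewrite -leeBlDr// -EFinB; apply: le_trans; rewrite lee_fin.
rewrite /dual /Rintegral lerBrDr addrC le_eqVlt; apply/orP; left; apply/eqP.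
rewrite addrA -big_split/= big1 ?add0r// => k _.
by rewrite mulrN addNr.
Qed.

Section plan.
Variable q : 'I_N -> Z -> R.
Hypothesis mq : forall k, measurable_fun setT (q k).
Hypothesis q0 : forall k y, 0 <= q k y.
Hypothesis qsum : forall y, \sum_k q k y = 1.
Hypothesis qint : forall k, \int[Q]_y q k y = v 0 k.

Let mpair (x : Z) : measurable_fun setT (fun y : Z => (x, y)).
Proof. exact: measurable_fun_pair. Qed.

Let rho k : {measure set Z -> \bar R} := density_measure Q (mq k) (q0 k).

Let nu (n : nat) : {measure set (Z * Z)%type -> \bar R} :=
  measure_function_pushforward__canonical__measure_function_Measure (rho (inord n))
    (mpair (s (inord n))).

(** The coupling whose conditional weights are [q]: of the mass of [Q] at [y], the share [q k y] is
    carried to [s k]. *)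
Definition plan : set (Z * Z)%type -> \bar R := msum nu N.
HB.instance Definition _ := Measure.on plan.

Let planE A : plan A = (\sum_(k < N) rho k ((fun y => (s k, y)) @^-1` A))%E.
Proof. by rewrite /plan/= /msum; apply: eq_bigr => k _; rewrite /nu/= inord_val. Qed.

Let rhoT k : rho k setT = (v 0 k)%:E.
Proof.
rewrite -qint /Rintegral fineK//.
apply: integrable_fin_num => //.
apply: (@bounded_integrable _ _ _ Q _ 1) => // y.
by rewrite ger0_norm// -(qsum y) (bigD1 k)//= lerDl sumr_ge0.
Qed.

Let planT : plan setT = 1%E.
Proof.
rewrite planE (eq_bigr (fun k => (v 0 k)%:E)); first by rewrite sumEFin v1.
by move=> k _; rewrite preimage_setT rhoT.
Qed.

HB.instance Definition _ := Measure_isProbability.Build _ _ _ plan planT.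

Let plan_prob : probability (Z * Z)%type R := plan.

Let plan_coupling : couplings P Q plan_prob.
Proof.
move=> A mA; split; rewrite [LHS]planE.
  rewrite PE//; apply: eq_bigr => k _; rewrite diracE.
  have [kA|kA] := boolP (s k \in A).
    rewrite mule1 -rhoT; congr (rho k _); apply/seteqP; split => y //= _.
    by split => //; rewrite inE in kA.
  rewrite mule0 (_ : _ @^-1` _ = set0) ?measure0//.
  by apply/seteqP; split => y //= [kA' _]; move/negP: kA; rewrite inE.
transitivity (\sum_(k < N) (\int[Q]_(y in A) (q k y)%:E))%E.
  apply: eq_bigr => k _; rewrite (_ : _ @^-1` _ = A)//.
  by apply/seteqP; split => y //= [].
rewrite -ge0_integral_sum//.
- under eq_integral do rewrite sumEFin qsum.
  by rewrite integral_cst// mul1e.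
- by move=> k; apply: measurable_funTS; exact/measurable_EFinP.
- by move=> k y _; rewrite lee_fin.
Qed.

Lemma transport_cost_le_plan :
  (transport_cost c P Q <= (\int[Q]_y (\sum_k q k y * C k y))%:E)%E.
Proof.
have mcE : measurable_fun setT (fun u : Z * Z => (c u.1 u.2)%:E).
  exact/measurable_EFinP.
apply: (@le_trans _ _ (\int[plan_prob]_u (c u.1 u.2)%:E)%E).
  by apply: ereal_inf_lbound; exists plan_prob => //; exact: plan_coupling.
rewrite (@ge0_integral_measure_sum _ _ _ nu setT measurableT)//; last first.
  by move=> u _; rewrite lee_fin.
rewrite (eq_bigr (fun k => \int[Q]_y (q k y * C k y)%:E)%E); last first.
  move=> k _; rewrite /nu inord_val ge0_integral_pushforward//; last first.
    by move=> u _; rewrite lee_fin.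
  rewrite preimage_setT ge0_integral_density_measure//.
  - by apply: eq_integral => y _; rewrite /= muleC.
  - by apply: (measurableT_comp mcE); exact: mpair.
  - by move=> y; rewrite lee_fin.
rewrite -ge0_integral_sum//; last 2 first.
- by move=> k; apply/measurable_EFinP; exact: measurable_funM.
- by move=> k y _; rewrite lee_fin mulr_ge0.
under eq_integral do rewrite sumEFin.
rewrite /Rintegral fineK//; apply: integrable_fin_num => //.
apply: (dominated_integrable IC (K := 0)).
  by apply: measurable_sum => k; exact: measurable_funM.
move=> y; rewrite addr0 ger0_norm; last by apply: sumr_ge0 => k _; rewrite mulr_ge0.
apply: ler_sum => k _; rewrite ler_piMl//.
by rewrite -(qsum y) (bigD1 k)//= lerDl sumr_ge0.
Qed.

End plan.

(** The box records that the maximiser can be taken nonpositive, which the rational approximation in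
    the measurability argument relies on. *)
Theorem transport_cost_dual del : 0 < del -> (forall i, del <= v 0 i) ->
  exists2 z, box (cost_bound Q C / del) z &
    (forall z', dual Q C v z' <= dual Q C v z) /\
    transport_cost c P Q = (dual Q C v z)%:E.
Proof.
move=> del0 vdel.
have vge0 i : 0 <= v 0 i by exact: ltW.
have F0 : - 0 <= dual Q C v 0 by rewrite oppr0 dual0_ge0.
have [z zb zmax] := coercive_max del0 (dual_coercive mC C0 IC vdel (ltW del0) v1)
  (dual_shift mC C0 IC v1) (dual_lipschitz mC C0 IC vge0 v1) F0.
exists z; first by rewrite addr0 in zb.
split => //; apply/eqP; rewrite eq_le dual_le_transport_cost andbT.
apply/lee_addgt0Pr => e e0; rewrite -EFinD.
have [z' [q [mq q0 qsum qint qle]]] := semidiscrete_plan mC C0 IC v0 v1 e0.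
apply: le_trans (transport_cost_le_plan mq q0 qsum qint) _.
by rewrite lee_fin (le_trans qle)// lerD2r.
Qed.

End integrable_cost.
End transport_duality.

(** * Measurable dependence of the cost on random atoms *)

Section measurable_transport_cost.
Context {R : realType} {d d' : measure_display} {Z : borelMetricType d R} {N' : nat}
  {Omega : measurableType d'}.
Local Notation N := N'.+1.
Variables (c : Z -> Z -> R) (Q : probability Z R) (v : 'rV[R]_N)
  (s : Omega -> 'I_N -> Z) (P : Omega -> {measure set Z -> \bar R}).
Hypothesis mc : measurable_fun setT (fun u : Z * Z => c u.1 u.2).
Hypothesis c_ge0 : forall x y, 0 <= c x y.
Hypothesis v0 : forall i, 0 < v 0 i.
Hypothesis v1 : \sum_i v 0 i = 1.
Hypothesis PE : forall w A, measurable A ->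
  P w A = (\sum_k (v 0 k)%:E * \d_(s w k) A)%E.
Hypothesis ms : forall k, measurable_fun setT (fun w => s w k).
Hypothesis IC : forall x, Q.-integrable setT (EFin \o c x).

Let C w k y := c (s w k) y.

Let mC w k : measurable_fun setT (C w k).
Proof. exact: measurable_cost_section. Qed.

Let C0 w k y : 0 <= C w k y. Proof. exact: c_ge0. Qed.

Let IC' w k : Q.-integrable setT (EFin \o C w k). Proof. exact: IC. Qed.

Lemma measurable_dual_param (z : 'rV[R]_N) : (forall k, z 0 k <= 0) ->
  measurable_fun setT (fun w => (dual Q (C w) v z)%:E).
Proof.
move=> z0.
have m0 w y : 0 <= min_cost (C w) z y.
  by apply: min_cost_glb => i; have := z0 i; have := C0 w i y; lra.
have mjoint : measurable_fun setT (fun u : Omega * Z => (min_cost (C u.1) z u.2)%:E).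
  apply/measurable_EFinP; rewrite /min_cost.
  have mCj k : measurable_fun setT (fun u : Omega * Z => C u.1 k u.2 - z 0 k).
    apply: measurable_funB => //.
    apply: (measurableT_comp (f := fun u : Z * Z => c u.1 u.2)
      (g := fun u : Omega * Z => (s u.1 k, u.2))) => //.
    apply: measurable_fun_pair => //.
    exact: (measurableT_comp (f := fun w => s w k)).
  elim: (index_enum _) => [|i r IH].
    by under eq_fun do rewrite big_nil; exact: mCj.
  by under eq_fun do rewrite big_cons; exact: measurable_minr.
have := measurable_fun_fubini_tonelli_F (m2 := Q) _ mjoint (fun u => m0 u.1 u.2).
move=> mF; rewrite /dual.
rewrite (_ : (fun w => _) = (fun w => ((\sum_i v 0 i * z 0 i)%:E +
    fubini_F Q (fun u : Omega * Z => (min_cost (C u.1) z u.2)%:E) w)%E)).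
  by apply: emeasurable_funD => //; exact: measurable_cst.
apply/funext => w; rewrite EFinD /Rintegral fineK//.
apply: integrable_fin_num => //.
exact: (integrable_min_cost (mC w) (C0 w) (IC' w)).
Qed.

(** By duality and Lipschitz continuity of the dual, the cost is a supremum over countably many
    potentials of functions that Tonelli's theorem makes measurable in the parameter. *)
Lemma measurable_transport_cost :
  measurable_fun setT (fun w => transport_cost c (P w) Q).
Proof.
have [del del0 vdel] := ex_weight_lb v0.
(* The absolute value keeps the rational potentials nonpositive, as Tonelli's theorem is applied to
   a nonnegative minimum; they are dense among the nonpositive ones. *)
pose zr (r : 'rV[rat]_N) : 'rV[R]_N := \row_i - `|ratr (r 0 i)|.
have zr0 r k : zr r 0 k <= 0 by rewrite mxE oppr_le0.
pose g (n : nat) w := (dual Q (C w) v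
  (zr (odflt 0 (unpickle n : option 'rV[rat]_N))))%:E.
suff -> : (fun w => transport_cost c (P w) Q) = (fun w => esups (g ^~ w) 0%N).
  by apply: measurable_fun_esups => n; exact: measurable_dual_param.
apply/funext => w.
have dle z : ((dual Q (C w) v z)%:E <= transport_cost c (P w) Q)%E.
  exact: (dual_le_transport_cost (P := P w) mc c_ge0 v0 v1 (PE w) (IC' w)).
apply/eqP; rewrite eq_le; apply/andP; split; last first.
  by apply: ge_ereal_sup => _ [n _ <-]; exact: dle.
have [z zb [zmax ->]] := transport_cost_dual (P := P w) mc c_ge0 v0 v1 (PE w) (IC' w) del0 vdel.
apply/lee_addgt0Pr => e e0.
(* [dual] is 2-Lipschitz for the l1 distance on [N] coordinates, so this tolerance costs [e] in
   total. *)
have e20 : 0 < e / (2 * N%:R) by rewrite divr_gt0// mulr_gt0.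
have [r rz] : exists r : 'rV[rat]_N, forall i, `|z 0 i - zr r 0 i| <= e / (2 * N%:R).
  have H i : exists q : rat, `|z 0 i - - `|ratr q| | <= e / (2 * N%:R).
    have zi : z 0 i <= 0 by have /andP[] := zb i.
    move: (e / _) e20 => u u0.
    have zu : - z 0 i < - z 0 i + u by rewrite ltrDl.
    have [q] := rat_in_itvoo zu.
    rewrite in_itv/= => /andP[q1 q2]; exists q.
    have q0 : 0 <= ratr q :> R by lra.
    by rewrite (ger0_norm q0) ler_norml; apply/andP; split; lra.
  have [f fH] := choice H.
  by exists (\row_i f i) => i; rewrite !mxE.
apply: (@le_trans _ _ ((dual Q (C w) v (zr r))%:E + e%:E)%E).
  rewrite -EFinD lee_fin -lerBlDl.
  have vge0 i : 0 <= v 0 i by exact: ltW.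
  have := dual_lipschitz (mC w) (C0 w) (IC' w) vge0 v1 z (zr r).
  move=> /(le_trans (ler_norm _)) h; apply: le_trans h _.
  apply: (@le_trans _ _ (2 * \sum_(i < N) e / (2 * N%:R))).
    by rewrite ler_wpM2l// ler_sum.
  rewrite sumr_const card_ord -(mulr_natr (e / _) N) le_eqVlt; apply/orP; left.
  have : (N%:R : R) != 0 by rewrite pnatr_eq0.
  by move: (N%:R : R) => x x0; apply/eqP; field.
rewrite leeD2r//; apply: ereal_sup_ubound; exists (pickle r) => //=.
by rewrite /g pickleK.
Qed.

End measurable_transport_cost.

(** * Directional derivative *)

Section directional_derivative.
Context {R : realType} {N' : nat} {d : measure_display} {T : measurableType d}.
Local Notation N := N'.+1.
Variables (Q : probability T R) (c : 'I_N -> T -> R).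
Hypothesis mc : forall i, measurable_fun setT (c i).
Hypothesis c0 : forall i y, 0 <= c i y.
Hypothesis Ic : forall i, Q.-integrable setT (EFin \o c i).
Variables (w : 'rV[R]_N) (del : R).
Hypothesis del0 : 0 < del.
Hypothesis wdel : forall i, del <= w 0 i.
Hypothesis w1 : \sum_i w 0 i = 1.

Let w0 i : 0 <= w 0 i. Proof. exact: le_trans (ltW del0) (wdel i). Qed.

Definition dual_maximiser (v z : 'rV[R]_N) := forall z', dual Q c v z' <= dual Q c v z.

(** With [del / 2] in place of [del], one box contains maximisers for all weights close to [w], not
    only for [w] itself. *)
Definition box_radius : R := cost_bound Q c / (del / 2).
Local Notation K := box_radius.

Definition optimal_box : set 'rV[R]_N := [set z | dual_maximiser w z] `&` box K.

Let cb0 : 0 <= cost_bound Q c.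
Proof. by apply: sumr_ge0 => i _; exact: Rintegral_ge0. Qed.

Lemma box_radius_ge0 : 0 <= K. Proof. by rewrite !divr_ge0// ltW. Qed.

Lemma dual_max_exists (v : 'rV[R]_N) : (forall i, del / 2 <= v 0 i) -> \sum_i v 0 i = 1 ->
  exists2 z, box K z & dual_maximiser v z.
Proof.
move=> vdel v1; have d20 : 0 < del / 2 by rewrite divr_gt0.
have vge0 i : 0 <= v 0 i by exact: le_trans (ltW d20) (vdel i).
have F0 : - 0 <= dual Q c v 0 by rewrite oppr0 dual0_ge0.
have [z zb zmax] := coercive_max d20 (dual_coercive mc c0 Ic vdel (ltW d20) v1)
  (dual_shift mc c0 Ic v1) (dual_lipschitz mc c0 Ic vge0 v1) F0.
by exists z => //; move: zb; rewrite addr0.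
Qed.

Let wdel2 i : del / 2 <= w 0 i.
Proof. by apply: le_trans (wdel i); rewrite ler_pdivrMr// ler_peMr ?(ltW del0)// ler1n. Qed.

Lemma optimal_box_nonempty : optimal_box !=set0.
Proof. by have [z zb zm] := dual_max_exists wdel2 w1; exists z. Qed.

Lemma dual_weight_shift (v h : 'rV[R]_N) r z :
  dual Q c (v + r *: h) z = dual Q c v z + r * dotr h z.
Proof.
rewrite /dual addrAC; congr (_ + _); rewrite mulr_sumr -big_split.
by apply: eq_bigr => i _; rewrite !mxE mulrDl mulrA.
Qed.

Lemma box_dist (z z' : 'rV[R]_N) i : box K z -> box K z' -> `|z 0 i - z' 0 i| <= K.
Proof.
move=> /(_ i)/andP[z1 z2] /(_ i)/andP[z3 z4].
by rewrite ler_norml; apply/andP; split; lra.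
Qed.

(** The points of the box at distance at least [eta] from every optimal one form a compact set; the
    maximum of the dual over it is strictly below the optimum, and half of this gap is [eps]. *)
Lemma near_optimal (eta : R) : 0 < eta -> exists2 eps, 0 < eps &
  forall z0 z : 'rV[R]_N, dual_maximiser w z0 -> box K z -> dual Q c w z0 - eps <= dual Q c w z ->
  exists2 z', optimal_box z' & \sum_i `|z 0 i - z' 0 i| <= eta.
Proof.
move=> eta0.
pose A := box K `&` \bigcap_(z' in optimal_box) [set z : 'rV[R]_N | eta <= \sum_i `|z 0 i - z' 0 i|].
have cA : compact A.
  apply: compact_closedI; first exact: box_compact.
  apply: closed_bigI => z' _.
  have cf : continuous (fun z : 'rV[R]_N => \sum_i `|z 0 i - z' 0 i|).
    apply: (@lipschitz1_continuous _ _ 1) => s t; rewrite mul1r -sumrB.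
    apply: le_trans (ler_norm_sum _ _ _) _; apply: ler_sum => i _.
    apply: le_trans (ler_dist_dist _ _) _.
    by rewrite opprB addrA subrK.
  rewrite (_ : [set _ | _] = (fun z : 'rV[R]_N => \sum_i `|z 0 i - z' 0 i|) @^-1` `[eta, +oo[%classic).
    by apply: preimage_closed => [z _|]; [exact: cf|exact: rray_closed].
  by apply/seteqP; split => z /=; rewrite in_itv/= andbT.
have [A0|/set0P/negP/negPn/eqP A0] := pselect (A !=set0); last first.
  exists 1 => // z0 z _ zb _.
  apply: contrapT => H.
  have : A z.
    split => // z' z'O /=; rewrite leNgt; apply/negP => zz'.
    by apply: H; exists z' => //; exact: ltW.
  by rewrite A0.
have cD : continuous (dual Q c w).
  exact: lipschitz1_continuous (dual_lipschitz mc c0 Ic w0 w1).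
have [a aA amax] := EVT_max_rV A0 cA (continuous_subspaceT cD).
rewrite inE in aA.
have [zs zsb zsm] := dual_max_exists wdel2 w1.
have alt : dual Q c w a < dual Q c w zs.
  rewrite lt_neqAle zsm andbT; apply/negP => /eqP aE.
  have aO : optimal_box a by split; [move=> z' /=; rewrite aE; exact: zsm|exact: aA.1].
  have := aA.2 a aO => /=.
  rewrite big1 => [|i _]; last by rewrite subrr normr0.
  by rewrite leNgt eta0.
exists ((dual Q c w zs - dual Q c w a) / 2); first by rewrite divr_gt0// subr_gt0.
move=> z0 z z0m zb zn; apply: contrapT => H.
have zA : A z.
  split => // z' z'O /=; rewrite leNgt; apply/negP => zz'.
  by apply: H; exists z' => //; exact: ltW.
have := amax z; rewrite inE => /(_ zA) h1.
have h2 := z0m zs; have h3 := zsm z0.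
move: zn h1 h2 alt.
move: (dual Q c w z0) (dual Q c w z) (dual Q c w zs) (dual Q c w a) => *; lra.
Qed.

(** Over all optimal potentials the supremum would be infinite unless [h] has sum zero. Restricted
    to the box it is finite and Lipschitz in every direction. *)
Definition support_fun (h : 'rV[R]_N) : R := sup [set dotr h z | z in optimal_box].

Let dotr_box (h z : 'rV[R]_N) : box K z -> `|dotr h z| <= K * \sum_i `|h 0 i|.
Proof.
move=> zb; apply: le_trans (ler_norm_sum _ _ _) _; rewrite mulr_sumr.
apply: ler_sum => i _; rewrite normrM mulrC ler_wpM2r//.
have /andP[z1 z2] := zb i.
by rewrite ler_norml; apply/andP; split => //; exact: le_trans z2 box_radius_ge0.
Qed.

Lemma support_fun_ge (h z : 'rV[R]_N) : optimal_box z -> dotr h z <= support_fun h.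
Proof.
move=> zO; apply: ub_le_sup; last by exists z.
exists (K * \sum_i `|h 0 i|) => _ [z' [_ zb] <-].
by apply: le_trans (ler_norm _) (dotr_box _ zb).
Qed.

Lemma support_fun_le (h : 'rV[R]_N) u : (forall z, optimal_box z -> dotr h z <= u) -> support_fun h <= u.
Proof.
move=> H; apply: ge_sup.
  by have [z zO] := optimal_box_nonempty; exists (dotr h z), z.
by move=> _ [z zO <-]; exact: H.
Qed.

Lemma support_fun_lipschitz : lipschitz1 K support_fun.
Proof.
apply: lipschitz1_onesided => h h'; rewrite lerBlDr; apply: support_fun_le => z zO.
have := support_fun_ge h' zO.
have := dotr_box (h - h') zO.2; rewrite dotrB => /(le_trans (ler_norm _)).
under eq_bigr do rewrite !mxE.
lra.
Qed.

Lemma support_fun0 : support_fun 0 = 0.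
Proof.
apply/eqP; rewrite eq_le; apply/andP; split.
  apply: support_fun_le => z _.
  by rewrite /dotr big1// => i _; rewrite mxE mul0r.
have [z zO] := optimal_box_nonempty.
apply: le_trans (support_fun_ge 0 zO).
by rewrite /dotr big1// => i _; rewrite mxE mul0r.
Qed.

(** A Danskin argument. From below, an optimal potential for [w] competes in the perturbed problem.
    From above, a maximiser of the perturbed problem loses at most [r N K M] for [w], so it lies
    within [eta / M] of an optimal one, which changes the pairing with [h] by at most [eta]. *)
Theorem dual_directional_derivative (M eta : R) : 0 < M -> 0 < eta ->
  exists2 r0, 0 < r0 & forall (r : R) (h zv zw : 'rV[R]_N), 0 < r <= r0 ->
    (forall i, `|h 0 i| <= M) -> \sum_i h 0 i = 0 ->
    dual_maximiser (w + r *: h) zv -> dual_maximiser w zw ->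
    [/\ forall i, del / 2 <= (w + r *: h) 0 i,
        support_fun h <= (dual Q c (w + r *: h) zv - dual Q c w zw) / r &
        (dual Q c (w + r *: h) zv - dual Q c w zw) / r <= support_fun h + eta].
Proof.
move=> M0 eta0.
have etaM : 0 < eta / M by rewrite divr_gt0.
have [eps eps0 Heps] := near_optimal etaM.
have MK0 : 0 <= N%:R * (K * M) by apply: mulr_ge0 => //; apply: mulr_ge0; [exact: box_radius_ge0|exact: ltW].
(* The first bound keeps the weights above [del / 2], so that the common box applies; the second
   makes the loss [r N K M] at most [eps]. *)
exists (Num.min (del / 2 / M) (eps / (N%:R * (K * M) + 1))).
  by rewrite lt_min !divr_gt0// ltr_wpDl.
move=> r h zv zw /andP[r0]; rewrite le_min => /andP[r1 r2] hM h0 zvm zwm.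
have hle (z u : 'rV[R]_N) : (forall i, `|z 0 i - u 0 i| <= K) -> dotr h z - dotr h u <= N%:R * (K * M).
  move=> zu; rewrite -sumrB.
  apply: (@le_trans _ _ (\sum_(i < N) K * M)); last first.
    by rewrite sumr_const card_ord mulr_natl.
  apply: ler_sum => i _; rewrite -mulrBr; apply: le_trans (ler_norm _) _.
  by rewrite normrM mulrC ler_pM.
have vdel i : del / 2 <= (w + r *: h) 0 i.
  rewrite !mxE; have := wdel i.
  have : `|r * h 0 i| <= del / 2.
    rewrite normrM gtr0_norm//.
    apply: (@le_trans _ _ (r * M)); first by rewrite ler_wpM2l// ltW.
    by rewrite -ler_pdivlMr.
  by rewrite ler_norml => /andP[? _] ?; lra.
have v1 : \sum_i (w + r *: h) 0 i = 1.
  by under eq_bigr do rewrite !mxE; rewrite big_split/= w1 -mulr_sumr h0 mulr0 addr0.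
split => //.
  apply: support_fun_le => z [zm zb]; rewrite ler_pdivlMr//.
  have := zvm z; rewrite (dual_weight_shift w h r z).
  have := zm zw; rewrite mulrC.
  move: (dual _ _ _ zw) (dual _ _ _ zv) (dual _ _ _ z) (r * dotr h z) => *; lra.
have [z zb zm] := dual_max_exists vdel v1.
have [z1 z1b z1m] := dual_max_exists wdel2 w1.
have zvE : dual Q c (w + r *: h) zv = dual Q c (w + r *: h) z.
  by apply/eqP; rewrite eq_le zm zvm.
have zwE : dual Q c w zw = dual Q c w z1.
  by apply/eqP; rewrite eq_le z1m zwm.
have rN : r * (N%:R * (K * M)) <= eps.
  rewrite ler_pdivlMr in r2; last by rewrite ltr_wpDl.
  by apply: le_trans r2; rewrite ler_pM2l// lerDl.
have near : dual Q c w z1 - eps <= dual Q c w z.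
  have := zm z1; rewrite !dual_weight_shift.
  have : r * (dotr h z - dotr h z1) <= eps.
    apply: le_trans rN; rewrite ler_pM2l//; apply: hle => i.
    exact: box_dist.
  rewrite mulrBr.
  move: (dual _ _ _ z1) (dual _ _ _ z) (r * dotr h z1) (r * dotr h z) => *; lra.
have [z' z'O zz'] := Heps z1 z z1m zb near.
rewrite ler_pdivrMr// zvE zwE dual_weight_shift.
have h1 : dotr h z <= support_fun h + eta.
  have := support_fun_ge h z'O.
  have : dotr h z - dotr h z' <= eta.
    rewrite -sumrB; apply: (@le_trans _ _ (M * \sum_i `|z 0 i - z' 0 i|)).
      rewrite mulr_sumr; apply: ler_sum => i _; rewrite -mulrBr.
      by apply: le_trans (ler_norm _) _; rewrite normrM ler_wpM2r.
    by rewrite mulrC -ler_pdivlMr.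
  lra.
have h2 : r * dotr h z <= (support_fun h + eta) * r by rewrite mulrC ler_pM2r.
have := z1m z.
move: h2; move: (dual _ _ _ z1) (dual _ _ _ z) (r * dotr h z) ((_ + eta) * r) => *; lra.
Qed.

End directional_derivative.

(** * Sampling *)

Section discrete_sample.
Context {R : realType} {d d' : measure_display} {Omega : measurableType d}
  {Z : measurableType d'} {N' : nat}.
Local Notation N := N'.+1.
Variables (Pr : probability Omega R) (P : probability Z R).
Variables (S : nat -> {RV Pr >-> Z}) (x : 'I_N -> Z) (w : 'rV[R]_N).
Hypothesis iidS : iid_sample P S.
Hypothesis x_inj : injective x.
Hypothesis m1 : forall z : Z, measurable [set z].
Hypothesis PE : forall A, measurable A -> P A = (\sum_(k < N) (w 0 k)%:E * \d_(x k) A)%E.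

Let P_atom j : P [set x j] = (w 0 j)%:E.
Proof.
rewrite PE// (bigD1 j)//= diracE mem_set// mule1 big1 ?adde0// => k kj.
by rewrite diracE memNset ?mule0//= => /x_inj kj'; rewrite kj' eqxx in kj.
Qed.

Let atom (i : nat) (j : 'I_N) : set Omega := S i @^-1` [set x j].

Let matom i j : measurable (atom i j).
Proof. by rewrite -[atom i j]setTI; exact: (measurable_funP (S i)). Qed.

Let Pr_atom i j : Pr (atom i j) = (w 0 j)%:E.
Proof. by rewrite -P_atom -(iidS.1 i). Qed.

Let cylinder (l : seq 'I_N) : set Omega :=
  \bigcap_(i in [set` iota 0 (size l)]) atom i (nth ord0 l i).

Let mcylinder l : measurable (cylinder l).
Proof. by apply: fin_bigcap_measurable => //; exact: finite_seq. Qed.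

Let Pr_cylinder l : Pr (cylinder l) = (\prod_(j <- l) w 0 j)%:E.
Proof.
rewrite /cylinder iidS.2//; last exact: iota_uniq.
rewrite (eq_bigr (fun i => (w 0 (nth ord0 l i))%:E)); last by move=> i _; exact: Pr_atom.
by rewrite prodEFin (big_nth ord0) /index_iota subn0.
Qed.

Let cylinder_rcons l j : cylinder (rcons l j) = cylinder l `&` atom (size l) j.
Proof.
apply/seteqP; split => o; last first.
  move=> [H Hj] i /=; rewrite mem_iota/= add0n size_rcons ltnS leq_eqVlt => /predU1P[->|il].
    by rewrite nth_rcons ltnn eqxx.
  by rewrite nth_rcons il; apply: H; rewrite /= mem_iota.
move=> H; split.
    move=> i /=; rewrite mem_iota/= add0n => il.
    have := H i; rewrite /= mem_iota/= add0n size_rcons ltnS (ltnW il) nth_rcons il.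
    by apply.
  have := H (size l); rewrite /= mem_iota/= add0n size_rcons ltnSn nth_rcons ltnn eqxx.
  by apply.
Qed.

Let hit i : set Omega := \big[setU/set0]_(j <- enum 'I_N) atom i j.

Let triv_atom i : trivIset [set` enum 'I_N] (atom i).
Proof.
by move=> j k _ _ [om [hj hk]]; apply: x_inj; rewrite -hj -hk.
Qed.

Let mhit i : measurable (hit i).
Proof. exact: bigsetU_measurable. Qed.

Let Pr_miss i : Pr (~` hit i) = 0%E.
Proof.
have -> : ~` hit i = S i @^-1` (~` range x).
  apply/seteqP; split => o; rewrite /hit -bigcup_seq.
    by move=> H [j _ jo]; apply: H; exists j => /=; [rewrite mem_enum|].
  by move=> H [j _ jo]; apply: H; exists j.
have mx : measurable (~` range x).
  apply: measurableC; rewrite (_ : range x = \bigcup_(k in [set: 'I_N]) [set x k]).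
    by apply: fin_bigcup_measurable.
  by apply/seteqP; split => z [k _ kz]; exists k => //=; exact/esym.
transitivity (P (~` range x)); first by rewrite -(iidS.1 i).
rewrite PE// big1// => k _.
by rewrite diracE memNset ?mule0//= => /(_ (ex_intro2 _ _ k I erefl)).
Qed.

Variables (a : 'I_N -> 'rV[R]_N) (g : 'rV[R]_N -> R) (G : Omega -> R) (n : nat).
Hypothesis mG : measurable_fun setT G.
Hypothesis Gg : forall o l, size l = n -> (forall i, (i < n)%N -> S i o = x (nth ord0 l i)) ->
  G o = g (\sum_(j <- l) a j).

(** Induction on the number [k] of draws still free: up to the null event that the next draw misses
    all atoms, a cylinder splits into those extended by one letter, which is one application of
    [walk]. *)
Let integral_cylinder k l : (size l + k)%N = n ->
  (\int[Pr]_(o in cylinder l) (G o)%:E =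
   (\prod_(j <- l) w 0 j * iter k (walk (fun j => w 0 j) a) g (\sum_(j <- l) a j))%:E)%E.
Proof.
elim: k l => [|k IH] l ln.
  rewrite (eq_integral (cst (g (\sum_(j <- l) a j))%:E)); last first.
    move=> o; rewrite inE => oA /=; congr EFin; apply: Gg; first by rewrite -ln addn0.
    by move=> i il; apply: oA; rewrite /= mem_iota/= add0n -(addn0 (size l)) ln.
  by rewrite integral_cst// [X in (_ * X)%E](Pr_cylinder l) -EFinM mulrC.
have mm : measurable (cylinder l `&` ~` hit (size l)).
  by apply: measurableI => //; exact: measurableC.
rewrite -[cylinder l](setIT) -(setUv (hit (size l))) setIUr integral_setU//=; last 3 first.
- exact: measurableI.
- by apply: measurable_funTS; exact/measurable_EFinP.
- apply/disj_setPS => o [[_ oh] [_ onh]]; exact: onh.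
rewrite [X in (_ + X)%E]null_set_integral ?adde0//; last 2 first.
- by apply: measurable_funTS; exact/measurable_EFinP.
- apply/eqP; rewrite eq_le measure_ge0 andbT -(Pr_miss (size l)).
  by apply: le_measure; rewrite ?inE//; exact: measurableC.
rewrite /hit big_distrr/= integral_bigsetU_EFin//=; last 4 first.
- by move=> j; exact: measurableI.
- exact: enum_uniq.
- by apply: trivIset_setIl; exact: triv_atom.
- by apply: measurable_funTS; exact/measurable_EFinP.
rewrite big_enum/= /walk mulr_sumr -sumEFin; apply: eq_bigr => j _.
rewrite -cylinder_rcons IH; last by rewrite size_rcons addSnnS.
by rewrite -cats1 !big_cat !big_seq1/= mulrA.
Qed.

Lemma integral_sample_walk :
  (\int[Pr]_o (G o)%:E = (iter n (walk (fun j => w 0 j) a) g 0)%:E)%E.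
Proof.
have := @integral_cylinder n [::] erefl; rewrite !big_nil mul1r => <-.
by congr (integral _ _ _); apply/seteqP; split.
Qed.

End discrete_sample.

(** * Reduction to Lipschitz test functions *)

Section lipschitz_envelope.
Context {R : realType}.
Variables (F : R -> R) (M : R).
Hypothesis FM : forall s, `|F s| <= M.

(** The Pasch-Hausdorff envelope: the largest [L]-Lipschitz function below [F]. *)
Definition lipschitz_envelope (L s : R) : R :=
  inf [set F t + L * `|s - t| | t in setT].

Variable L : R.
Hypothesis L0 : 0 <= L.

Let lb s : lbound [set F t + L * `|s - t| | t in setT] (- M).
Proof.
move=> _ [t _ <-]; have := FM t; rewrite ler_norml => /andP[h _].
by apply: le_trans h _; rewrite lerDl mulr_ge0.
Qed.

Lemma lipschitz_envelope_le_line s t : lipschitz_envelope L s <= F t + L * `|s - t|.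
Proof. by apply: ge_inf; [exists (- M); exact: lb|exists t]. Qed.

Lemma lipschitz_envelope_glb s u :
  (forall t, u <= F t + L * `|s - t|) -> u <= lipschitz_envelope L s.
Proof.
move=> H; apply: lb_le_inf; first by exists (F s + L * `|s - s|), s.
by move=> _ [t _ <-]; exact: H.
Qed.

Lemma lipschitz_envelope_le s : lipschitz_envelope L s <= F s.
Proof. by have := lipschitz_envelope_le_line s s; rewrite subrr normr0 mulr0 addr0. Qed.

Lemma lipschitz_envelope_bounded s : `|lipschitz_envelope L s| <= M.
Proof.
rewrite ler_norml; apply/andP; split.
  by apply: lipschitz_envelope_glb => t; apply: lb; exists t.
by apply: le_trans (lipschitz_envelope_le s) _; exact: le_trans (ler_norm _) (FM s).
Qed.

Lemma lipschitz_envelope_lipschitz s t :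
  `|lipschitz_envelope L s - lipschitz_envelope L t| <= L * `|s - t|.
Proof.
have H a b : lipschitz_envelope L a - lipschitz_envelope L b <= L * `|a - b|.
  rewrite lerBlDr -lerBlDl; apply: lipschitz_envelope_glb => u.
  rewrite lerBlDr; apply: le_trans (lipschitz_envelope_le_line a u) _.
  rewrite -addrA lerD2l -mulrDr ler_wpM2l// [leRHS]addrC.
  by apply: le_trans (ler_normD _ _); rewrite addrA subrK.
by rewrite ler_norml H andbT lerNl opprB distrC H.
Qed.

End lipschitz_envelope.

Lemma lipschitz_real_continuous {R : realType} (L : R) (g : R -> R) :
  0 <= L -> (forall s t, `|g s - g t| <= L * `|s - t|) -> continuous g.
Proof.
move=> L0 gL s; apply/cvgrPdist_le => e e0; near=> t.
apply: le_trans (gL s t) _; apply: (@le_trans _ _ ((L + 1) * `|s - t|)).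
  by rewrite ler_wpM2r// lerDl.
rewrite mulrC -ler_pdivlMr ?ltr_wpDl//.
near: t; apply: cvgr_dist_le; first exact: cvg_id.
by rewrite divr_gt0// ltr_wpDl.
Unshelve. all: by end_near. Qed.

Lemma lipschitz_envelope_cvg {R : realType} (F : R -> R) (M : R) (s : R) :
  (forall s, `|F s| <= M) -> continuous F ->
  lipschitz_envelope F k%:R s @[k --> \oo] --> F s.
Proof.
move=> FM cF; apply/cvgrPdist_le => e e0.
have /cvgrPdist_le /(_ e e0) := cF s.
move=> /nbhs_ballP[r /= r0 rF].
(* For such [k], [k r >= 2 M]: at distance [r] or more from [s] the penalty outweighs the
   oscillation of [F]. *)
exists (Num.truncn (2 * M / r)).+1 => // k /= kM.
rewrite ger0_norm; last by rewrite subr_ge0 (lipschitz_envelope_le FM).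
rewrite lerBlDr -lerBlDl; apply: lipschitz_envelope_glb => t.
have [st|st] := ltP `|s - t| r.
  have := rF t st; rewrite ler_norml => /andP[_ h].
  by rewrite -[leLHS]addr0 lerD// ?mulr_ge0//; lra.
have kr : 2 * M <= k%:R * `|s - t|.
  apply: (@le_trans _ _ (k%:R * r)); last by rewrite ler_wpM2l.
  rewrite -ler_pdivrMr//; apply: le_trans (ltW (truncnS_gt _)) _.
  by rewrite ler_nat.
have := FM s; have := FM t; rewrite !ler_norml => /andP[t1 _] /andP[_ s1].
by move: (k%:R * _) kr => u; lra.
Qed.

Section portmanteau.
Context {R : realType} {d d' : measure_display} {Omega : measurableType d}
  {Omega' : measurableType d'}.
Variables (Pr : probability Omega R) (Pr' : probability Omega' R).
Variables (u : nat -> Omega -> R) (v : Omega' -> R).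
Hypothesis mu : forall n, measurable_fun setT (u n).
Hypothesis mv : measurable_fun setT v.
Hypothesis cvg_lip : forall (L M : R) (g : R -> R), 0 <= L ->
  (forall s t, `|g s - g t| <= L * `|s - t|) -> (forall s, `|g s| <= M) ->
  \int[Pr]_o g (u n o) @[n --> \oo] --> \int[Pr']_o g (v o).

(** The envelopes are Lipschitz test functions below [F] whose means along [v] converge to that of
    [F]; this gives the lower half of the limit, and [- F] gives the upper half. *)
Let liminf (F : R -> R) (M : R) (e : R) : continuous F -> (forall s, `|F s| <= M) -> 0 < e ->
  \forall n \near \oo, \int[Pr']_o F (v o) - e <= \int[Pr]_o F (u n o).
Proof.
move=> cF FM e0; have e20 : 0 < e / 2 by rewrite divr_gt0.
have clip k : continuous (lipschitz_envelope F k%:R).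
  by apply: (@lipschitz_real_continuous _ k%:R) => //; exact: (lipschitz_envelope_lipschitz FM).
have mcomp (G : R -> R) d0 (O : measurableType d0) (y : O -> R) :
    continuous G -> measurable_fun setT y -> measurable_fun setT (G \o y).
  by move=> cG my; apply: measurableT_comp => //; exact: continuous_measurable_fun.
have := @bounded_cvg_Rintegral _ _ _ Pr' (fun k o => lipschitz_envelope F k%:R (v o))
  (fun o => F (v o)) M (fun k => mcomp _ _ _ _ (clip k) mv)
  (fun k o => lipschitz_envelope_bounded FM (ler0n _ k) (v o))
  (fun o => lipschitz_envelope_cvg FM cF).
move=> /cvgrPdist_le /(_ _ e20)[k _ /(_ k (leqnn k)) hk].
have := cvg_lip (ler0n R k) (lipschitz_envelope_lipschitz FM (ler0n _ k))
  (lipschitz_envelope_bounded FM (ler0n _ k)).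
move=> /cvgrPdist_le /(_ _ e20); apply: filterS => n hn.
have : \int[Pr]_o lipschitz_envelope F k%:R (u n o) <= \int[Pr]_o F (u n o).
  apply: (@le_bounded_Rintegral _ _ _ Pr _ _ M) => //.
  - exact: mcomp (clip k) (mu n).
  - exact: mcomp cF (mu n).
  - by move=> o; exact: lipschitz_envelope_bounded.
  - by move=> o; exact: (lipschitz_envelope_le FM (ler0n _ k)).
move: hk hn; rewrite !ler_norml => /andP[_ h1] /andP[_ h2].
move: h1 h2; do 2 move: (Rintegral Pr' _ _) => ?; do 2 move: (Rintegral Pr _ _) => ?.
by move=> *; lra.
Qed.

Lemma cvg_bounded_continuous (F : R -> R) (M : R) :
  continuous F -> (forall s, `|F s| <= M) ->
  \int[Pr]_o F (u n o) @[n --> \oo] --> \int[Pr']_o F (v o).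
Proof.
move=> cF FM; apply/cvgrPdist_le => e e0.
have NM s : `|- F s| <= M by rewrite normrN.
have cN : continuous (fun s => - F s) by move=> s; apply: cvgN; exact: cF.
have iF d0 (O : measurableType d0) (mu0 : probability O R) (y : O -> R) :
    measurable_fun setT y -> mu0.-integrable setT (EFin \o (F \o y)).
  move=> my; apply: (@bounded_integrable _ _ _ mu0 _ M) => //.
    by apply: measurableT_comp => //; exact: continuous_measurable_fun.
  by move=> o; exact: FM.
have := liminf cN NM e0; have := liminf cF FM e0.
apply: filterS2 => n h1.
have iN d0 (O : measurableType d0) (mu0 : probability O R) (y : O -> R) :
    measurable_fun setT y -> \int[mu0]_o - F (y o) = - \int[mu0]_o F (y o).
  move=> my; under eq_Rintegral do rewrite -mulN1r.
  by rewrite RintegralZl ?mulN1r//; exact: (iF _ _ mu0 y).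
rewrite !iN// => h2; rewrite ler_norml; apply/andP; split; move: h1 h2;
 move: (Rintegral Pr' _ _) (Rintegral Pr _ _) => *; lra.
Qed.

End portmanteau.

(** At [T > 0] this is differentiability. For [q = 1] the expansion is exact, also at [T = 0], since
    0^0 = 1. *)
Lemma powR_taylor1 {R : realType} (q T e : R) : 0 < T \/ (0 <= T /\ q = 1) -> 0 < e ->
  exists2 r, 0 < r & forall u, `|u| <= r -> 0 <= T + u ->
    `|(T + u) `^ q - T `^ q - q * T `^ (q - 1) * u| <= e * `|u|.
Proof.
move=> [T0|[T0 ->]] e0; last first.
  exists 1 => // u _ Tu0; rewrite !powRr1// subrr powRr0 !mul1r.
  by rewrite (_ : T + u - T - u = 0) ?normr0 ?mulr_ge0// ?ltW//; ring.
have [dv dE] := is_derive1_powR q T0.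
move: dE; rewrite /derive => dE.
have := dv; rewrite /derivable => /cvg_ex[l hl].
have lE : l = q * T `^ (q - 1) by rewrite -dE; apply/esym/cvg_lim.
move: hl => /cvgrPdist_le /(_ e e0).
rewrite near_withinE => /nbhs_ballP[r /= r0 hr].
exists (r / 2); first by rewrite divr_gt0.
move=> u ur _; have [->|u0] := eqVneq u 0; first by rewrite addr0 mulr0 !subrr normr0 mulr0.
have := hr u; rewrite -ball_normE /= sub0r normrN => /(_ _ u0).
have ur2 : `|u| < r by apply: le_lt_trans ur _; rewrite ltr_pdivrMr// ltr_pMr// ltr1n.
move=> /(_ ur2); rewrite -lE -ler_pdivrMr ?normr_gt0// -normfV -normrM distrC.
apply: le_trans; rewrite le_eqVlt; apply/orP; left; apply/eqP; congr (`| _ |).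
rewrite /GRing.scale/= mulr1 (addrC u T) mulrBl -mulrA divff// mulr1.
by rewrite mulrC.
Qed.

(** * Test functions on the extended line *)

Section extended_real.
Context {R : realType}.
Variable f : \bar R -> R.
Hypothesis cf : continuous f.

Lemma continuous_comp_EFin : continuous (f \o EFin).
Proof. by move=> s A /cf. Qed.

Lemma continuous_at_pinfty e : 0 < e ->
  exists A, forall s, A <= s -> `|f s%:E - f +oo%E| <= e.
Proof.
move=> e0; have /cvgrPdist_le /(_ e e0) := @cf +oo%E.
move=> [A [_ hA]]; exists (A + 1) => s As; rewrite distrC; apply: hA.
by rewrite lte_fin; lra.
Qed.

Lemma measurable_continuous_ereal {d : measure_display} {T : measurableType d}
    (V : T -> \bar R) : measurable_fun setT V -> measurable_fun setT (f \o V).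
Proof.
move=> mV.
rewrite (_ : f \o V = fun t => if V t == +oo%E then f +oo%E else
   if V t == -oo%E then f -oo%E else (f \o EFin) (fine (V t))); last first.
  by apply/funext => t /=; case: (V t).
apply: measurable_fun_ifT; [exact: measurable_fun_eqe|exact: measurable_cst|].
apply: measurable_fun_ifT; [exact: measurable_fun_eqe|exact: measurable_cst|].
apply: (measurableT_comp (f := f \o EFin)).
  exact: (continuous_measurable_fun continuous_comp_EFin).
exact: (measurableT_comp (fine_measurable _)).
Qed.

End extended_real.

(** * Powers of the distance *)

Section dist_pow.
Context {R : realType} {d : measure_display} {Z : borelMetricType d R}.
Implicit Types (x y z : Z) (p : R).

Lemma dist_pow_ge0 p x y : 0 <= dist_pow p x y.
Proof. exact: powR_ge0. Qed.

Lemma dist_pow_sym p x y : dist_pow p x y = dist_pow p y x.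
Proof. by rewrite /dist_pow metric_sym. Qed.

Lemma dist_powxx p x : p != 0 -> dist_pow p x x = 0.
Proof. by move=> p0; rewrite /dist_pow mdistxx powR0. Qed.

Lemma dist_pow_triangle p x y z : 0 <= p ->
  dist_pow p x z <= 2 `^ p * (dist_pow p x y + dist_pow p y z).
Proof.
move=> p0; rewrite /dist_pow.
wlog : x z / mdist x y <= mdist y z => [H|xyz].
  have [xz|/ltW zx] := leP (mdist x y) (mdist y z); first exact: H.
  have := H z x; rewrite (metric_sym z y) (metric_sym y x) (metric_sym z x) addrC.
  exact.
apply: (@le_trans _ _ ((2 * mdist y z) `^ p)).
  apply: ge0_ler_powR => //; rewrite ?nnegrE ?mdist_ge0 ?mulr_ge0 ?mdist_ge0//.
  by apply: le_trans (metric_triangle x y z) _; rewrite mulr_natl mulr2n lerD2r.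
rewrite powRM ?mdist_ge0// ler_wpM2l ?powR_ge0// lerDr powR_ge0//.
Qed.

Lemma measurable_dist_pow p : separable Z ->
  measurable_fun setT (fun u : Z * Z => dist_pow p u.1 u.2).
Proof.
move=> sZ; apply: (measurableT_comp (f := fun r : R => r `^ p)).
  exact: measurable_powR.
exact: measurable_mdist.
Qed.

(** d(x, y)^p is at most [2 ^ p] times a constant plus [h y], the cost from [y] to the nearest
    [s k], so one finite integral of [h] gives all moments. The second alternative ranges over all
    finite families because it is applied to empirical measures too. *)
Lemma dist_pow_moment p (Q : probability Z R) : separable Z -> 0 <= p ->
  (forall x, Q.-integrable setT (EFin \o dist_pow p x)) \/
  (forall N' (s : 'I_N'.+1 -> Z),
     \int[Q]_y (min_cost (fun k => dist_pow p (s k)) 0 y)%:E = +oo)%E.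
Proof.
move=> sZ p0.
have mp x : measurable_fun setT (dist_pow p x).
  exact: (measurable_cost_section (measurable_dist_pow p sZ)).
have [|nI] := pselect (forall x, Q.-integrable setT (EFin \o dist_pow p x)); first by left.
right => N' s; apply: contrapT => fin; apply: nI => x.
pose h y := min_cost (fun k => dist_pow p (s k)) 0 y.
have h0 y : 0 <= h y.
  by apply: min_cost_glb => i; rewrite mxE subr0 dist_pow_ge0.
have mh : measurable_fun setT h by apply: measurable_min_cost => i; exact: mp.
have Ih : Q.-integrable setT (EFin \o h).
  apply/integrableP; split; first exact/measurable_EFinP.
  under eq_integral do rewrite /= ger0_norm//.
  by rewrite ltey; apply/eqP.
pose K := \sum_k dist_pow p x (s k).
have IK : Q.-integrable setT (fun y => (2 `^ p * (K + h y))%:E).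
  have := integrableZl measurableT (2 `^ p)
    (integrableD measurableT (finite_measure_integrable_cst Q K measurableT) Ih).
  by apply: eq_integrable => // y _; rewrite /= EFinM EFinD.
apply: (le_integrable _ _ _ IK) => //; first exact/measurable_EFinP.
move=> y _; rewrite lee_fin ger0_norm ?dist_pow_ge0//.
apply: le_trans (ler_norm _); have [i] := min_cost_attained (fun k => dist_pow p (s k)) 0 y.
rewrite -/(h y) mxE subr0 => hi.
apply: le_trans (dist_pow_triangle x (s i) y p0) _.
rewrite ler_wpM2l ?powR_ge0// hi lerD2r /K (bigD1 i)//= lerDl sumr_ge0// => k _.
exact: dist_pow_ge0.
Qed.

Lemma eq_transport_cost (c : Z -> Z -> R) (P P' Q : {measure set Z -> \bar R}) :
  (forall A, measurable A -> P A = P' A) -> transport_cost c P Q = transport_cost c P' Q.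
Proof.
move=> PP'; rewrite /transport_cost; congr (ereal_inf (image _ _)).
by apply/seteqP; split => pi H A mA; have [] := H A mA; rewrite ?PP'// -?PP'.
Qed.

Section discrete_measure.
Variables (N' : nat) (x : 'I_N'.+1 -> Z).

(* The absolute values make this a measure for every [v]. *)
Definition discrete_measure (v : 'rV[R]_N'.+1) : {measure set Z -> \bar R} :=
  msum (fun k => mscale (NngNum (normr_ge0 (v 0 (inord k)))) (\d_(x (inord k)))) N'.+1.

Lemma discrete_measureE (v : 'rV[R]_N'.+1) (A : set Z) : (forall k, 0 <= v 0 k) ->
  discrete_measure v A = (\sum_k (v 0 k)%:E * \d_(x k) A)%E.
Proof.
move=> v0; rewrite /discrete_measure /msum; apply: eq_bigr => k _.
transitivity ((`|v 0 (inord k)|)%:E * \d_(x (inord k)) A)%E; first by [].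
by rewrite inord_val ger0_norm.
Qed.

Lemma empirical_measure_discrete n (X : nat -> Z) (l : seq 'I_N'.+1) (A : set Z) :
    size l = n -> (forall i, (i < n)%N -> X i = x (nth ord0 l i)) ->
  empirical_measure n X A = discrete_measure (n%:R^-1 *: \sum_(j <- l) delta_mx 0 j) A.
Proof.
move=> ln Xl; rewrite discrete_measureE; last first.
  move=> k; rewrite mxE mulr_ge0// summxE sumr_ge0// => j _.
  by rewrite mxE; case: (_ && _).
transitivity ((n%:R^-1 : R)%:E * \sum_(k < n) \d_(X k) A)%E; first by [].
rewrite (eq_bigr (fun i : 'I_n => \d_(x (nth ord0 l i)) A)); last by move=> i _; rewrite Xl.
have -> : (\sum_(i < n) \d_(x (nth ord0 l i)) A =
    \sum_(j <- l) \d_(x j) A :> \bar R)%E.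
  by rewrite (big_nth ord0) big_mkord ln.
under [in RHS]eq_bigr do rewrite mxE EFinM -muleA.
rewrite -ge0_sume_distrr; last first.
  move=> k _; rewrite mule_ge0//; last by rewrite lee_fin summxE sumr_ge0// => j _; rewrite mxE; case: (_ && _).
congr (_ * _)%E.
under [in RHS]eq_bigr do rewrite summxE -sumEFin.
rewrite [in RHS](eq_bigr (fun k => \sum_(j <- l) ((delta_mx 0 j : 'rV[R]_N'.+1) 0 k)%:E * \d_(x k) A)%E); last first.
  move=> k _; rewrite ge0_sume_distrl// => j _.
  by rewrite mxE; case: (_ && _).
rewrite exchange_big/=; apply: eq_bigr => j _.
rewrite (bigD1 j)//= mxE !eqxx mul1e big1 ?adde0// => k kj.
by rewrite mxE (negbTE kj) andbF mul0e.
Qed.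

End discrete_measure.

Lemma empirical_measureE n (X : nat -> Z) (A : set Z) :
  empirical_measure n.+1 X A =
  (\sum_(k < n.+1) ((const_mx n.+1%:R^-1 : 'rV[R]_n.+1) 0 k)%:E * \d_(X k) A)%E.
Proof.
transitivity ((n.+1%:R^-1 : R)%:E * \sum_(k < n.+1) \d_(X k) A)%E; first by [].
rewrite ge0_sume_distrr//.
by apply: eq_bigr => k _; rewrite mxE.
Qed.

Section dual_objective.
Variables (N' : nat) (x : 'I_N'.+1 -> Z) (p : R) (Q : probability Z R) (v : 'rV[R]_N'.+1).
Hypothesis sZ : separable Z.
Hypothesis Ip : forall x, Q.-integrable setT (EFin \o dist_pow p x).
Hypothesis v0 : forall k, 0 <= v 0 k.
Hypothesis v1 : \sum_k v 0 k = 1.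

Lemma dual_objectiveE (z : 'rV[R]_N'.+1) :
  dual_objective x Q p z v = (dual Q (fun k => dist_pow p (x k)) v z)%:E.
Proof.
have nv : l1norm v = 1 by rewrite /l1norm -v1; apply: eq_bigr => k _; rewrite ger0_norm.
rewrite /dual_objective nv invr1 mul1r /dual EFinD; congr (_ + _)%E.
  by congr EFin; apply: eq_bigr => k _; rewrite ger0_norm.
rewrite /Rintegral fineK; last first.
  apply: integrable_fin_num => //; apply: integrable_min_cost => // k.
  - exact: (measurable_cost_section (measurable_dist_pow p sZ)).
  - by move=> y; exact: dist_pow_ge0.
apply: eq_integral => y _; rewrite /min_cost.
rewrite [LHS](_ : _ = \big[mine/+oo]_(i < N'.+1) (dist_pow p (x i) y - z 0 i)%:E)%E; last first.
  by apply: eq_bigr => i _; rewrite dist_pow_sym.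
apply/eqP; rewrite eq_le; apply/andP; split.
  have [i] := min_cost_attained (fun k => dist_pow p (x k)) z y.
  rewrite /min_cost => ->; exact: bigmin_le_cond.
apply: (big_ind (fun t => (_ <= t)%E)) => [|a b ha hb|i _]; first by rewrite leey.
  by rewrite le_min ha.
by rewrite lee_fin; exact: (min_cost_le (fun k => dist_pow p (x k))).
Qed.

End dual_objective.
End dist_pow.

(** * Multinomial walk *)

Section multinomial_walk.
Context {R : realType} {m' : nat} {d : measure_display} {Omega : measurableType d}.
Local Notation m := m'.+1.
Variables (Pr : probability Omega R) (Y : 'I_m -> {RV Pr >-> R}) (w : 'rV[R]_m).
Hypothesis w0 : forall k, 0 < w 0 k.
Hypothesis w1 : \sum_k w 0 k = 1.
Hypothesis gY : centered_gaussian_vector (multinomial_cov w) Y.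

Let wge0 k : 0 <= w 0 k. Proof. exact: ltW. Qed.

Definition multinomial_step (j : 'I_m) : 'rV[R]_m := delta_mx 0 j - w.
Local Notation a := multinomial_step.

Let dotr_step (t : 'rV[R]_m) j : dotr t (a j) = t 0 j - dotr t w.
Proof. rewrite /dotr; under eq_bigr do rewrite !mxE mulrBr.
rewrite sumrB (bigD1 j)//= eqxx mulr1 big1 ?addr0// => i /negbTE ->.
by rewrite mulr0. Qed.

Let sum_step j : \sum_i a j 0 i = 0.
Proof.
under eq_bigr do rewrite !mxE; rewrite sumrB w1 (bigD1 j)//= eqxx big1 ?addr0 ?subrr//.
by move=> i /negbTE ->.
Qed.

Lemma multinomial_mean0 (t : 'rV[R]_m) : \sum_j w 0 j * dotr t (a j) = 0.
Proof.
under eq_bigr do rewrite dotr_step mulrBr.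
rewrite sumrB -mulr_suml w1 mul1r /dotr; apply/eqP; rewrite subr_eq0; apply/eqP.
by apply: eq_bigr => i _; rewrite mulrC.
Qed.

Lemma multinomial_covE (t : 'rV[R]_m) :
  \sum_j w 0 j * dotr t (a j) ^+ 2 = (t *m multinomial_cov w *m t^T) 0 0.
Proof.
pose tau := dotr t w.
have E1 : \sum_j w 0 j * dotr t (a j) ^+ 2 = \sum_j w 0 j * t 0 j ^+ 2 - tau ^+ 2.
  rewrite (eq_bigr (fun j => w 0 j * t 0 j ^+ 2 - 2 * tau * (t 0 j * w 0 j) + tau ^+ 2 * w 0 j)).
    rewrite big_split/= sumrB -!mulr_sumr w1 -/tau.
    rewrite (_ : \sum_i t 0 i * w 0 i = tau)//; ring.
  by move=> j _; rewrite dotr_step -/tau; ring.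
rewrite E1 mxE.
under [RHS]eq_bigr do rewrite mxE.
have E2 j : (\sum_i t 0 i * multinomial_cov w i j) * t^T j 0 =
    w 0 j * t 0 j ^+ 2 - tau * (t 0 j * w 0 j).
  rewrite (eq_bigr (fun i => (i == j)%:R * (t 0 i * w 0 i) - t 0 i * w 0 i * w 0 j)); last first.
    move=> i _; rewrite mxE; case: eqP => [->|_]; first by rewrite mul1r; ring.
    by rewrite mul0r; ring.
  rewrite sumrB -mulr_suml (bigD1 j)//= eqxx mul1r big1 ?addr0; last first.
    by move=> i /negbTE ->; rewrite mul0r.
  by rewrite (_ : \sum_i t 0 i * w 0 i = tau)// mxE; ring.
rewrite (eq_bigr _ (fun j _ => E2 j)) sumrB -mulr_sumr.
by rewrite (_ : \sum_i t 0 i * w 0 i = tau)//; ring.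
Qed.

Local Notation swalk := (scaled_walk (fun j => w 0 j) a).

(** The steps preserve the sum of the coordinates, so the comparison is needed on sum zero only; the
    quadratic part is paid for by the trace of the covariance. *)
Lemma multinomial_walk_close (n : nat) (G H B : 'rV[R]_m -> R) (K : R) : 0 <= K ->
    (forall h : 'rV[R]_m, \sum_i h 0 i = 0 -> `|G h - H h| <= B h + K * \sum_i h 0 i ^+ 2) ->
  `|swalk n G - swalk n H| <= swalk n B + K * \sum_i multinomial_cov w i i.
Proof.
move=> K0 GH.
pose b (h : 'rV[R]_m) := B h + K * \sum_i h 0 i ^+ 2.
apply: (@le_trans _ _ (swalk n b)).
  apply: (@iter_walk_dist _ _ _ _ _ wge0 (fun h : 'rV[R]_m => \sum_i h 0 i = 0)) => //.
    move=> s j s0; under eq_bigr do rewrite 2!mxE.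
    by rewrite big_split/= s0 add0r -mulr_sumr sum_step mulr0.
  by rewrite big1// => i _; rewrite mxE.
rewrite /b /scaled_walk walkD_iter walkZ_iter walk_sum_iter lerD2l ler_wpM2l//.
apply: ler_sum => i _.
exact: (scaled_walk_sqr_le wge0 w1 multinomial_mean0 multinomial_covE).
Qed.

Lemma multinomial_cov00_gt0 : (0 < m')%N -> 0 < multinomial_cov w 0 0.
Proof.
move=> m0; rewrite mxE eqxx mulr_gt0// subr_gt0 -w1 (bigD1 0)//= ltrDl.
rewrite (bigD1 ord_max)/=; last by rewrite -val_eqE/= -lt0n.
by rewrite ltr_wpDr// sumr_ge0.
Qed.

Lemma sum0_degenerate (h : 'rV[R]_m) : m' = 0%N -> \sum_i h 0 i = 0 -> h = 0.
Proof.
move=> m0 hs; have i0 (i : 'I_m) : i = ord0.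
  by apply/val_inj; case: i => i /=; rewrite m0 ltnS leqn0 => /eqP.
apply/rowP => i; rewrite (i0 i) mxE -[LHS]addr0 -[RHS]hs (bigD1 ord0)//=.
by congr (_ + _); rewrite big1// => j; rewrite (i0 j) eqxx.
Qed.

Let trace_ge0 : 0 <= \sum_i multinomial_cov w i i.
Proof.
apply: sumr_ge0 => i _; rewrite mxE eqxx mulr_ge0// subr_ge0 -w1 (bigD1 i)//= lerDl.
exact: sumr_ge0.
Qed.

Let trace := \sum_i multinomial_cov w i i.

(** Chebyshev's inequality in pointwise form: outside the cube of radius [B], the trivial bound
    [2 M] is dominated by a multiple of the squared norm. *)
Let far_bound (B M : R) (h : 'rV[R]_m) : 0 < B -> 0 <= M -> ~ (forall i, `|h 0 i| <= B) ->
  2 * M <= 2 * M / B ^+ 2 * \sum_i h 0 i ^+ 2.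
Proof.
move=> B0 M0 /existsNP[i /negP]; rewrite -ltNge => hi.
rewrite -mulrA ler_peMr ?mulr_ge0// mulrC ler_pdivlMr ?exprn_gt0// mul1r.
apply: (@le_trans _ _ (h 0 i ^+ 2)).
  by rewrite -[leRHS](real_normK (num_real (h 0 i))) ler_sqr ?nnegrE ?(ltW hi) ?(ltW B0).
by rewrite (bigD1 i)//= lerDl sumr_ge0// => j _; exact: sqr_ge0.
Qed.

Let far_radius (M e : R) : 0 <= M -> 0 < e ->
  exists2 B, 0 < B & 2 * M / B ^+ 2 * trace <= e.
Proof.
move=> M0 e0; have K0 : 0 <= 2 * M * trace by rewrite !mulr_ge0.
exists (1 + 2 * M * trace / e).
  by rewrite ltr_wpDr// divr_ge0// ltW.
set B := 1 + _; have B1 : 1 <= B by rewrite lerDl divr_ge0// ltW.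
have B0 : 0 < B by exact: lt_le_trans B1.
rewrite mulrAC ler_pdivrMr ?exprn_gt0//.
apply: (@le_trans _ _ (e * B)).
  by rewrite /B mulrDr mulr1 mulrCA divff ?gt_eqF// mulr1 lerDr ltW.
by rewrite ler_wpM2l ?(ltW e0)// expr2 ler_peMl// ltW.
Qed.

Let norm_le_M (M u v : R) : `|u| <= M -> `|v| <= M -> `|u - v| <= 2 * M.
Proof. by move=> uM vM; apply: le_trans (ler_normB _ _) _; lra. Qed.

(** A continuous mapping theorem for functionals depending on [n]: uniform convergence on a cube,
    Chebyshev outside, and [cvg_scaled_walk] for the limit functional. *)
Theorem cvg_multinomial_walk (G_ : nat -> 'rV[R]_m -> R) (G : 'rV[R]_m -> R) (L M : R) :
    0 <= L -> lipschitz1 L G -> (forall n h, `|G_ n h| <= M) -> (forall h, `|G h| <= M) ->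
    (forall B e : R, 0 < B -> 0 < e -> \forall n \near \oo, forall h : 'rV[R]_m,
      \sum_i h 0 i = 0 -> (forall i, `|h 0 i| <= B) -> `|G_ n h - G h| <= e) ->
  swalk n (G_ n) @[n --> \oo] --> \int[Pr]_o G (rvec Y o).
Proof.
move=> L0 GL GnM GM GnG; apply/cvgrPdist_le => e e0.
have M0 : 0 <= M by exact: le_trans (normr_ge0 _) (GM 0).
have e30 : 0 < e / 3 by rewrite divr_gt0.
have [B B0 hB] := far_radius M0 e30.
have := cvg_scaled_walk gY wge0 w1 multinomial_mean0 multinomial_covE L0 GL GM.
move=> /cvgrPdist_le /(_ _ e30); have := GnG B (e / 3) B0 e30.
apply: filterS2 => n h1 h2.
have K0 : 0 <= 2 * M / B ^+ 2 by apply: divr_ge0; [exact: mulr_ge0|exact: sqr_ge0].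
have := @multinomial_walk_close n (G_ n) G (fun=> e / 3) _ K0 _.
have -> : swalk n (fun=> e / 3) = e / 3 by exact: iter_walk_cst.
rewrite -/trace.
have H : forall h : 'rV[R]_m, \sum_i h 0 i = 0 ->
    `|G_ n h - G h| <= e / 3 + 2 * M / B ^+ 2 * \sum_i h 0 i ^+ 2.
  move=> h hs; have [hb|/far_bound hb] := pselect (forall i, `|h 0 i| <= B).
    apply: le_trans (h1 h hs hb) _; rewrite lerDl mulr_ge0// sumr_ge0// => i _.
    exact: sqr_ge0.
  apply: le_trans (norm_le_M (GnM n h) (GM h)) _.
  by apply: le_trans (hb M B0 M0) _; rewrite lerDr ltW.
move=> /(_ H) h3.
move: h2 h3 hB; rewrite !ler_norml => /andP[? ?] /andP[? ?] ?.
by apply/andP; split; lra.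
Qed.

(** For [k > 0], equal to 1 where [|h 0 0| <= 1 / k] and to 0 where [|h 0 0| >= 2 / k]: a Lipschitz
    majorant of the indicator of a thin slab. *)
Let cutoff (k : nat) (h : 'rV[R]_m) : R := Num.max 0 (Num.min 1 (2 - k%:R * `|h 0 0|)).

Let cutoff_ge0 k (h : 'rV[R]_m) : 0 <= cutoff k h. Proof. by rewrite le_max lexx. Qed.

Let cutoff_le1 k (h : 'rV[R]_m) : cutoff k h <= 1. Proof. by rewrite ge_max ler01 ge_min lexx. Qed.

Let cutoff_norm k (h : 'rV[R]_m) : `|cutoff k h| <= 1. Proof. by rewrite ger0_norm. Qed.

Let cutoff_near k (h : 'rV[R]_m) : k%:R * `|h 0 0| <= 1 -> cutoff k h = 1.
Proof. by move=> hk; rewrite /cutoff min_l ?max_r//; lra. Qed.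

Let cutoff_lipschitz k : lipschitz1 k%:R (cutoff k).
Proof.
have trunc1 (s t : R) : `|Num.max 0 (Num.min 1 s) - Num.max 0 (Num.min 1 t)| <= `|s - t|.
  rewrite /Num.max /Num.min; do !case: ifPn => //; rewrite -?leNgt => *;
  rewrite ?subrr ?normr0 ?normr_ge0// ler_norml; apply/andP;
  have := ler_norm (s - t); have := ler_norm (- (s - t)); rewrite normrN => *; split; lra.
move=> s t; apply: le_trans (trunc1 _ _) _.
rewrite (_ : _ - _ = k%:R * (`|t 0 0| - `|s 0 0|)); last by ring.
rewrite normrM ger0_norm// ler_wpM2l// (le_trans (ler_dist_dist _ _))// distrC.
by rewrite (bigD1 ord0)//= lerDl sumr_ge0.
Qed.

Hypothesis cov00 : 0 < multinomial_cov w 0 0.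

Lemma multinomial_coord_eq0 : Pr [set o | Y 0 o = 0] = 0%E.
Proof.
have := @gY (delta_mx 0 0) [set 0] (measurable_set1 _).
rewrite -rowE !mxE (bigD1 ord0)//= big1 ?addr0; last first.
  by move=> i i0; rewrite !mxE eqxx (negbTE i0) mulr0.
rewrite !mxE !eqxx mulr1 => H.
have -> : [set o | Y 0 o = 0] =
   [set o | [set 0] (\sum_i (delta_mx 0 0 : 'rV[R]_m) 0 i * Y i o)].
  apply/seteqP; split => o /=; rewrite (bigD1 ord0)//= mxE !eqxx mul1r big1 ?addr0//;
  by move=> i i0; rewrite mxE (negbTE i0) andbF mul0r.
rewrite H; move: cov00; rewrite mxE eqxx => c0.
rewrite /centered_normal gt_eqF//.
rewrite /normal_prob; apply: null_set_integral => //; last exact: lebesgue_measure_set1.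
by apply: measurable_funTS; apply/measurable_EFinP; exact: measurable_normal_pdf.
Qed.

Let cutoff_small (e : R) : 0 < e -> exists2 k, (0 < k)%N & \int[Pr]_o cutoff k (rvec Y o) <= e.
Proof.
move=> e0.
have mc k : measurable_fun setT (fun o => cutoff k (rvec Y o)).
  exact: (lipschitz_rvec_measurable Y (ler0n _ k) (@cutoff_lipschitz k)).
have := @bounded_cvg_Rintegral _ _ _ Pr (fun k o => cutoff k (rvec Y o))
   (fun o => (Y 0 o == 0)%:R) 1 mc (fun k o => cutoff_norm k _).
have -> : \int[Pr]_o (Y 0 o == 0)%:R = 0 :> R.
  rewrite /Rintegral; transitivity (fine (\int[Pr]_o (\1_[set o | Y 0 o = 0] o)%:E)).
    congr fine; apply: eq_integral => o _; rewrite indicE; congr (_%:R%:E).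
    congr nat_of_bool.
    by apply/idP/idP => [/eqP h|]; rewrite inE // => h; apply/eqP.
  rewrite integral_indic// ?setIT; first by rewrite [X in fine X](multinomial_coord_eq0).
  rewrite -[X in measurable X]setTI.
  exact: (measurable_funP (Y 0) measurableT _ (measurable_set1 0)).
move=> H; have {H} : \int[Pr]_o cutoff k (rvec Y o) @[k --> \oo] --> 0.
  apply: H => o; apply: cvg_near_cst; have [Y0|Y0] := eqVneq (Y 0 o) 0.
    by apply: nearW => k; rewrite cutoff_near// /rvec mxE Y0 normr0 mulr0.
  exists (Num.truncn (2 / `|Y 0 o|)).+1 => // k /= kY.
  rewrite /cutoff max_l// ge_min; apply/orP; right; rewrite subr_le0 /rvec mxE.
  rewrite -ler_pdivrMr ?normr_gt0//; apply: le_trans (ltW (truncnS_gt _)) _.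
  by rewrite ler_nat.
move=> /cvgrPdist_le /(_ e e0)[k _ hk].
exists k.+1 => //; have := hk k.+1 (leqnSn k); rewrite sub0r normrN.
exact: le_trans (ler_norm _).
Qed.

(** Uniform convergence is assumed only away from [h 0 0 = 0]. The mass of the walk in a thin slab
    is controlled by the Gaussian mean of [cutoff k], small because the first coordinate has no atom
    at 0. *)
Theorem cvg_multinomial_walk_cst (G_ : nat -> 'rV[R]_m -> R) (c M : R) :
    (forall n h, `|G_ n h| <= M) -> `|c| <= M ->
    (forall B r e : R, 0 < B -> 0 < r -> 0 < e -> \forall n \near \oo, forall h : 'rV[R]_m,
      \sum_i h 0 i = 0 -> (forall i, `|h 0 i| <= B) -> r <= `|h 0 0| -> `|G_ n h - c| <= e) ->
  swalk n (G_ n) @[n --> \oo] --> c.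
Proof.
move=> GnM cM Gnc; apply/cvgrPdist_le => e e0.
have M0 : 0 <= M by exact: le_trans (normr_ge0 _) cM.
have e40 : 0 < e / 4 by rewrite divr_gt0.
have [B B0 hB] := far_radius M0 e40.
(* Budget: [e / 4] for the uniform part, [e / 4] for Chebyshev and [e / 2] for the slab, since the
   mean of the cutoff under the walk is at most twice this tolerance. *)
have e4M0 : 0 < e / 4 / (2 * M + 1) by rewrite divr_gt0// ltr_wpDl// mulr_ge0.
have [k k0 hk] := cutoff_small e4M0.
have r0 : 0 < (k%:R : R)^-1 by rewrite invr_gt0 ltr0n.
have := cvg_scaled_walk gY wge0 w1 multinomial_mean0 multinomial_covE (ler0n _ k)
  (@cutoff_lipschitz k) (cutoff_norm k).
move=> /cvgrPdist_le /(_ _ e4M0); have := Gnc B k%:R^-1 (e / 4) B0 r0 e40.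
apply: filterS2 => n h1 h2.
have K0 : 0 <= 2 * M / B ^+ 2 by apply: divr_ge0; [exact: mulr_ge0|exact: sqr_ge0].
have := @multinomial_walk_close n (G_ n) (fun=> c) (fun h => e / 4 + 2 * M * cutoff k h) _ K0 _.
have -> : swalk n (fun=> c) = c by exact: iter_walk_cst.
have -> : swalk n (fun h => e / 4 + 2 * M * cutoff k h) = e / 4 + 2 * M * swalk n (cutoff k).
  by rewrite /scaled_walk walkD_iter walkZ_iter iter_walk_cst.
rewrite -/trace.
have H : forall h : 'rV[R]_m, \sum_i h 0 i = 0 ->
    `|G_ n h - c| <= e / 4 + 2 * M * cutoff k h + 2 * M / B ^+ 2 * \sum_i h 0 i ^+ 2.
  move=> h hs; have S0 : 0 <= 2 * M / B ^+ 2 * \sum_i h 0 i ^+ 2.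
    by rewrite mulr_ge0// sumr_ge0// => i _; exact: sqr_ge0.
  have C0 : 0 <= 2 * M * cutoff k h by rewrite !mulr_ge0.
  have [hb|/far_bound hb] := pselect (forall i, `|h 0 i| <= B); last first.
    have := norm_le_M (GnM n h) cM; have := hb M B0 M0.
    by move: S0 C0; move: (_ * \sum_i _) (2 * M * cutoff k h) => *; lra.
  have [hr|hr] := leP k%:R^-1 `|h 0 0|.
    have := h1 h hs hb hr.
    by move: S0 C0; move: (_ * \sum_i _) (2 * M * cutoff k h) => *; lra.
  have := norm_le_M (GnM n h) cM; rewrite cutoff_near; last first.
    by rewrite mulrC -ler_pdivlMr ?ltr0n// div1r ltW.
  by move: S0; move: (_ * \sum_i _) => *; lra.
move=> /(_ H) h3.
have h4 : 2 * M * swalk n (cutoff k) <= e / 2.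
  have : swalk n (cutoff k) <= 2 * (e / 4 / (2 * M + 1)).
    by move: h2 hk; rewrite ler_norml; move: (_ / _) (Rintegral _ _ _) => ? ? /andP[? ?] ?; lra.
  move=> /(ler_wpM2l (_ : 0 <= 2 * M)) h; apply: le_trans (h _) _; first by rewrite mulr_ge0.
  rewrite mulrCA mulrA mulrA ler_pdivrMr ?ltr_wpDl ?mulr_ge0//.
  by move: e0 M0 => ? ?; nra.
move: h3 hB h4; rewrite distrC; move: (_ * trace) (_ * swalk n _) => *; lra.
Qed.

End multinomial_walk.

(** * Fluctuations of the Wasserstein distance *)

Lemma near_sqrt_inv {R : realType} (r0 : R) : 0 < r0 ->
  \forall n \near \oo, 0 < (Num.sqrt (n%:R : R))^-1 <= r0.
Proof.
move=> r0_gt0; exists (Num.truncn (r0 ^- 2)).+1 => // n /= nr.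
have n0 : (0 : R) < n%:R by rewrite ltr0n; exact: leq_ltn_trans nr.
have s0 : 0 < Num.sqrt n%:R :> R by rewrite sqrtr_gt0.
rewrite invr_gt0 s0/= -[leRHS]invrK lef_pV2 ?posrE ?invr_gt0//.
rewrite -(@ler_pXn2r _ 2)// ?nnegrE ?invr_ge0 ?(ltW r0_gt0) ?(ltW s0)//.
rewrite sqr_sqrtr ?(ltW n0)// exprVn; apply: le_trans (ltW (truncnS_gt _)) _.
by rewrite ler_nat.
Qed.

(** As [s < 1], [r^-1 (k r)^s = k^s r^(s - 1)] is unbounded near 0. With [s = 1 / p] this is the
    escape at zero cost. *)
Lemma powR_rate_pinfty {R : realType} (k s A : R) : 0 < k -> 0 < s < 1 ->
  exists2 r0, 0 < r0 & forall r, 0 < r <= r0 -> A <= r^-1 * (k * r) `^ s.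
Proof.
move=> k0 /andP[s0 s1]; pose B := `|A| + 1.
have B0 : 0 < B by rewrite ltr_wpDl.
have q0 : 0 < 1 - s by rewrite subr_gt0.
have kB : 0 < k `^ s / B by rewrite divr_gt0// powR_gt0.
exists ((k `^ s / B) `^ (1 - s)^-1); first exact: powR_gt0.
move=> r /andP[r_gt0 rr0]; apply: (@le_trans _ _ B).
  by apply: le_trans (ler_norm _) _; rewrite lerDl.
rewrite mulrC ler_pdivlMr// powRM ?(ltW k0) ?(ltW r_gt0)//.
have rq : r `^ (1 - s) <= k `^ s / B.
  apply: (@le_trans _ _ (((k `^ s / B) `^ (1 - s)^-1) `^ (1 - s))).
    by apply: ge0_ler_powR; rewrite ?nnegrE ?powR_ge0 ?(ltW q0) ?(ltW r_gt0).
  by rewrite -powRrM mulVf ?gt_eqF// powRr1// ltW.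
rewrite -[r in B * r](powRr1 (ltW r_gt0)) -[1 in X in B * X](subrK s 1).
rewrite powRD; last by rewrite (gt_eqF r_gt0) implybT.
rewrite mulrA ler_wpM2r ?powR_ge0//.
by rewrite ler_pdivlMr// mulrC in rq.
Qed.

Section wasserstein_deviation.
Context {R : realType} {d : measure_display} {Z : borelMetricType d R} {N' : nat}.
Local Notation N := N'.+1.
Variables (p : R) (x : 'I_N -> Z) (w : 'rV[R]_N) (Q : probability Z R).
Variable P : probability Z R.
Hypothesis sZ : separable Z.
Hypothesis p1 : 1 <= p.
Hypothesis w0 : forall k, 0 < w 0 k.
Hypothesis w1 : \sum_k w 0 k = 1.
Hypothesis PE : forall A, measurable A -> P A = (\sum_(k < N) (w 0 k)%:E * \d_(x k) A)%E.
Hypothesis Ip : forall z, Q.-integrable setT (EFin \o dist_pow p z).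

Let C k y := dist_pow p (x k) y.

Let p0 : 0 < p. Proof. exact: lt_le_trans p1. Qed.

Let mc : measurable_fun setT (fun u : Z * Z => dist_pow p u.1 u.2).
Proof. exact: measurable_dist_pow. Qed.

Let mC k : measurable_fun setT (C k). Proof. exact: measurable_cost_section mc _. Qed.

Let C0 k y : 0 <= C k y. Proof. exact: dist_pow_ge0. Qed.

Let IC k : Q.-integrable setT (EFin \o C k). Proof. exact: Ip. Qed.

Let wge0 k : 0 <= w 0 k. Proof. exact: ltW. Qed.

Lemma transport_cost_maximiser (v : 'rV[R]_N) (P' : {measure set Z -> \bar R}) :
    (forall k, 0 < v 0 k) -> \sum_k v 0 k = 1 ->
    (forall A, measurable A -> P' A = (\sum_k (v 0 k)%:E * \d_(x k) A)%E) ->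
  exists2 z, dual_maximiser Q C v z &
    transport_cost (dist_pow p) P' Q = (dual Q C v z)%:E.
Proof.
move=> v0 v1 P'E; have [e e0 ve] := ex_weight_lb v0.
have [z _ [zm zT]] := transport_cost_dual mc (dist_pow_ge0 p) v0 v1 P'E IC e0 ve.
by exists z.
Qed.

Lemma Opt_maximiser : Opt x w P Q p = [set z | dual_maximiser Q C w z].
Proof.
have [zw zwm TE] := transport_cost_maximiser w0 w1 PE.
rewrite /Opt TE; apply/seteqP; split => z /=; rewrite dual_objectiveE//.
  by move=> [zE] z'; rewrite -zE; exact: zwm.
by move=> zm; congr EFin; apply/eqP; rewrite eq_le zm zwm.
Qed.

Variables (t0 : R).
Hypothesis TE : transport_cost (dist_pow p) P Q = t0%:E.

Let t0E z : dual_maximiser Q C w z -> t0 = dual Q C w z.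
Proof.
move=> zm; have [zw zwm] := transport_cost_maximiser w0 w1 PE.
by rewrite TE => -[->]; apply/eqP; rewrite eq_le zm zwm.
Qed.

Lemma transport_cost_real_ge0 : 0 <= t0.
Proof.
have [zw zwm _] := transport_cost_maximiser w0 w1 PE.
by rewrite (t0E zwm); apply: le_trans (zwm 0); exact: dual0_ge0.
Qed.
Let t0_ge0 := transport_cost_real_ge0.

Definition deviation (n : nat) (t : \bar R) : R :=
  Num.sqrt n%:R * (fine (t `^ p^-1)%E - t0 `^ p^-1).

Definition walk_deviation (n : nat) (h : 'rV[R]_N) : R :=
  deviation n (transport_cost (dist_pow p)
    (discrete_measure x (w + (Num.sqrt n%:R)^-1 *: h)) Q).

Variable del : R.
Hypothesis del0 : 0 < del.
Hypothesis wdel : forall k, del <= w 0 k.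
Local Notation sigma := (support_fun Q C w del).

Lemma maximiser_shift z : dual_maximiser Q C w z ->
  exists s, optimal_box Q C w del (z + const_mx s).
Proof.
move=> zm; have wdel2 k : del / 2 <= w 0 k.
  by apply: le_trans (wdel k); rewrite ler_pdivrMr// ler_peMr ?(ltW del0)// ler1n.
have d20 : 0 < del / 2 by rewrite divr_gt0.
have F0 : - 0 <= dual Q C w z by rewrite oppr0 -(t0E zm).
have [s sb sE] := coercive_shift_box d20 (dual_coercive mC C0 IC wdel2 (ltW d20) w1)
  (dual_shift mC C0 IC w1) F0.
rewrite addr0 in sb; exists s; split => // z' /=.
by rewrite sE; exact: zm.
Qed.

Lemma dotr_const_shift (h z : 'rV[R]_N) s : \sum_i h 0 i = 0 ->
  dotr h (z + const_mx s) = dotr h z.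
Proof.
move=> h0; rewrite dotrDr; under [X in _ + X]eq_bigr do rewrite mxE.
by rewrite -mulr_suml h0 mul0r addr0.
Qed.

(** An optimal potential outside the box differs from one inside by a constant, which pairs to zero
    with [h]. *)
Lemma support_fun_maximiser (h z : 'rV[R]_N) : \sum_i h 0 i = 0 ->
  dual_maximiser Q C w z -> dotr h z <= sigma h.
Proof.
move=> h0 /maximiser_shift[s so].
by rewrite -(dotr_const_shift z s h0); exact: support_fun_ge.
Qed.

(** Separates duality from the power function: the transport cost is [t0 + th / sqrt n] with [th]
    close to the support function. This form serves the differentiable case as well as [t0 = 0]. *)
Lemma walk_deviation_bracket (B eta : R) : 0 < B -> 0 < eta ->
  \forall n \near \oo, forall h : 'rV[R]_N, \sum_i h 0 i = 0 ->
    (forall i, `|h 0 i| <= B) ->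
  exists th, [/\ sigma h <= th <= sigma h + eta, 0 <= t0 + (Num.sqrt n%:R)^-1 * th &
    walk_deviation n h =
    Num.sqrt n%:R * ((t0 + (Num.sqrt n%:R)^-1 * th) `^ p^-1 - t0 `^ p^-1)].
Proof.
move=> B0 eta0.
have [r0 r0_gt0 H] := dual_directional_derivative mC C0 IC del0 wdel w1 B0 eta0.
have [zw zwm _] := transport_cost_maximiser w0 w1 PE.
have := near_sqrt_inv (_ : 0 < Num.min r0 (del / 2 / B)).
rewrite lt_min r0_gt0 !divr_gt0// => /(_ isT).
apply: filterS => n; set r := (Num.sqrt n%:R)^-1.
move=> /andP[r_gt0]; rewrite le_min => /andP[rr0 rd] h hs hB.
have vdel i : del / 2 <= (w + r *: h) 0 i.
  rewrite !mxE; have := wdel i.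
  have : `|r * h 0 i| <= del / 2.
    rewrite normrM gtr0_norm//.
    apply: (@le_trans _ _ (r * B)); first by rewrite ler_wpM2l// ltW.
    by rewrite -ler_pdivlMr.
  by rewrite ler_norml => /andP[? _] ?; lra.
have v0 i : 0 < (w + r *: h) 0 i by apply: lt_le_trans (vdel i); rewrite divr_gt0.
have v1 : \sum_i (w + r *: h) 0 i = 1.
  by under eq_bigr do rewrite !mxE; rewrite big_split/= w1 -mulr_sumr hs mulr0 addr0.
have vE A : measurable A -> discrete_measure x (w + r *: h) A =
    (\sum_k ((w + r *: h) 0 k)%:E * \d_(x k) A)%E.
  by move=> _; apply: discrete_measureE => k; exact: ltW.
have [zv zvm vT] := transport_cost_maximiser v0 v1 vE.
have rr : 0 < r <= r0 by rewrite r_gt0.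
have [_ h1 h2] := H r h zv zw rr hB hs zvm zwm.
exists ((dual Q C (w + r *: h) zv - dual Q C w zw) / r).
have E : t0 + r * ((dual Q C (w + r *: h) zv - dual Q C w zw) / r) = dual Q C (w + r *: h) zv.
  by rewrite (t0E zwm) mulrCA divff ?gt_eqF// mulr1 addrC subrK.
split; [by rewrite h1 h2| |].
  by rewrite E; apply: le_trans (zvm 0); exact: dual0_ge0.
by rewrite E /walk_deviation /deviation -/r vT poweR_EFin.
Qed.

Let support_bound (B : R) (h : 'rV[R]_N) : (forall i, `|h 0 i| <= B) ->
  `|sigma h| <= box_radius Q C del * (N%:R * B).
Proof.
move=> hB.
have := support_fun_lipschitz mC C0 IC del0 wdel w1 h 0.
rewrite (support_fun0 mC C0 IC del0 wdel w1) subr0; move=> /le_trans; apply; rewrite ler_wpM2l ?box_radius_ge0//.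
apply: (@le_trans _ _ (\sum_(i < N) B)); last by rewrite sumr_const card_ord mulr_natl.
by apply: ler_sum => i _; rewrite mxE subr0.
Qed.

Definition slope : R := p^-1 * t0 `^ (p^-1 - 1).

Lemma walk_deviation_linear (B e : R) : 0 < t0 \/ p = 1 -> 0 < B -> 0 < e ->
  \forall n \near \oo, forall h : 'rV[R]_N, \sum_i h 0 i = 0 ->
    (forall i, `|h 0 i| <= B) -> `|walk_deviation n h - slope * sigma h| <= e.
Proof.
move=> tp B0 e0.
have tq : 0 < t0 \/ 0 <= t0 /\ p^-1 = 1.
  by case: tp => [|->]; [left|right; rewrite invr1].
have sl0 : 0 <= slope by rewrite mulr_ge0 ?powR_ge0// invr_ge0 ltW.
(* This choice makes the bracket error, multiplied by [slope], at most [e / 2]; the Taylor error,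
   relative to [|th| <= Th], takes the other half. *)
have eta0 : 0 < e / 2 / (slope + 1) by rewrite !divr_gt0// ltr_wpDl.
pose Th := box_radius Q C del * (N%:R * B) + e / 2 / (slope + 1).
have Th0 : 0 < Th.
  apply: ltr_wpDl => //; apply: mulr_ge0; first exact: box_radius_ge0.
  by apply: mulr_ge0 => //; exact: ltW.
have e2Th : 0 < e / 2 / Th by rewrite !divr_gt0.
have [r r_gt0 Hr] := powR_taylor1 tq e2Th.
have := near_sqrt_inv (_ : 0 < r / Th); rewrite divr_gt0// => /(_ isT).
have := walk_deviation_bracket B0 eta0.
apply: filterS2 => n H; set q := (Num.sqrt n%:R)^-1 in H *.
move=> /andP[q0 qr] h hs hB.
have [th [/andP[th1 th2] th3 ->]] := H h hs hB.
have thTh : `|th| <= Th.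
  have := support_bound hB; rewrite /Th !ler_norml.
  move: (e / 2 / _) th2 eta0 => ? ? ? /andP[? ?]; apply/andP; split; lra.
have qth : `|q * th| <= r.
  rewrite normrM gtr0_norm//; apply: (@le_trans _ _ (q * Th)).
    by rewrite ler_wpM2l// ltW.
  by rewrite -ler_pdivlMr.
have := Hr _ qth th3; rewrite -/slope.
have -> : Num.sqrt n%:R = q^-1 by rewrite invrK.
move: (_ `^ p^-1 - _) => D hD.
have h1 : `|q^-1 * D - slope * th| <= e / 2.
  have -> : q^-1 * D - slope * th = q^-1 * (D - slope * (q * th)).
    by field; rewrite gt_eqF.
  have qv0 : 0 < q^-1 by rewrite invr_gt0.
  rewrite normrM (gtr0_norm qv0) mulrC ler_pdivrMr//.
  apply: le_trans hD _; rewrite normrM (gtr0_norm q0) mulrCA mulrC ler_wpM2r ?(ltW q0)//.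
  by rewrite mulrAC ler_pdivrMr// ler_wpM2l// divr_ge0// ltW.
have h2 : `|slope * th - slope * sigma h| <= e / 2.
  rewrite -mulrBr normrM (ger0_norm sl0) ger0_norm ?subr_ge0//.
  apply: (@le_trans _ _ (slope * (e / 2 / (slope + 1)))).
    by rewrite ler_wpM2l//; lra.
  by rewrite mulrA ler_pdivrMr ?ltr_wpDl// mulrC ler_wpM2l ?divr_ge0 ?(ltW e0)// lerDl.
rewrite -(subrKA (slope * th)); apply: le_trans (ler_normD _ _) _; lra.
Qed.

End wasserstein_deviation.

Lemma dotrC {R : realType} {m : nat} (t y : 'rV[R]_m) : dotr t y = dotr y t.
Proof. by apply: eq_bigr => i _; rewrite mulrC. Qed.

(** * Vanishing transport cost *)

Section zero_cost.
Context {R : realType} {d : measure_display} {Z : borelMetricType d R} {N' : nat}.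
Local Notation N := N'.+1.
Variables (p : R) (x : 'I_N -> Z) (w : 'rV[R]_N) (Q : probability Z R).
Variable P : probability Z R.
Hypothesis sZ : separable Z.
Hypothesis p1 : 1 < p.
Hypothesis x_inj : injective x.
Hypothesis w0 : forall k, 0 < w 0 k.
Hypothesis w1 : \sum_k w 0 k = 1.
Hypothesis PE : forall A, measurable A -> P A = (\sum_(k < N) (w 0 k)%:E * \d_(x k) A)%E.
Hypothesis Ip : forall z, Q.-integrable setT (EFin \o dist_pow p z).
Hypothesis TE : transport_cost (dist_pow p) P Q = 0%E.

Let C k y := dist_pow p (x k) y.

Let p0 : 0 < p. Proof. exact: lt_trans p1. Qed.

Let mc : measurable_fun setT (fun u : Z * Z => dist_pow p u.1 u.2).
Proof. exact: measurable_dist_pow. Qed.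

Let mC k : measurable_fun setT (C k). Proof. exact: measurable_cost_section mc _. Qed.

Let C0 k y : 0 <= C k y. Proof. exact: dist_pow_ge0. Qed.

Let IC k : Q.-integrable setT (EFin \o C k). Proof. exact: Ip. Qed.

Let C_eq0 k y : C k y = 0 -> y = x k.
Proof.
rewrite /C /dist_pow => /eqP; rewrite powR_eq0 (gt_eqF p0) andbT => /eqP h.
exact/esym/mdist_positivity.
Qed.

Let separation : exists2 e, 0 < e & forall i k, i != k -> e <= C i (x k).
Proof.
exists (\big[Num.min/1]_(u : 'I_N * 'I_N | u.1 != u.2) C u.1 (x u.2)).
  elim/big_ind : _ => [//|a b a0 b0|[i k] /= ik]; first by rewrite lt_min a0.
  rewrite lt_neqAle C0 andbT; apply/negP => /eqP /esym /C_eq0 /x_inj ki.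
  by rewrite ki eqxx in ik.
by move=> i k ik; exact: (@bigmin_le_cond _ _ _ 1 (i, k) (fun u => u.1 != u.2) (fun u => C u.1 (x u.2))).
Qed.

(** Zero cost forces [Q] to sit on the atoms. For [z] small against their separation the minimum at
    [x k] is [- z 0 k], so the dual values at [z] and [- z] add up to 0; both are at most the
    optimum 0, hence equal to it. *)
Lemma zero_cost_maximiser : exists2 e, 0 < e &
  forall z : 'rV[R]_N, (forall i, `|z 0 i| <= e) -> dual_maximiser Q C w z.
Proof.
have [e e0 sep] := separation; exists (e / 2); first by rewrite divr_gt0.
have [zw zwm] := transport_cost_maximiser sZ Ip w0 w1 PE.
rewrite TE => -[zw0].
have min0 : \int[Q]_y min_cost C 0 y = 0.
  apply/eqP; rewrite eq_le; apply/andP; split.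
    by rewrite zw0; have := zwm 0; rewrite {1}/dual big1 ?add0r// => i _; rewrite mxE mulr0.
  by have := dual0_ge0 Q C0 w; rewrite /dual big1 ?add0r// => i _; rewrite mxE mulr0.
have m00 y : 0 <= min_cost C 0 y by apply: min_cost_glb => i; rewrite mxE subr0.
have Im z : Q.-integrable setT (EFin \o min_cost C z) by exact: integrable_min_cost.
have ae0 : ae_eq Q setT (EFin \o min_cost C 0) (cst 0%E).
  apply/ae_eq_integral_abs => //.
    by apply/measurable_EFinP; exact: measurable_min_cost.
  under eq_integral do rewrite /= ger0_norm//.
  move: min0; rewrite /Rintegral => h.
  by rewrite -[LHS](fineK (integrable_fin_num measurableT (Im 0))) h.
have sum0 (z : 'rV[R]_N) : (forall i, `|z 0 i| <= e / 2) -> dual Q C w z + dual Q C w (- z) = 0.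
  move=> ze; have NzE : \sum_i w 0 i * (- z) 0 i = - \sum_i w 0 i * z 0 i.
    by rewrite -sumrN; apply: eq_bigr => i _; rewrite mxE mulrN.
  rewrite /dual NzE addrACA subrr add0r -RintegralD//.
  rewrite /Rintegral; apply/eqP; rewrite (ae_eq_integral (cst 0%E))//=.
  - by rewrite integral0.
  - apply/measurable_EFinP; apply: measurable_funD; exact: measurable_min_cost.
  - apply: filterS ae0 => y /(_ I) [] y0 _ /=; congr EFin.
    have [k] := min_cost_attained C 0 y; rewrite y0 mxE subr0 => /esym /C_eq0 ->.
    have mz (z' : 'rV[R]_N) : (forall i, `|z' 0 i| <= e / 2) -> min_cost C z' (x k) = - z' 0 k.
      move=> z'e; have Ck : C k (x k) = 0 by rewrite /C dist_powxx// gt_eqF.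
      apply/eqP; rewrite eq_le; apply/andP; split.
        by have := min_cost_le C z' (x k) k; rewrite Ck sub0r.
      apply: min_cost_glb => i; have [->|ik] := eqVneq i k; first by rewrite Ck sub0r.
      have := sep i k ik; have := z'e i; have := z'e k; rewrite !ler_norml.
      move=> /andP[? ?] /andP[? ?] ?; lra.
    rewrite !mz//; last by move=> i; rewrite mxE normrN.
    by rewrite mxE opprK addNr.
move=> z ze z'; apply: le_trans (zwm z') _.
have h1 := zwm z; have h2 := zwm (- z); have := sum0 z ze.
rewrite -zw0 in h1 h2 *; move: (dual _ _ _ z) (dual _ _ _ (- z)) h1 h2 => *; lra.
Qed.

Variable del : R.
Hypothesis del0 : 0 < del.
Hypothesis wdel : forall k, del <= w 0 k.
Local Notation sigma := (support_fun Q C w del).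

Lemma zero_cost_support_fun : exists2 e, 0 < e &
  forall h : 'rV[R]_N, \sum_i h 0 i = 0 -> e * `|h 0 0| <= sigma h.
Proof.
have [e e0 He] := zero_cost_maximiser; exists e => // h hs.
have H (s : R) : `|s| = 1 -> s * (e * h 0 0) <= sigma h.
  move=> s1; have : dual_maximiser Q C w ((s * e) *: delta_mx 0 0).
    apply: He => i; rewrite !mxE normrM normrM s1 mul1r (gtr0_norm e0).
    by case: (_ && _); rewrite ?normr1 ?mulr1// normr0 mulr0 ltW.
  move=> /(support_fun_maximiser sZ w0 w1 PE Ip TE del0 wdel hs).
  by rewrite dotrC dotr_delta mulrA.
have [h0|h0] := leP 0 (h 0 0).
  by have := H 1 (normr1 _); rewrite mul1r ger0_norm.
by have := H (- 1) (normrN1 _); rewrite mulN1r -mulrN ltr0_norm.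
Qed.

(** Here the deviation is [sqrt n (th / sqrt n)^(1/p)] with [th >= e r > 0], which
    [powR_rate_pinfty] makes arbitrarily large. *)
Lemma walk_deviation_escape (B r A : R) : 0 < B -> 0 < r ->
  \forall n \near \oo, forall h : 'rV[R]_N, \sum_i h 0 i = 0 ->
    (forall i, `|h 0 i| <= B) -> r <= `|h 0 0| -> A <= walk_deviation p x w Q 0 n h.
Proof.
move=> B0 r0; have [e e0 He] := zero_cost_support_fun.
have s01 : 0 < p^-1 < 1 by rewrite invr_gt0 p0 invf_lt1.
have [q0 q0_gt0 Hq] := powR_rate_pinfty A (mulr_gt0 e0 r0) s01.
have := walk_deviation_bracket sZ w0 w1 PE Ip TE del0 wdel B0 ltr01.
have := near_sqrt_inv q0_gt0; apply: filterS2 => n.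
set q := (Num.sqrt n%:R)^-1 => qq0 H h hs hB hr.
have [th [/andP[th1 _] th0 ->]] := H h hs hB.
rewrite powR0 ?invr_eq0 ?gt_eqF// subr0 add0r; rewrite add0r in th0.
have -> : Num.sqrt n%:R = q^-1 by rewrite invrK.
apply: le_trans (Hq q qq0) _; have /andP[q_gt0 _] := qq0.
rewrite ler_wpM2l ?invr_ge0 ?(ltW q_gt0)//.
apply: ge0_ler_powR; rewrite ?nnegrE ?invr_ge0 ?(ltW p0)// ?mulr_ge0 ?(ltW e0) ?(ltW r0) ?(ltW q_gt0)//.
rewrite mulrC ler_wpM2l ?(ltW q_gt0)//; apply: le_trans th1; apply: le_trans (He h hs).
by rewrite ler_wpM2l// ltW.
Qed.

End zero_cost.

(** * From the sample to the multinomial walk *)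

Section sample_deviation.
Context {R : realType} {d : measure_display} {Z : borelMetricType d R} {N' : nat}
  {d1 : measure_display} {Omega : measurableType d1}.
Local Notation N := N'.+1.
Variables (p : R) (x : 'I_N -> Z) (w : 'rV[R]_N) (Q : probability Z R).
Variables (P : probability Z R) (Pr : probability Omega R) (S : nat -> {RV Pr >-> Z}).
Hypothesis sZ : separable Z.
Hypothesis x_inj : injective x.
Hypothesis PE : forall A, measurable A -> P A = (\sum_(k < N) (w 0 k)%:E * \d_(x k) A)%E.
Hypothesis iidS : iid_sample P S.
Hypothesis Ip : forall z, Q.-integrable setT (EFin \o dist_pow p z).
Variable t0 : R.

Definition sample_deviation n o : R := deviation p t0 n
  (transport_cost (dist_pow p) (empirical_measure n (fun k => S k o)) Q).

(** Written with [n] equally weighted sample points instead of the atoms, which carry the sample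
    only almost surely. For [n = 0] the factor [sqrt 0] makes it vanish. *)
Lemma measurable_sample_deviation n : measurable_fun setT (sample_deviation n).
Proof.
case: n => [|n].
  rewrite (_ : sample_deviation 0 = cst 0); first exact: measurable_cst.
  by apply/funext => o; rewrite /sample_deviation /deviation sqrtr0 mul0r.
apply: measurable_funM => //; apply: measurable_funB => //.
apply: (measurableT_comp (fine_measurable _)) => //.
apply: (measurableT_comp (f := fun y => (y `^ p^-1)%E)).
  exact: measurable_poweR.
apply: (@measurable_transport_cost _ _ _ _ n _ _ _ (const_mx n.+1%:R^-1) (fun o k => S k o)) => //.
- exact: measurable_dist_pow.
- exact: dist_pow_ge0.
- by move=> i; rewrite mxE invr_gt0.
- under eq_bigr do rewrite mxE.
  by rewrite sumr_const card_ord -[(_ *+ _)]mulr_natl divff.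
- by move=> o A _; exact: empirical_measureE.
Qed.

Lemma integral_sample_deviation (F : R -> R) n : measurable_fun setT F ->
  (\int[Pr]_o (F (sample_deviation n o))%:E =
   (scaled_walk (fun j => w 0 j) (multinomial_step w) n
      (F \o walk_deviation p x w Q t0 n))%:E)%E.
Proof.
move=> mF; apply: (integral_sample_walk iidS x_inj _ PE).
- exact: measurable_set1_metric.
- exact: (measurableT_comp mF (measurable_sample_deviation n)).
- move=> o l ln lS; congr F; rewrite /walk_deviation /sample_deviation.
  case: n ln lS => [|n] ln lS; first by rewrite /deviation sqrtr0 !mul0r.
  congr (deviation _ _ _ _); apply: eq_transport_cost => A _.
  rewrite (empirical_measure_discrete A ln lS); congr (discrete_measure _ _ _).
  (* The empirical weights are [w] plus [1 / sqrt n] times the scaled sum of the centred steps. *)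
  rewrite -scaler_sumr scalerA -invfM -expr2 sqr_sqrtr// /multinomial_step sumrB.
  rewrite scalerBr big_const_seq count_predT iter_addr_0 ln -(scaler_nat n.+1 w) scalerA.
  by rewrite mulVf// scale1r addrC subrK.
Qed.

End sample_deviation.

Lemma bounded_expectation {R : realType} {d : measure_display} {T : measurableType d}
    (Pr : probability T R) (g : T -> R) (M : R) :
    measurable_fun setT g -> (forall o, `|g o| <= M) ->
  expectation Pr g = (\int[Pr]_o g o)%:E.
Proof.
move=> mg gM; rewrite expectation.unlock /Rintegral fineK//.
by apply: integrable_fin_num => //; exact: (@bounded_integrable _ _ _ Pr g M).
Qed.

Lemma ae_eq_bounded_Rintegral {R : realType} {d : measure_display} {T : measurableType d}
    (Pr : probability T R) (f g : T -> R) :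
    measurable_fun setT f -> measurable_fun setT g ->
    {ae Pr, forall o, f o = g o} -> \int[Pr]_o f o = \int[Pr]_o g o.
Proof.
move=> mf mg fg; rewrite /Rintegral; congr fine; apply: ae_eq_integral => //.
- exact/measurable_EFinP.
- exact/measurable_EFinP.
- by apply: filterS fg => o -> _.
Qed.

(** * The Gaussian limit variable *)

Section gaussian_limit.
Context {R : realType} {d : measure_display} {Z : borelMetricType d R} {N' : nat}
  {d2 : measure_display} {Omega' : measurableType d2}.
Local Notation N := N'.+1.
Variables (p : R) (x : 'I_N -> Z) (w : 'rV[R]_N) (Q P : probability Z R).
Variables (Pr' : probability Omega' R) (Y : 'I_N -> {RV Pr' >-> R}).
Hypothesis sZ : separable Z.
Hypothesis w0 : forall k, 0 < w 0 k.
Hypothesis w1 : \sum_k w 0 k = 1.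
Hypothesis PE : forall A, measurable A -> P A = (\sum_(k < N) (w 0 k)%:E * \d_(x k) A)%E.
Hypothesis gY : centered_gaussian_vector (multinomial_cov w) Y.
Hypothesis Ip : forall z, Q.-integrable setT (EFin \o dist_pow p z).
Variables (t0 del : R).
Hypothesis TE : transport_cost (dist_pow p) P Q = t0%:E.
Hypothesis del0 : 0 < del.
Hypothesis wdel : forall k, del <= w 0 k.

Let C k y := dist_pow p (x k) y.
Local Notation sigma := (support_fun Q C w del).

Let mC k : measurable_fun setT (C k).
Proof. exact: measurable_cost_section (measurable_dist_pow p sZ) _. Qed.

Let C0 k y : 0 <= C k y. Proof. exact: dist_pow_ge0. Qed.

Let IC k : Q.-integrable setT (EFin \o C k). Proof. exact: Ip. Qed.

(** The centred steps pair to 0 with the constant vector 1, so the sum of the coordinates has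
    variance 0 and its law is the Dirac mass at 0. *)
Lemma gaussian_sum0 : {ae Pr', forall o, \sum_i Y i o = 0}.
Proof.
have E o : \sum_i (const_mx 1 : 'rV[R]_N) 0 i * Y i o = \sum_i Y i o.
  by apply: eq_bigr => i _; rewrite mxE mul1r.
have msum : measurable_fun setT (fun o => \sum_i Y i o).
  by apply: measurable_sum => i; exact: measurable_funP.
exists [set o | \sum_i Y i o != 0]; split.
- rewrite (_ : [set o | _] = ~` [set o | \sum_i Y i o = 0]); last first.
    by apply/seteqP; split => o /= /eqP.
  apply: measurableC; rewrite -[X in measurable X]setTI.
  exact: msum measurableT _ (measurable_set1 0).
- have := @gY (const_mx 1) (~` [set 0]) (measurableC (measurable_set1 _)).
  rewrite -multinomial_covE// big1; last first.
    move=> j _; rewrite (_ : dotr _ _ = 0) ?expr0n ?mulr0//.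
    rewrite /dotr; under eq_bigr do rewrite !mxE mul1r.
    rewrite sumrB w1 (bigD1 j)//= eqxx big1 ?addr0 ?subrr// => i /negbTE ->//.
  rewrite /centered_normal eqxx diracE memNset; last by apply.
  move=> H; apply: etrans H; congr (Pr' _); apply/seteqP; split => o /=; rewrite E.
    by move=> /eqP.
  by move=> h; apply/eqP.
- by move=> o /= h; apply/eqP => h'; apply: h.
Qed.

(** Invariance of [Opt] under constants makes the supremum finite only where the coordinates of [Y]
    sum to 0, and there the box suffices. The formula covers every outcome, as measurability of the
    limit requires. *)
Lemma ereal_sup_Opt o :
  ereal_sup [set (\sum_i z 0 i * Y i o)%:E | z in Opt x w P Q p] =
  if \sum_i Y i o == 0 then (sigma (rvec Y o))%:E else +oo%E.
Proof.
rewrite (Opt_maximiser sZ w0 w1 PE Ip); set S := image _ _.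
have dE (z : 'rV[R]_N) : \sum_i z 0 i * Y i o = dotr (rvec Y o) z.
  by apply: eq_bigr => i _; rewrite /rvec mxE mulrC.
have rs : \sum_i rvec Y o 0 i = \sum_i Y i o.
  by apply: eq_bigr => i _; rewrite /rvec mxE.
have [zw [zwm zwb]] := optimal_box_nonempty mC C0 IC del0 wdel w1.
case: eqP => [s0|/eqP s0].
  rewrite s0 in rs.
  have Sle : (ereal_sup S <= (sigma (rvec Y o))%:E)%E.
    apply: ge_ereal_sup => _ [z zm <-]; rewrite lee_fin dE.
    exact: (support_fun_maximiser sZ w0 w1 PE Ip TE del0 wdel rs zm).
  have leS z : dual_maximiser Q C w z -> ((dotr (rvec Y o) z)%:E <= ereal_sup S)%E.
    by move=> zm; apply: ereal_sup_ubound; exists z => //; rewrite dE.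
  move: Sle leS; case: (ereal_sup S) => [r| |] Sle leS //; last first.
    by have := leS zw zwm; rewrite leeNy_eq.
  congr EFin; apply/eqP; rewrite eq_le -lee_fin Sle/=.
  apply: (support_fun_le mC C0 IC del0 wdel w1) => z [zm _].
  by rewrite -lee_fin; exact: leS.
(* The shift [s] is chosen so that the pairing takes the arbitrary value [A]. *)
apply/eqyP => A A0; pose s := (A - dotr (rvec Y o) zw) / \sum_i Y i o.
apply: ereal_sup_ubound; exists (zw + const_mx s).
  by move=> z' /=; rewrite (dual_shift mC C0 IC w1); exact: zwm.
congr EFin; rewrite dE dotrDr [X in _ + X](_ : _ = s * \sum_i Y i o).
  by rewrite /s -mulrA mulVf// mulr1 addrC subrK.
by rewrite -rs mulr_sumr; apply: eq_bigr => i _; rewrite [const_mx _ _ _]mxE mulrC.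
Qed.

Definition gaussian_limit (k : \bar R) (o : Omega') : \bar R :=
  (k * ereal_sup [set (\sum_i z 0 i * Y i o)%:E | z in Opt x w P Q p])%E.

Lemma measurable_gaussian_limit k : measurable_fun setT (gaussian_limit k).
Proof.
apply: measurable_funeM; under eq_fun do rewrite ereal_sup_Opt.
apply: measurable_fun_ifT; [| |exact: measurable_cst].
  apply: measurable_fun_eqr; last exact: measurable_cst.
  by apply: measurable_sum => i; exact: measurable_funP.
apply/measurable_EFinP; apply: (lipschitz_rvec_measurable Y (C := box_radius Q C del)).
  exact: box_radius_ge0.
exact: support_fun_lipschitz.
Qed.

Lemma gaussian_limit_ae k :
  {ae Pr', forall o, gaussian_limit k o = (k * (sigma (rvec Y o))%:E)%E}.
Proof.
by apply: filterS gaussian_sum0 => o o0; rewrite /gaussian_limit ereal_sup_Opt o0 eqxx.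
Qed.

End gaussian_limit.

(** * Limits of the fluctuations in each regime *)

Section empirical_clt.
Context {R : realType} {d : measure_display} {Z : borelMetricType d R} {N' : nat}
  {d1 d2 : measure_display} {Omega : measurableType d1} {Omega' : measurableType d2}.
Local Notation N := N'.+1.
Variables (p : R) (x : 'I_N -> Z) (w : 'rV[R]_N) (Q P : probability Z R).
Variables (Pr : probability Omega R) (S : nat -> {RV Pr >-> Z}).
Variables (Pr' : probability Omega' R) (Y : 'I_N -> {RV Pr' >-> R}).
Hypothesis sZ : separable Z.
Hypothesis p1 : 1 <= p.
Hypothesis x_inj : injective x.
Hypothesis w0 : forall k, 0 < w 0 k.
Hypothesis w1 : \sum_k w 0 k = 1.
Hypothesis PE : forall A, measurable A -> P A = (\sum_(k < N) (w 0 k)%:E * \d_(x k) A)%E.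
Hypothesis iidS : iid_sample P S.
Hypothesis gY : centered_gaussian_vector (multinomial_cov w) Y.
Hypothesis Ip : forall z, Q.-integrable setT (EFin \o dist_pow p z).
Variables (t0 del : R).
Hypothesis TE : transport_cost (dist_pow p) P Q = t0%:E.
Hypothesis del0 : 0 < del.
Hypothesis wdel : forall k, del <= w 0 k.

Let C k y := dist_pow p (x k) y.
Local Notation sigma := (support_fun Q C w del).

Let p0 : 0 < p. Proof. exact: lt_le_trans p1. Qed.

Let mC k : measurable_fun setT (C k).
Proof. exact: measurable_cost_section (measurable_dist_pow p sZ) _. Qed.

Let C0 k y : 0 <= C k y. Proof. exact: dist_pow_ge0. Qed.

Let IC k : Q.-integrable setT (EFin \o C k). Proof. exact: Ip. Qed.

Let t0_ge0 : 0 <= t0. Proof. exact: (transport_cost_real_ge0 sZ w0 w1 PE Ip TE). Qed.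

Let slope_ge0 : 0 <= slope p t0.
Proof. by rewrite mulr_ge0 ?powR_ge0// invr_ge0 ltW. Qed.

Let sigma_lip : lipschitz1 (slope p t0 * box_radius Q C del) (fun h => slope p t0 * sigma h).
Proof.
move=> h h'; rewrite -mulrBr normrM ger0_norm// -mulrA ler_wpM2l//.
exact: support_fun_lipschitz.
Qed.

Let lip_ge0 : 0 <= slope p t0 * box_radius Q C del.
Proof. by rewrite mulr_ge0// box_radius_ge0. Qed.

Let Rintegral_sample (F : R -> R) n : measurable_fun setT F ->
  \int[Pr]_o F (sample_deviation p Q S t0 n o) =
  scaled_walk (fun j => w 0 j) (multinomial_step w) n (F \o walk_deviation p x w Q t0 n).
Proof.
by move=> mF; rewrite /Rintegral (integral_sample_deviation sZ x_inj PE iidS Ip).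
Qed.

Lemma cvg_sample_linear (F : R -> R) (M : R) : 0 < t0 \/ p = 1 ->
    continuous F -> (forall s, `|F s| <= M) ->
  \int[Pr]_o F (sample_deviation p Q S t0 n o) @[n --> \oo] -->
  \int[Pr']_o F (slope p t0 * sigma (rvec Y o)).
Proof.
move=> tp cF FM.
apply: (cvg_bounded_continuous (measurable_sample_deviation S sZ Ip t0) _ _ cF FM).
  exact: (lipschitz_rvec_measurable Y lip_ge0 sigma_lip).
move=> L B g L0 gL gB.
have mg : measurable_fun setT g.
  exact: continuous_measurable_fun (lipschitz_real_continuous L0 gL).
under eq_fun do rewrite Rintegral_sample//.
apply: (cvg_multinomial_walk w0 w1 gY (G := fun h => g (slope p t0 * sigma h))
   (L := L * (slope p t0 * box_radius Q C del)) (M := B)) => //.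
- exact: mulr_ge0.
- by move=> h h'; apply: le_trans (gL _ _) _; rewrite -(mulrA L) ler_wpM2l.
- by move=> n h; exact: gB.
move=> r e r0 e0; have e'0 : 0 < e / (L + 1) by rewrite divr_gt0// ltr_wpDl.
have := walk_deviation_linear sZ p1 w0 w1 PE Ip TE del0 wdel tp r0 e'0.
apply: filterS => n H h hs hr; apply: le_trans (gL _ _) _.
apply: (@le_trans _ _ (L * (e / (L + 1)))); first by rewrite ler_wpM2l// H.
by rewrite mulrA ler_pdivrMr ?ltr_wpDl// mulrC ler_wpM2l ?(ltW e0)// lerDl.
Qed.

Lemma cvg_sample_escape (F : R -> R) (c M : R) : (0 < N')%N -> t0 = 0 -> 1 < p ->
    measurable_fun setT F -> (forall s, `|F s| <= M) -> `|c| <= M ->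
    (forall e, 0 < e -> exists A, forall s, A <= s -> `|F s - c| <= e) ->
  \int[Pr]_o F (sample_deviation p Q S t0 n o) @[n --> \oo] --> c.
Proof.
move=> N0 t00 p1' mF FM cM Fc.
under eq_fun do rewrite Rintegral_sample//.
apply: (cvg_multinomial_walk_cst w0 w1 gY _ (M := M)) => //.
- exact: multinomial_cov00_gt0.
- by move=> n h; exact: FM.
move=> B r e B0 r0 e0; have [A HA] := Fc e e0.
have TE0 : transport_cost (dist_pow p) P Q = 0%E by rewrite TE t00.
rewrite t00; have := walk_deviation_escape sZ p1' x_inj w0 w1 PE Ip TE0 del0 wdel A B0 r0.
by apply: filterS => n H h hs hB hr; apply: HA; exact: H.
Qed.

(** For a single atom the hyperplane of sum zero is reduced to 0, so the walk never moves and the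
    deviation is that of [P] itself. *)
Lemma sample_degenerate (F : R -> R) n : N' = 0%N -> measurable_fun setT F ->
  \int[Pr]_o F (sample_deviation p Q S t0 n o) = F 0.
Proof.
move=> N0 mF; rewrite Rintegral_sample//.
have := @multinomial_walk_close _ _ w w0 w1 n (F \o walk_deviation p x w Q t0 n)
  (fun=> F 0) (fun=> 0) 0 (lexx 0) _.
have -> : scaled_walk (fun j => w 0 j) (multinomial_step w) n (fun=> F 0) = F 0.
  exact: iter_walk_cst.
have -> : scaled_walk (fun j => w 0 j) (multinomial_step w) n (fun=> 0) = 0 :> R.
  exact: iter_walk_cst.
rewrite mul0r add0r => H; apply/eqP; rewrite -subr_eq0 -normr_le0; apply: H => h hs.
rewrite (sum0_degenerate N0 hs).
rewrite mul0r addr0 /= /walk_deviation scaler0 addr0.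
rewrite (@eq_transport_cost _ _ _ _ (discrete_measure x w) P); last first.
  move=> A mA; apply: etrans (esym (PE mA)).
  by rewrite discrete_measureE// => k; exact: ltW.
by rewrite TE /deviation poweR_EFin subrr mulr0 subrr normr0.
Qed.

End empirical_clt.

Lemma normalisation_slope {R : realType} (p t0 : R) : 1 <= p -> 0 <= t0 -> 0 < t0 \/ p = 1 ->
  ((p%:E * ((t0 `^ p^-1)%:E `^ (p - 1)))^-1 = (slope p t0)%:E)%E.
Proof.
move=> p1 t00 tp; have p0 : 0 < p by exact: lt_le_trans p1.
rewrite poweR_EFin -EFinM -powRrM mulrBr mulr1 mulVf ?gt_eqF//.
have a0 : 0 < t0 `^ (1 - p^-1).
  case: tp => [t0_gt0|->]; first exact: powR_gt0.
  by rewrite invr1 subrr powRr0.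
rewrite inver mulf_eq0 !gt_eqF//=; congr EFin.
by rewrite /slope -(opprB p^-1 1) powRN invfM invrK.
Qed.

Section main.
Context {R : realType} {d : measure_display} {Z : borelMetricType d R} {N' : nat}
  {d1 d2 : measure_display} {Omega : measurableType d1} {Omega' : measurableType d2}.
Local Notation N := N'.+1.
Variables (p : R) (x : 'I_N -> Z) (w : 'rV[R]_N) (Q P : probability Z R).
Variables (Pr : probability Omega R) (S : nat -> {RV Pr >-> Z}).
Variables (Pr' : probability Omega' R) (Y : 'I_N -> {RV Pr' >-> R}).
Hypothesis sZ : separable Z.
Hypothesis p1 : 1 <= p.
Hypothesis w0 : forall k, 0 < w 0 k.
Hypothesis w1 : \sum_k w 0 k = 1.
Hypothesis PE : forall A, measurable A -> P A = (\sum_(k < N) (w 0 k)%:E * \d_(x k) A)%E.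

Definition wasserstein_fluctuation n o : \bar R :=
  (Num.sqrt n%:R * (fine (wasserstein p (empirical_measure n (fun k => S k o)) Q) -
    fine (wasserstein p P Q)))%:E.

Definition wasserstein_limit : Omega' -> \bar R :=
  gaussian_limit p x w Q P Y (p%:E * wasserstein p P Q `^ (p - 1))^-1%E.

Let p0 : 0 < p. Proof. exact: lt_le_trans p1. Qed.

Let sqrt0 : Num.sqrt 0%:R = 0 :> R. Proof. exact: sqrtr0. Qed.

(** All distances involved are [+oo] for [n >= 1]. As [p != 1], the exponent [p - 1] in the limit
    factor is nonzero, and the factor is the inverse of [+oo]. *)
Lemma wasserstein_clt_infinite_moment : p != 1 ->
    (forall m' (s : 'I_m'.+1 -> Z),
      \int[Q]_y (min_cost (fun k => dist_pow p (s k)) 0 y)%:E = +oo)%E ->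
  cvg_in_distribution Pr Pr' wasserstein_fluctuation wasserstein_limit.
Proof.
move=> pn1 Qoo.
have Too m' (v : 'rV[R]_m'.+1) (s : 'I_m'.+1 -> Z) (P' : {measure set Z -> \bar R}) :
    (forall k, 0 < v 0 k) -> \sum_k v 0 k = 1 ->
    (forall A, measurable A -> P' A = (\sum_k (v 0 k)%:E * \d_(s k) A)%E) ->
    wasserstein p P' Q = +oo%E.
  move=> v0 v1 P'E; rewrite /wasserstein.
  have := transport_cost_ge_min Q (measurable_dist_pow p sZ) (dist_pow_ge0 p) v0 P'E.
  rewrite Qoo leye_eq => /eqP ->.
  by rewrite poweRyr// invr_eq0 gt_eqF.
have Poo : wasserstein p P Q = +oo%E by exact: Too w0 w1 PE.
have U0 n o : wasserstein_fluctuation n o = 0%E.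
  rewrite /wasserstein_fluctuation Poo/=; case: n => [|n]; first by rewrite sqrt0 mul0r.
  have -> : wasserstein p (empirical_measure n.+1 (fun k => S k o)) Q = +oo%E.
  apply: (@Too n (const_mx n.+1%:R^-1) (fun k => S k o)).
  - by move=> k; rewrite mxE invr_gt0.
  - under eq_bigr do rewrite mxE.
    by rewrite sumr_const card_ord -[(_ *+ _)]mulr_natl divff.
  - by move=> A _; exact: empirical_measureE.
  by rewrite subrr mulr0.
have V0 o : wasserstein_limit o = 0%E.
  rewrite /wasserstein_limit /gaussian_limit Poo poweRyr ?subr_eq0// mulry gtr0_sg// mul1e.
  by rewrite invey mul0e.
split.
- by move=> n; rewrite (_ : wasserstein_fluctuation n = cst 0%E)//; apply/funext => o; exact: U0.
- by rewrite (_ : wasserstein_limit = cst 0%E)//; apply/funext => o; exact: V0.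
move=> f cf [M fM].
rewrite (_ : f \o wasserstein_limit = cst (f 0%E)); last by apply/funext => o /=; rewrite V0.
rewrite (_ : (fun n => _) = (fun=> expectation Pr' (cst (f 0%E)))); first exact: cvg_cst.
apply/funext => n.
rewrite (_ : f \o wasserstein_fluctuation n = cst (f 0%E)); last by apply/funext => o /=; rewrite U0.
by rewrite !expectation_cst.
Qed.

Hypothesis x_inj : injective x.
Hypothesis iidS : iid_sample P S.
Hypothesis gY : centered_gaussian_vector (multinomial_cov w) Y.

Lemma wasserstein_clt_finite_moment :
    (forall z, Q.-integrable setT (EFin \o dist_pow p z)) ->
  cvg_in_distribution Pr Pr' wasserstein_fluctuation wasserstein_limit.
Proof.
move=> Ip.
have [del del0 wdel] := ex_weight_lb w0.
have [zw _] := transport_cost_maximiser sZ Ip w0 w1 PE.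
set t0 := dual _ _ _ _ => TE.
have t0_ge0 := transport_cost_real_ge0 sZ w0 w1 PE Ip TE.
pose C k y := dist_pow p (x k) y.
have mC k : measurable_fun setT (C k) by exact: measurable_cost_section (measurable_dist_pow p sZ) _.
have C0 k y : 0 <= C k y by exact: dist_pow_ge0.
have IC k : Q.-integrable setT (EFin \o C k) by exact: Ip.
pose sigma := support_fun Q C w del.
have WE : wasserstein p P Q = (t0 `^ p^-1)%:E by rewrite /wasserstein TE poweR_EFin.
have UE n o : wasserstein_fluctuation n o = (sample_deviation p Q S t0 n o)%:E.
  by rewrite /wasserstein_fluctuation WE.
have mU := measurable_sample_deviation S sZ Ip t0.
have mV : measurable_fun setT wasserstein_limit.
  exact: (measurable_gaussian_limit Y sZ w0 w1 PE Ip TE del0 wdel).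
have Vae k := gaussian_limit_ae sZ w0 w1 PE gY Ip TE del0 wdel k.
split=> //.
  by move=> n; rewrite (funext (UE n)); apply/measurable_EFinP; exact: mU.
move=> f cf [M fM].
pose F : R -> R := f \o EFin.
have cF : continuous F by exact: continuous_comp_EFin.
have mF : measurable_fun setT F by exact: continuous_measurable_fun.
have FM s : `|F s| <= M by exact: fM.
have mfV : measurable_fun setT (f \o wasserstein_limit) by exact: measurable_continuous_ereal.
rewrite (bounded_expectation Pr' mfV (fun o => fM _)).
rewrite (_ : (fun n => _) = (fun n => (\int[Pr]_o F (sample_deviation p Q S t0 n o))%:E)); last first.
  apply/funext => n; rewrite (_ : f \o _ = F \o sample_deviation p Q S t0 n); last first.
    by apply/funext => o /=; rewrite UE.
  have mFs := measurableT_comp mF (mU n).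
  exact: (bounded_expectation Pr mFs (fun o => FM _)).
apply: cvg_EFin; first exact: nearW.
suff [l Ul ->] : exists2 l, \int[Pr]_o F (sample_deviation p Q S t0 n o) @[n --> \oo] --> l &
    \int[Pr']_o f (wasserstein_limit o) = l by exact: Ul.
(* In both regimes of zero cost with [p > 1] the limit is almost surely constant. *)
have Vcst c : {ae Pr', forall o, wasserstein_limit o = c} ->
    \int[Pr']_o f (wasserstein_limit o) = f c.
  move=> Vc; transitivity (\int[Pr']_o (cst (f c) o)).
    by apply: ae_eq_bounded_Rintegral => //; apply: filterS Vc => o ->.
  by rewrite Rintegral_cst//= probability_setT mulr1.
have [tp|] := pselect (0 < t0 \/ p = 1).
  exists (\int[Pr']_o F (slope p t0 * sigma (rvec Y o))).
    exact: (cvg_sample_linear sZ p1 x_inj w0 w1 PE iidS gY Ip TE del0 wdel tp cF FM).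
  apply: ae_eq_bounded_Rintegral => //.
    apply: measurableT_comp => //; apply: measurable_funM => //.
    apply: (lipschitz_rvec_measurable Y (C := box_radius Q C del)).
      exact: box_radius_ge0.
    exact: support_fun_lipschitz.
  apply: filterS (Vae (p%:E * wasserstein p P Q `^ (p - 1))^-1%E) => o.
  rewrite /wasserstein_limit WE => ->.
  by rewrite normalisation_slope.
move=> /not_orP[/negP]; rewrite -leNgt => t0le /eqP pn1.
have t00 : t0 = 0 by apply/eqP; rewrite eq_le t0le.
have p1' : 1 < p by rewrite lt_neqAle eq_sym pn1.
have kE : ((p%:E * wasserstein p P Q `^ (p - 1))^-1 = +oo)%E.
  rewrite WE t00 poweR_EFin powR0 ?invr_eq0 ?gt_eqF//.
  by rewrite powR0 ?mule0 ?inve0// subr_eq0.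
have TE0 : transport_cost (dist_pow p) P Q = 0%E by rewrite TE t00.
have [N0|N0] := posnP N'.
  exists (F 0).
    by under eq_fun do rewrite (sample_degenerate sZ x_inj w0 w1 PE iidS Ip TE)//; exact: cvg_cst.
  apply: (Vcst 0%E); have H0 := gaussian_sum0 w1 gY; have HV := Vae +oo%E.
  move: H0 HV; apply: filterS2 => o o0.
  rewrite /wasserstein_limit kE => ->.
  have rs : \sum_i rvec Y o 0 i = 0 by rewrite -[RHS]o0; apply: eq_bigr => i _; rewrite mxE.
  rewrite (sum0_degenerate N0 rs).
  by rewrite (support_fun0 mC C0 IC del0 wdel w1) mule0.
exists (f +oo%E).
  apply: (cvg_sample_escape sZ x_inj w0 w1 PE iidS gY Ip TE del0 wdel) => //.
  by move=> e e0; exact: continuous_at_pinfty.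
apply: Vcst.
have cov00 := multinomial_cov00_gt0 w0 w1 N0.
have [e e0 He] := zero_cost_support_fun sZ p1' x_inj w0 w1 PE Ip TE0 del0 wdel.
have Y0 : {ae Pr', forall o, Y 0 o <> 0}.
  exists [set o | Y 0 o = 0]; split.
  - rewrite -[X in measurable X]setTI.
    exact: (measurable_funP (Y 0) measurableT _ (measurable_set1 0)).
  - exact: (multinomial_coord_eq0 gY cov00).
  - by move=> o /= /contrapT.
have H0 := gaussian_sum0 w1 gY; have HV := Vae +oo%E.
move: H0 HV Y0; apply: filterS3 => o o0.
rewrite /wasserstein_limit kE => -> Y0.
(* The support function is at least [e |Y 0|], almost surely positive, so its product with [+oo] is
   [+oo]. *)
rewrite gt0_mulye// lte_fin.
have rs : \sum_i rvec Y o 0 i = 0 by rewrite -[RHS]o0; apply: eq_bigr => i _; rewrite mxE.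
apply: lt_le_trans (He _ rs); rewrite mulr_gt0// normr_gt0 mxE; exact/eqP.
Qed.

End main.

Local Open Scope ereal_scope.

Theorem corollary2p5 (R : realType) (d : measure_display)
    (Z : borelMetricType d R) (hZ : polish R Z)
    (X : set Z) (hX : polish R (set_type X))
    (m : nat) (x : 'I_m -> Z) (xX : forall k, X (x k)) (x_inj : injective x)
    (w : 'rV[R]_m) (w_gt0 : forall k, (0 < w 0 k)%R)
    (w_sum1 : (\sum_k w 0 k = 1)%R)
    (P : probability Z R)
    (hP : forall A : set Z, measurable A ->
       P A = \sum_(k < m) (w 0 k)%:E * \d_(x k) A)
    (Q : probability Z R)
    (hQ : exists2 x0 : Z, X x0 & \int[Q]_y (mdist y x0)%:E < +oo)
    (d1 : measure_display) (Omega : measurableType d1)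
    (Pr : probability Omega R)
    (S : nat -> {RV Pr >-> Z}) (hS : iid_sample P S)
    (d2 : measure_display) (Omega' : measurableType d2)
    (Pr' : probability Omega' R)
    (Y : 'I_m -> {RV Pr' >-> R})
    (hY : centered_gaussian_vector (multinomial_cov w) Y)
    (p : R) (p_ge1 : (1 <= p)%R) :
  cvg_in_distribution Pr Pr'
    (fun n omega =>
       (Num.sqrt n%:R *
          (fine (wasserstein p (empirical_measure n (fun k => S k omega)) Q) -
           fine (wasserstein p P Q)))%:E)
    (fun omega =>
       (p%:E * wasserstein p P Q `^ (p - 1))^-1 *
       ereal_sup [set (\sum_i z 0 i * Y i omega)%:E | z in Opt x w P Q p]).
Proof.
case: m => [|N'] in x xX x_inj w w_gt0 w_sum1 hP Y hY *.
  by move: w_sum1; rewrite big_ord0 => /esym/eqP; rewrite oner_eq0.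
have p_ge0 : (0 <= p)%R by exact: le_trans p_ge1.
have [Ip|Qoo] := dist_pow_moment Q hZ.1 p_ge0.
  exact: (wasserstein_clt_finite_moment hZ.1 p_ge1 w_gt0 w_sum1 hP x_inj hS hY Ip).
apply: (wasserstein_clt_infinite_moment S Y hZ.1 p_ge1 w_gt0 w_sum1 hP _ Qoo).
(* For [p = 1] the second alternative, taken with the single point [x0], contradicts the first
   moment assumption. *)
apply/eqP => pE; have [x0 _] := hQ.
have := Qoo 0%N (fun=> x0); rewrite pE => Q1.
rewrite (_ : \int[Q]_y _ = +oo) ?ltxx//; rewrite -[RHS]Q1; apply: eq_integral => y _.
have [i ->] := min_cost_attained (fun=> dist_pow 1 x0) (0 : 'rV[R]_1) y.
by rewrite mxE subr0 /dist_pow powRr1 ?mdist_ge0// metric_sym.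
Qed.
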